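(* Let $\mathcal X$ be a complex Banach space, $s<0$, $0<p<\infty$ and $1\le q<\infty$. Then $$H^p(\mathcal X)\cdot F^s_{\infty,q}\subset F^s_{p,q}(\mathcal X),$$ i.e. there is $C$ such that $\|gh\|_{F^s_{p,q}(\mathcal X)}\le C\|g\|_{H^p(\mathcal X)}\|h\|_{F^s_{\infty,q}}$ for all $g\in H^p(\mathcal X)$, $h\in F^s_{\infty,q}$. Moreover, if $\mathcal H$ is an infinite-dimensional separable complex Hilbert space, then there exists $f\in F^s_{1,2}(\mathcal H)$ such that $f\neq gh$ for every $g\in H^1(\mathcal H)$ and every $h\in F^s_{\infty,2}$.
   Context: Notation: $\mathbb D$ unit disc, $\mathbb T$ unit circle, $\zeta_x=e^{2\pi ix}$, $dx$ normalized arc length, $|I|$ normalized length of an arc. $\mathcal A(\mathcal X)$: analytic functions $\mathbb D\to\mathcal X$. $H^p(\mathcal X)$: $f\in\mathcal A(\mathcal X)$ with $\|f\|_{H^p(\mathcal X)}=\sup_{0<r<1}(\int_{\mathbb T}\|f(r\zeta_x)\|_{\mathcal X}^pdx)^{1/p}<\infty$. Dyadic arcs $\mathcal D(\mathbb T)$: images of $[2^{-j}k,2^{-j}(k+1))$, $j\ge0$, $0\le k<2^j$. Stolz angle $\Gamma(\zeta_x)$: convex hull of $\{\zeta_x\}\cup\{|w|=1/2\}$. Tent $T(E)=\mathbb D\setminus\bigcup_{\zeta\notin E}\Gamma(\zeta)$. $A_qF(\zeta_x)=(\int_{\Gamma(\zeta_x)}|F(z)|^q(1-|z|)^{-2}dA(z))^{1/q}$;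 $\|F\|_{T_{p,q}}=\|A_qF\|_{L^p(\mathbb T)}$ for $p<\infty$; $\|F\|_{T_{\infty,q}}^q=\sup_{I\in\mathcal D(\mathbb T)}|I|^{-1}\int_{T(I)}|F|^q(1-|z|)^{-1}dA$. $T_{p,q}(\mathcal X)$: strongly measurable $F:\mathbb D\to\mathcal X$ with $\|F\|_{\mathcal X}\in T_{p,q}$, norm $\|\,\|F\|_{\mathcal X}\|_{T_{p,q}}$. For $s<0$, $0<p\le\infty$, $1\le q<\infty$: $F^s_{p,q}(\mathcal X)=\{f\in\mathcal A(\mathcal X):\|(1-|z|)^{-s}f\|_{T_{p,q}(\mathcal X)}<\infty\}$ with that norm; $F^s_{p,q}=F^s_{p,q}(\mathbb C)$. *)

(* Defs.v *)
(* mathcomp-analysis over an abstract R : realType,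
   complex numbers C = R[i] (mathcomp-real-closed). *)
From mathcomp Require Import all_boot all_order all_algebra.
From mathcomp Require Import all_classical all_reals all_analysis.
From mathcomp Require Export complex.
Import numFieldNormedType.Exports.
Import Order.TTheory GRing.Theory Num.Theory.

Set Implicit Arguments.
Unset Strict Implicit.
Unset Printing Implicit Defensive.

Local Open Scope classical_set_scope.
Local Open Scope ring_scope.
Local Open Scope complex_scope.

(** The complex plane as a normed module over itself (for derivatives). *)
Notation CC R := ((R[i])^o).

Section defs.
Variable R : realType.

(** real-valued norm: the norms of normed R[i]-modules take values in R[i]
    (with zero imaginary part); we take the real part. *)
Definition rnorm (V : normedModType R[i]) (v : V) : R := complex.Re `|v|.
(** complex modulus |z| *)
Definition cabs (z : R[i]) : R := complex.Re `|z|.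

(** zeta_x = e^{2 pi i x} *)
Definition zeta (x : R) : R[i] := (cos (2 * pi * x)) +i* (sin (2 * pi * x)).

(** identification R^2 ~ C, used for the area measure dA *)
Definition toC (p : R * R) : R[i] := p.1 +i* p.2.

Definition disc : set R[i] := [set z | cabs z < 1].
Definition circle : set R[i] := [set z | cabs z = 1].

(** convex hull in C (viewed as a real vector space) *)
Definition convexC (K : set R[i]) : Prop :=
  forall a b t, K a -> K b -> 0 <= t <= 1 ->
    K (t%:C * a + (1 - t)%:C * b).
Definition hullC (S : set R[i]) : set R[i] :=
  \bigcap_(K in [set K | convexC K /\ S `<=` K]) K.

(** Stolz angle Gamma(zeta) *)
Definition stolz (zt : R[i]) : set R[i] :=
  hullC ([set zt] `|` [set w | cabs w = 2^-1]).

(** Tent T(E) = D \ U_{zeta in T, zeta notin E} Gamma(zeta) *)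
Definition tent (E : set R[i]) : set R[i] :=
  disc `\` \bigcup_(zt in [set zt | circle zt /\ ~ E zt]) stolz zt.

(** dyadic arc: image of [2^-j k, 2^-j (k+1)) under x |-> zeta_x *)
Definition dyadic_arc (j k : nat) : set R[i] :=
  zeta @` `[(2 ^- j * k%:R)%R, (2 ^- j * k.+1%:R)%R[.

(** area integral (Lebesgue measure on R^2 = C) of a nonnegative function *)
Definition area_int (A : set R[i]) (u : R[i] -> R) : \bar R :=
  (\int[(@lebesgue_measure R) \x (@lebesgue_measure R)]_(p in toC @^-1` A)
      (u (toC p))%:E)%E.

(** normalized arc-length integral over T, parametrized by x in [0,1) *)
Definition circ_int (u : R -> \bar R) : \bar R :=
  (\int[@lebesgue_measure R]_(x in `[0%R, 1%R[) u x)%E.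

(** A_q F (zeta) for a nonnegative function u = |F| *)
Definition Aq (q : R) (u : R[i] -> R) (zt : R[i]) : \bar R :=
  (area_int (stolz zt) (fun z => (u z `^ q * (1 - cabs z) ^- 2)%R) `^ q^-1)%E.

(** tent space quasi-norm ||u||_{T_{p,q}}, 0 < p < oo *)
Definition Tnorm (p q : R) (u : R[i] -> R) : \bar R :=
  (circ_int (fun x => Aq q u (zeta x) `^ p) `^ p^-1)%E.

(** ||u||_{T_{oo,q}}: (sup over dyadic arcs I of |I|^-1 int_{T(I)} ...)^{1/q} *)
Definition Tinfnorm (q : R) (u : R[i] -> R) : \bar R :=
  (ereal_sup [set e | exists j k : nat, (k < 2 ^ j)%N /\
       e = ((2 ^ j)%N%:R%:E * area_int (tent (dyadic_arc j k))
                 (fun z => (u z `^ q * (1 - cabs z)^-1)%R))%E] `^ q^-1)%E.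

(** analytic (holomorphic) functions D -> X *)
Definition analytic (X : normedModType R[i]) (f : CC R -> X) : Prop :=
  forall z : CC R, cabs z < 1 -> derivable f z 1.

(** Hardy space norm ||f||_{H^p(X)} *)
Definition Hnorm (X : normedModType R[i]) (p : R) (f : CC R -> X) : \bar R :=
  ereal_sup [set (circ_int (fun x => (rnorm (f (r%:C * zeta x)) `^ p)%:E)
                    `^ p^-1)%E | r in `]0%R, 1%R[].

(** ||f||_{F^s_{p,q}(X)} = ||(1-|z|)^{-s} f||_{T_{p,q}(X)}, 0 < p < oo *)
Definition Fnorm (X : normedModType R[i]) (s p q : R) (f : CC R -> X) : \bar R :=
  Tnorm p q (fun z => (1 - cabs z) `^ (- s) * rnorm (f z)).

(** ||h||_{F^s_{oo,q}(X)} *)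
Definition Finfnorm (X : normedModType R[i]) (s q : R) (f : CC R -> X) : \bar R :=
  Tinfnorm q (fun z => (1 - cabs z) `^ (- s) * rnorm (f z)).

(** complex Hilbert space: the norm comes from an inner product *)
Definition hilbert (H : normedModType R[i]) : Prop :=
  exists ip : H -> H -> R[i],
    (forall (a : R[i]) (x y z : H), ip (a *: x + y) z = a * ip x z + ip y z) /\
    (forall x y, ip y x = (ip x y)^*) /\
    (forall x, `|x| ^+ 2 = ip x x).

Definition separable_space (H : normedModType R[i]) : Prop :=
  exists d : nat -> H, closure (range d) = setT.

Definition infinite_dimensional (H : normedModType R[i]) : Prop :=
  forall (n : nat) (v : 'I_n -> H), exists x : H,
    forall c : 'I_n -> R[i], x <> \sum_(i < n) c i *: v i.

End defs.

(* Main.v *)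
(** Part 1.  Write [d = 1 - |z|] and let [kap] be the [q]-th power of the norm
    of [h].  The dyadic tents miss the Stolz angles over dyadic points, so the
    pointwise bound [d^(-s) |h| <= C kap^(1/q)] is not immediate: near the ends
    of an arc, [h] is only controlled on part of a circle.  A product of
    rotations of [h] about the centre of that circle improves any power bound on
    [h], and iterating reaches the exponent [s].  Hence the masses of
    [(d^(-s) |h|)^q dA / d] over Whitney boxes satisfy a Carleson condition on
    the dyadic tree.  On the other side [|g|^(1/m)] is dominated on each box by
    a discretised Poisson integral of its boundary values, which reduces a
    nontangential maximal function to an [l^2] bound for a linearised family of
    Poisson kernels; this is proved by a [T T^*] argument.  The two are combined
    by a Carleson embedding on finite dyadic trees.
    Part 2.  [f z = sum_n z^n / sqrt (n + 1) e_n], with [e_n] orthonormal, has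
    [|f z|^2 = sum_n |z|^(2n) / (n + 1)], logarithmic in [1 / (1 - |z|)].  If
    [f = h g], then [h] has no zero and [|g| = |f| / |h|]; as [|f|] is radial
    and the mean of [1 / |h|] on circles is at least [1 / |h 0|], the means of
    [|g|] are unbounded.
    Cauchy's theorem is needed only through the mean value property, which follows
    from Goursat's argument in logarithmic polar coordinates with Riemann sums. *)

(* The bound on [h] is indispensable at the two ends of an arc: in each generation up to four cells
   there have boxes that need not lie in the tent, and their masses become a geometric series. The
   root of [g] is chosen with [(m + 1) p >= 2]. Jensen's inequality then brings every [p] to the
   exponent 2, where the [T T^*] argument works. The boundary values are those of a dilate of [g],
   taken on the circle of radius [1 - 2^(- n0 - 4)] and replaced by step functions; only [n0]
   generations are summed, and monotone convergence supplies the rest. Stolz angles and tents enter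
   through pointwise comparisons of nonnegative integrands, the integral being a supremum over
   simple functions below. The area mean value property comes from rotations instead of polar
   coordinates: averages over rotated copies have the same integral, and rotations preserve area as
   products of shears. *)
Require Import Defs.
From mathcomp Require Import all_boot all_order all_algebra.
From mathcomp Require Import all_classical all_reals all_analysis.
From mathcomp Require Import measurable_realfun complex ring lra zify.
Import numFieldNormedType.Exports.
Import Order.TTheory GRing.Theory Num.Theory.
Set Implicit Arguments.
Unset Strict Implicit.
Unset Printing Implicit Defensive.
Local Open Scope classical_set_scope.
Local Open Scope ring_scope.
Local Open Scope complex_scope.

(** * Complex differentiability *)

(* Reflexive decision of additive identities: [ring] does not apply to vectors. *)
Inductive zexp := ZO | ZV of nat | ZA of zexp & zexp | ZN of zexp.

Section zmod_reflection.
Variable V : zmodType.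

Fixpoint zeval (env : seq V) e : V :=
  match e with
  | ZO => 0 | ZV n => nth 0 env n
  | ZA a b => zeval env a + zeval env b | ZN a => - zeval env a
  end.

Fixpoint zcoef (n : nat) e : int :=
  match e with
  | ZO => 0 | ZV m => if m == n then 1 else 0
  | ZA a b => zcoef n a + zcoef n b | ZN a => - zcoef n a
  end.

Lemma zevalE env e :
  zeval env e = \sum_(i < size env) nth 0 env i *~ zcoef i e.
Proof.
elim: e => [|m|a iha b ihb|a iha] /=; rewrite ?iha ?ihb.
- by rewrite big1.
- have [mlt|mge] := ltnP m (size env).
    rewrite (bigD1 (Ordinal mlt)) //= eqxx big1 ?addr0 // => i /negbTE.
    by rewrite -val_eqE /= eq_sym => ->.
  rewrite nth_default // big1 // => i _; case: eqP => // mi.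
  by rewrite mi leqNgt ltn_ord in mge.
- by rewrite -big_split /=; apply: eq_bigr => i _; rewrite mulrzDr.
- by rewrite -sumrN; apply: eq_bigr => i _; rewrite mulrNz.
Qed.

Lemma zeval_eq env a b :
  all (fun n => zcoef n a == zcoef n b) (iota 0 (size env)) ->
  zeval env a = zeval env b.
Proof.
move=> /allP h; rewrite !zevalE; apply: eq_bigr => i _.
by rewrite (eqP (h i _)) // mem_iota /=.
Qed.
End zmod_reflection.

Ltac zmod_mem x l := lazymatch l with
  | nil => constr:(false)
  | ?y :: ?l' => match constr:(Set) with
    | _ => let u := match constr:(Set) with _ => unify x y end in constr:(true)
    | _ => zmod_mem x l' end
  end.
Ltac zmod_index x l := lazymatch l with
  | ?y :: ?l' => match constr:(Set) with
    | _ => let u := match constr:(Set) with _ => unify x y end in constr:(O)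
    | _ => let n := zmod_index x l' in constr:(S n) end
  end.
Ltac zmod_vars e l := lazymatch e with
  | ?a + ?b => let l1 := zmod_vars a l in zmod_vars b l1
  | - ?a => zmod_vars a l
  | 0 => l
  | _ => lazymatch zmod_mem e l with true => l | false => constr:(e :: l) end
  end.
Ltac zmod_reify e l := lazymatch e with
  | ?a + ?b => let x := zmod_reify a l in let y := zmod_reify b l in constr:(ZA x y)
  | - ?a => let x := zmod_reify a l in constr:(ZN x)
  | 0 => constr:(ZO)
  | _ => let n := zmod_index e l in constr:(ZV n)
  end.
Ltac zmod := lazymatch goal with |- @eq ?T ?a ?b =>
  let l := zmod_vars a (@nil T) in let l := zmod_vars b l in
  let x := zmod_reify a l in let y := zmod_reify b l in
  refine (@zeval_eq _ l x y _); vm_compute; reflexivity end.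

Section modulus.
Context {R : realType}.
Implicit Types (z w : R[i]) (x y : R).

Lemma cabsE z : cabs z = Num.sqrt ((complex.Re z) ^+ 2 + (complex.Im z) ^+ 2).
Proof. by rewrite /cabs normc_def. Qed.

Lemma normC_cabs z : `|z| = (cabs z)%:C.
Proof. by rewrite normc_def cabsE. Qed.

Lemma cabs_ge0 z : 0 <= cabs z.
Proof. by rewrite cabsE sqrtr_ge0. Qed.

Lemma cabs0 : cabs (0 : R[i]) = 0.
Proof. by rewrite /cabs normr0. Qed.

Lemma cabs1 : cabs (1 : R[i]) = 1.
Proof. by rewrite /cabs normr1. Qed.

Lemma cabs_eq0 z : (cabs z == 0) = (z == 0).
Proof. by rewrite -[RHS]normr_eq0 normC_cabs (inj_eq (@complexI _)). Qed.

Lemma cabs_gt0 z : (0 < cabs z) = (z != 0).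
Proof. by rewrite lt_def cabs_eq0 cabs_ge0 andbT. Qed.

Lemma cabsM z w : cabs (z * w) = cabs z * cabs w.
Proof. by apply: complexI; rewrite -normC_cabs normrM !normC_cabs rmorphM. Qed.

Lemma cabsN z : cabs (- z) = cabs z.
Proof. by rewrite /cabs normrN. Qed.

Lemma cabsV z : cabs z^-1 = (cabs z)^-1.
Proof. by apply: complexI; rewrite -normC_cabs normfV normC_cabs fmorphV. Qed.

Lemma cabsX z n : cabs (z ^+ n) = cabs z ^+ n.
Proof. by elim: n => [|n IH]; rewrite ?expr0 ?cabs1 // !exprS cabsM IH. Qed.

Lemma cabsB z w : cabs (z - w) = cabs (w - z).
Proof. by rewrite -cabsN opprB. Qed.

Lemma cabsD z w : cabs (z + w) <= cabs z + cabs w.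
Proof. by rewrite -lecR -normC_cabs rmorphD /= -!normC_cabs ler_normD. Qed.

Lemma cabs_sub z w : cabs z - cabs w <= cabs (z - w).
Proof. by rewrite lerBlDr; apply: le_trans (cabsD _ _); rewrite subrK. Qed.

Lemma cabsR x : cabs x%:C = `|x|.
Proof. by rewrite cabsE /= expr0n /= addr0 sqrtr_sqr. Qed.

Lemma cabs_sqr z : cabs z ^+ 2 = complex.Re z ^+ 2 + complex.Im z ^+ 2.
Proof. by rewrite cabsE sqr_sqrtr // addr_ge0 // sqr_ge0. Qed.

Lemma ler_Re z : `|complex.Re z| <= cabs z.
Proof. by rewrite cabsE -sqrtr_sqr ler_wsqrtr // lerDl sqr_ge0. Qed.

Lemma ler_Im z : `|complex.Im z| <= cabs z.
Proof. by rewrite cabsE -sqrtr_sqr ler_wsqrtr // lerDr sqr_ge0. Qed.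

Lemma cabs_le_ReIm z : cabs z <= `|complex.Re z| + `|complex.Im z|.
Proof.
rewrite -(@ler_pXn2r _ 2) // ?nnegrE ?cabs_ge0 ?addr_ge0 // cabs_sqr.
rewrite sqrrD !real_normK ?num_real // lerD2r lerDl mulrn_wge0 // mulr_ge0 //.
Qed.

Lemma cabs_conj z : cabs z^*%C = cabs z.
Proof. by rewrite !cabsE; case: z => a b /=; rewrite sqrrN. Qed.

Lemma cabs_prod I (r : seq I) (P : pred I) (F : I -> R[i]) :
  cabs (\prod_(i <- r | P i) F i) = \prod_(i <- r | P i) cabs (F i).
Proof. by apply: big_morph => [z w|]; rewrite ?cabsM ?cabs1. Qed.

Lemma ReD z w : complex.Re (z + w) = complex.Re z + complex.Re w.
Proof. by case: z w => [a b] [c d]. Qed.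

Lemma ReB z w : complex.Re (z - w) = complex.Re z - complex.Re w.
Proof. by case: z w => [a b] [c d]. Qed.

Lemma ImB z w : complex.Im (z - w) = complex.Im z - complex.Im w.
Proof. by case: z w => [a b] [c d]. Qed.

Lemma Re_sum I (r : seq I) (P : pred I) (F : I -> R[i]) :
  complex.Re (\sum_(i <- r | P i) F i) = \sum_(i <- r | P i) complex.Re (F i).
Proof. by apply: big_morph => // z w; rewrite ReD. Qed.

Section vectors.
Context {X : normedModType R[i]}.
Implicit Types u v : X.

Lemma norm_rnorm v : `|v| = (rnorm v)%:C.
Proof.
have : `|v| \is Num.real by rewrite ger0_real.
by rewrite /rnorm; case/complex_realP => x ->.
Qed.

Lemma rnorm_ge0 v : 0 <= rnorm v.
Proof. by rewrite -lecR -norm_rnorm normr_ge0. Qed.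

Lemma rnorm0 : rnorm (0 : X) = 0.
Proof. by rewrite /rnorm normr0. Qed.

Lemma rnorm_eq0 v : (rnorm v == 0) = (v == 0).
Proof. by rewrite -[RHS]normr_eq0 norm_rnorm (inj_eq (@complexI _)). Qed.

Lemma rnormN v : rnorm (- v) = rnorm v.
Proof. by rewrite /rnorm normrN. Qed.

Lemma rnormB u v : rnorm (u - v) = rnorm (v - u).
Proof. by rewrite -rnormN opprB. Qed.

Lemma rnormD u v : rnorm (u + v) <= rnorm u + rnorm v.
Proof. by rewrite -lecR -norm_rnorm rmorphD /= -!norm_rnorm ler_normD. Qed.

Lemma rnormZ z v : rnorm (z *: v) = cabs z * rnorm v.
Proof.
by apply: complexI; rewrite -norm_rnorm normrZ norm_rnorm normC_cabs rmorphM.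
Qed.

Lemma rnorm_sub u v : rnorm u - rnorm v <= rnorm (u - v).
Proof. by rewrite lerBlDr; apply: le_trans (rnormD _ _); rewrite subrK. Qed.

Lemma rnorm_sum I (r : seq I) (P : pred I) (F : I -> X) :
  rnorm (\sum_(i <- r | P i) F i) <= \sum_(i <- r | P i) rnorm (F i).
Proof.
by elim/big_ind2: _ => [|z1 x1 z2 x2 h1 h2|//]; rewrite ?rnorm0 //;
  apply: le_trans (rnormD _ _) _; apply: lerD.
Qed.

End vectors.

Lemma rnorm_cabs (z : CC R) : rnorm z = cabs z.
Proof. by []. Qed.

End modulus.

Section cderiv.
Context {R : realType}.

(** A bound on the first-order remainder in place of a limit of quotients: [eps] and [delta] are
    real and [w = 0] is no exception. *)
Definition cderiv (X : normedModType R[i]) (f : R[i] -> X) (z : R[i]) (D : X) :=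
  forall e : R, 0 < e -> exists2 d : R, 0 < d &
    forall w, cabs w < d -> rnorm (f (z + w) - f z - w *: D) <= e * cabs w.

Definition cdiff (X : normedModType R[i]) (f : R[i] -> X) (z : R[i]) :=
  exists D, cderiv f z D.

Definition ccont (X : normedModType R[i]) (f : R[i] -> X) (z : R[i]) :=
  forall e : R, 0 < e -> exists2 d : R, 0 < d &
    forall w, cabs (w - z) < d -> rnorm (f w - f z) < e.

Lemma posC (e : R[i]) : 0 < e -> exists2 x : R, 0 < x & e = x%:C.
Proof.
move=> e0; have : e \is Num.real by rewrite gtr0_real.
by case/complex_realP => x ex; exists x => //; rewrite -ltcR -ex.
Qed.

(** Positive elements of [R[i]] are real, so an [eps] for the complex-valued norm is a real one; the
    difference quotient times [w] gives the remainder. *)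
Lemma derivable_cdiff (X : normedModType R[i]) (f : CC R -> X) (z : CC R) :
  derivable f z 1 <-> cdiff f z.
Proof.
split.
- move=> /cvg_ex[D]/cvgrPdist_le /= fD; exists D => e e0.
  have /fD : 0 < e%:C by rewrite ltcR.
  rewrite near_withinE => /nbhs_ballP[d /= /posC[d' d'0 ->] dball].
  exists d' => // w wd; have [->|w0] := eqVneq w 0.
    by rewrite addr0 subrr scale0r subr0 rnorm0 cabs0 mulr0.
  have /dball/(_ w0) : ball (0 : CC R) d'%:C w.
    by rewrite -ball_normE /= sub0r normrN normC_cabs ltcR.
  rewrite norm_rnorm lecR => h.
  have -> : f (z + w) - f z - w *: D = - (w *: (D - w^-1 *: (f (w *: 1 + z) - f z))).
    rewrite scalerBr scalerA divff // scale1r opprB.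
    by rewrite -[w *: 1]/(w * 1) mulr1 [w + z]addrC.
  by rewrite rnormN rnormZ mulrC ler_wpM2r // cabs_ge0.
- move=> [D fD]; apply/cvg_ex; exists D; apply/cvgrPdist_le => /= e /posC[e' e'0 ->].
  have [d d0 h] := fD _ e'0.
  rewrite near_withinE; apply/nbhs_ballP; exists d%:C => /=; first by rewrite ltcR.
  move=> w; rewrite -ball_normE /= sub0r normrN normC_cabs ltcR => wd w0.
  have := h _ wd.
  have -> : f (z + w) - f z - w *: D = - (w *: (D - w^-1 *: (f (w *: 1 + z) - f z))).
    rewrite scalerBr scalerA divff // scale1r opprB.
    by rewrite -[w *: 1]/(w * 1) mulr1 [w + z]addrC.
  by rewrite rnormN rnormZ mulrC ler_pM2r ?cabs_gt0 // norm_rnorm lecR.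
Qed.

Lemma cdiff_cont (X : normedModType R[i]) (f : R[i] -> X) z :
  cdiff f z -> ccont f z.
Proof.
move=> [D fD] e e0; have [d d0 h] := fD 1 ltr01.
have M0 : 0 < 1 + rnorm D by rewrite ltr_pwDl // rnorm_ge0.
exists (Num.min d (e / (1 + rnorm D))); first by rewrite lt_min d0 divr_gt0.
move=> w; rewrite lt_min => /andP[wd we].
have := h _ wd; rewrite subrKC mul1r => hw.
have -> : f w - f z = (f w - f z - (w - z) *: D) + (w - z) *: D by rewrite subrK.
apply: le_lt_trans (rnormD _ _) _; rewrite rnormZ.
apply: (@le_lt_trans _ _ (cabs (w - z) * (1 + rnorm D))).
  by rewrite mulrDr mulr1 lerD2r.
by rewrite -ltr_pdivlMr.
Qed.

Lemma cderiv_cst (X : normedModType R[i]) (c : X) z : cderiv (fun=> c) z 0.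
Proof.
move=> e e0; exists 1 => // w _.
by rewrite subrr scaler0 subr0 rnorm0 mulr_ge0 // ?cabs_ge0 // ltW.
Qed.

Lemma cdiff_cst (X : normedModType R[i]) (c : X) z : cdiff (fun=> c) z.
Proof. by exists 0; apply: cderiv_cst. Qed.

Lemma cdiff_id z : cdiff (fun w : R[i] => w : CC R) z.
Proof.
exists 1 => e e0; exists 1 => // w _.
rewrite (_ : _ - _ - _ = 0) ?rnorm0 ?mulr_ge0 ?cabs_ge0 ?(ltW e0) //.
by rewrite -[w *: _]/(w * 1); ring.
Qed.

Lemma cdiffD (X : normedModType R[i]) (f g : R[i] -> X) z :
  cdiff f z -> cdiff g z -> cdiff (fun w => f w + g w) z.
Proof.
move=> [D fD] [E gE]; exists (D + E) => e e0.
have e20 : 0 < e / 2 by rewrite divr_gt0.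
have [d1 d10 h1] := fD _ e20; have [d2 d20 h2] := gE _ e20.
exists (Num.min d1 d2); first by rewrite lt_min d10 d20.
move=> w; rewrite lt_min => /andP[/h1 w1 /h2 w2].
have -> : f (z + w) + g (z + w) - (f z + g z) - w *: (D + E) =
  (f (z + w) - f z - w *: D) + (g (z + w) - g z - w *: E).
  by rewrite scalerDr; zmod.
apply: le_trans (rnormD _ _) _; rewrite [e]splitr mulrDl; exact: lerD.
Qed.

Lemma cdiffN (X : normedModType R[i]) (f : R[i] -> X) z :
  cdiff f z -> cdiff (fun w => - f w) z.
Proof.
move=> [D fD]; exists (- D) => e /fD[d d0 h]; exists d => // w /h.
have -> : - f (z + w) - - f z - w *: - D = - (f (z + w) - f z - w *: D).
  by rewrite scalerN; zmod.
by rewrite rnormN.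
Qed.

Lemma cdiffZ (X : normedModType R[i]) (h : R[i] -> CC R) (g : R[i] -> X) z :
  cdiff h z -> cdiff g z -> cdiff (fun w => h w *: g w) z.
Proof.
move=> [D hD] gz; have gc := cdiff_cont gz; case: gz => E gE.
exists (h z *: E + D *: g z) => e e0.
have M0 : 0 < 1 + cabs (h z) + rnorm (g z) + cabs D.
  by rewrite -!addrA ltr_pwDl // !addr_ge0 // ?rnorm_ge0 ?cabs_ge0.
set M := 1 + _ + _ + _ in M0.
(* The remainder splits into three products, each at most [e' * M * |w|]; the 1 in the minimum keeps
   [|g (z + w)|] below [1 + |g z|]. *)
have eM : 0 < Num.min 1 (e / (3 * M)) by rewrite lt_min ltr01 divr_gt0 ?mulr_gt0.
set e' := Num.min _ _ in eM.
have e'M : e' * M <= e / 3.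
  apply: (@le_trans _ _ (e / (3 * M) * M)); last by rewrite invfM mulrA mulfVK ?gt_eqF.
  by rewrite ler_wpM2r ?(ltW M0) // ge_min lexx orbT.
have [d1 d10 h1] := hD _ eM; have [d2 d20 h2] := gE _ eM.
have [d3 d30 h3] := gc _ eM.
exists (Num.min d1 (Num.min d2 d3)); first by rewrite !lt_min d10 d20 d30.
move=> w; rewrite !lt_min => /and3P[/h1 w1 /h2 w2 w3].
have {}w3 : rnorm (g (z + w) - g z) < e' by apply: h3; rewrite addrAC subrr add0r.
have -> : h (z + w) *: g (z + w) - h z *: g z - w *: (h z *: E + D *: g z) =
  ((h (z + w) - h z - w * D) *: g (z + w) + h z *: (g (z + w) - g z - w *: E))
  + (w * D) *: (g (z + w) - g z).
  by rewrite !scalerBr !scalerBl scalerDr !scalerA [h z * w]mulrC; zmod.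
have gb : rnorm (g (z + w)) <= 1 + rnorm (g z).
  rewrite -lerBlDr; apply: le_trans (rnorm_sub _ _) _.
  by apply: le_trans (ltW w3) _; rewrite ge_min lexx.
have hM : cabs (h z) <= M by rewrite /M; have := rnorm_ge0 (g z); have := cabs_ge0 D; lra.
have DM : cabs D <= M by rewrite /M; have := rnorm_ge0 (g z); have := cabs_ge0 (h z); lra.
have gM : rnorm (g (z + w)) <= M.
  by rewrite /M; have := cabs_ge0 D; have := cabs_ge0 (h z); lra.
have b1 : rnorm ((h (z + w) - h z - w * D) *: g (z + w)) <= e / 3 * cabs w.
  rewrite rnormZ -[cabs _]/(rnorm (h (z + w) - h z - w *: D)).
  apply: (@le_trans _ _ (e' * cabs w * M)); last by rewrite mulrAC ler_wpM2r // cabs_ge0.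
  by apply: ler_pM => //; rewrite ?rnorm_ge0.
have b2 : rnorm (h z *: (g (z + w) - g z - w *: E)) <= e / 3 * cabs w.
  rewrite rnormZ; apply: (@le_trans _ _ (M * (e' * cabs w))).
    by apply: ler_pM => //; rewrite ?rnorm_ge0 ?cabs_ge0.
  by rewrite mulrA [M * _]mulrC ler_wpM2r // cabs_ge0.
have b3 : rnorm ((w * D) *: (g (z + w) - g z)) <= e / 3 * cabs w.
  rewrite rnormZ cabsM -mulrA mulrC ler_wpM2r ?cabs_ge0 //.
  apply: le_trans e'M; rewrite mulrC.
  by apply: ler_pM; rewrite ?rnorm_ge0 ?cabs_ge0 // ltW.
apply: le_trans (rnormD _ _) _.
have -> : e * cabs w = (e / 3 * cabs w + e / 3 * cabs w) + e / 3 * cabs w.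
  by rewrite -!mulrDl; congr (_ * _); field.
by apply: lerD => //; apply: le_trans (rnormD _ _) _; apply: lerD.
Qed.

Lemma cdiffM (f g : R[i] -> CC R) z :
  cdiff f z -> cdiff g z -> cdiff (fun w => f w * g w : CC R) z.
Proof. exact: cdiffZ. Qed.

Lemma cdiff_prod (I : Type) (r : seq I) (F : I -> R[i] -> CC R) z :
  (forall i, cdiff (F i) z) -> cdiff (fun w => \prod_(i <- r) F i w : CC R) z.
Proof.
move=> h; elim: r => [|i r IH].
  rewrite (_ : (fun _ => _) = fun=> 1); first exact: cdiff_cst.
  by apply/funext => w; rewrite big_nil.
rewrite (_ : (fun _ => _) = fun w => F i w * \prod_(j <- r) F j w); first exact: cdiffM.
by apply/funext => w; rewrite big_cons.
Qed.

Lemma cdiffX (f : R[i] -> CC R) n z :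
  cdiff f z -> cdiff (fun w => f w ^+ n : CC R) z.
Proof.
move=> h; elim: n => [|n IH].
  by rewrite (_ : (fun _ => _) = fun=> 1); [exact: cdiff_cst|].
rewrite (_ : (fun _ => _) = fun w => f w * f w ^+ n); first exact: cdiffM.
by apply/funext => w; rewrite exprS.
Qed.

Lemma cdiff_sum (X : normedModType R[i]) (I : Type) (r : seq I) (F : I -> R[i] -> X) z :
  (forall i, cdiff (F i) z) -> cdiff (fun w => \sum_(i <- r) F i w) z.
Proof.
move=> h; elim: r => [|i r IH].
  rewrite (_ : (fun _ => _) = fun=> 0); first exact: cdiff_cst.
  by apply/funext => w; rewrite big_nil.
rewrite (_ : (fun _ => _) = fun w => F i w + \sum_(j <- r) F j w); first exact: cdiffD.
by apply/funext => w; rewrite big_cons.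
Qed.

Lemma cdiffV (f : R[i] -> CC R) z :
  f z != 0 -> cdiff f z -> cdiff (fun w => (f w)^-1 : CC R) z.
Proof.
move=> f0 fz; have fc := cdiff_cont fz; case: fz => D fD.
have f0' : 0 < cabs (f z) by rewrite cabs_gt0.
set a := cabs (f z) in f0'.
exists (- D / (f z) ^+ 2) => e e0.
(* The bound [a / 2] keeps [|f (z + w)|] above [a / 2]; the other one makes the term in
   [w * D * (f (z + w) - f z)] at most [e / 2 * |w|]. *)
have [d3 d30 h3] : exists2 d, 0 < d & forall w, cabs (w - z) < d ->
    rnorm (f w - f z) < Num.min (a / 2) (e * a ^+ 3 / (4 * (1 + cabs D))).
  apply: fc; rewrite lt_min divr_gt0 //= divr_gt0 ?mulr_gt0 ?exprn_gt0 //.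
  by rewrite ltr_pwDl // cabs_ge0.
have [d1 d10 h1] := fD (e * a ^+ 2 / 4) ltac:(by rewrite divr_gt0 ?mulr_gt0 ?exprn_gt0).
exists (Num.min d1 d3); first by rewrite lt_min d10 d30.
move=> w; rewrite lt_min => /andP[/h1 w1 w3].
have : rnorm (f (z + w) - f z) < Num.min (a / 2) (e * a ^+ 3 / (4 * (1 + cabs D))).
  by apply: h3; rewrite addrAC subrr add0r.
rewrite lt_min => /andP[w4 w5].
have fw : a / 2 <= cabs (f (z + w)).
  have := rnorm_sub (f z) (f (z + w)); rewrite rnormB.
  rewrite -[rnorm (f z)]/a -[rnorm (f (z + w))]/(cabs _); move: w4; set x := rnorm _; lra.
have fw0 : f (z + w) != 0 by rewrite -cabs_gt0; apply: lt_le_trans fw; rewrite divr_gt0.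
have -> : (f (z + w))^-1 - (f z)^-1 - w *: (- D / f z ^+ 2) =
   - (f (z + w) - f z - w * D) / (f z * f (z + w))
   + w * D * (f (z + w) - f z) / (f z ^+ 2 * f (z + w)).
  rewrite -[w *: _]/(w * _); by field; rewrite f0 fw0.
have ci : (cabs (f (z + w)))^-1 <= 2 / a.
  by rewrite -[2 / a]invrK lef_pV2 ?posrE ?invf_div // ?divr_gt0 // cabs_gt0.
have b1 : cabs (- (f (z + w) - f z - w * D) / (f z * f (z + w))) <= e / 2 * cabs w.
  rewrite cabsM cabsV cabsM invfM -/a cabsN.
  apply: (@le_trans _ _ (e * a ^+ 2 / 4 * cabs w * (a^-1 * (2 / a)))).
    apply: ler_pM; rewrite ?cabs_ge0 ?mulr_ge0 ?invr_ge0 ?cabs_ge0 // ?(ltW f0') //.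
    by rewrite ler_wpM2l // invr_ge0 ltW.
  by rewrite le_eqVlt; apply/orP; left; apply/eqP; field; rewrite gt_eqF.
have b2 : cabs (w * D * (f (z + w) - f z) / (f z ^+ 2 * f (z + w))) <= e / 2 * cabs w.
  rewrite cabsM cabsV [cabs (f z ^+ 2 * _)]cabsM cabsX cabsM [cabs (w * D)]cabsM invfM -/a.
  apply: (@le_trans _ _ (cabs w * (1 + cabs D) * (e * a ^+ 3 / (4 * (1 + cabs D))) *
                      (a ^- 2 * (2 / a)))).
    apply: ler_pM; rewrite ?mulr_ge0 ?invr_ge0 ?cabs_ge0 ?exprn_ge0 // ?(ltW f0') //.
      apply: ler_pM; rewrite ?mulr_ge0 ?cabs_ge0 //; last exact: ltW.
      by rewrite ler_wpM2l ?cabs_ge0 // lerDr.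
    by rewrite ler_wpM2l // invr_ge0 exprn_ge0 // ltW.
  have D1 : 1 + cabs D != 0 by rewrite gt_eqF // ltr_pwDl // cabs_ge0.
  by rewrite le_eqVlt; apply/orP; left; apply/eqP; field; rewrite D1 gt_eqF.
rewrite rnorm_cabs [e]splitr mulrDl; apply: le_trans (cabsD _ _) _; exact: lerD.
Qed.

Lemma cdiff_comp (X : normedModType R[i]) (f : R[i] -> X) (g : R[i] -> CC R) z :
  cdiff g z -> cdiff f (g z) -> cdiff (fun w => f (g w)) z.
Proof.
move=> gz; have gc := cdiff_cont gz; case: gz => E gE [D fD].
exists (E *: D) => e e0.
have M0 : 0 < 2 * (1 + cabs E) by rewrite mulr_gt0 // ltr_pwDl // cabs_ge0.
have D0 : 0 < 2 * (1 + rnorm D) by rewrite mulr_gt0 // ltr_pwDl // rnorm_ge0.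
have [d1 d10 h1] := fD _ (divr_gt0 e0 M0).
have e'0 : 0 < Num.min 1 (e / (2 * (1 + rnorm D))) by rewrite lt_min ltr01 divr_gt0.
have [d2 d20 h2] := gE _ e'0.
have [d3 d30 h3] := gc _ d10.
exists (Num.min d2 d3); first by rewrite lt_min d20 d30.
move=> w; rewrite lt_min => /andP[/h2 w2 w3].
have gw : cabs (g (z + w) - g z) < d1.
  by apply: h3; rewrite addrAC subrr add0r.
have := h1 _ gw; rewrite subrKC => w1.
have -> : f (g (z + w)) - f (g z) - w *: (E *: D) =
  (f (g (z + w)) - f (g z) - (g (z + w) - g z) *: D)
   + (g (z + w) - g z - w *: E) *: D.
  by rewrite !scalerBl scalerA; zmod.
apply: le_trans (rnormD _ _) _; rewrite [e]splitr mulrDl; apply: lerD.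
  apply: le_trans w1 _.
  have : cabs (g (z + w) - g z) <= (1 + cabs E) * cabs w.
    have -> : g (z + w) - g z = (g (z + w) - g z - w * E) + w * E by rewrite subrK.
    apply: le_trans (cabsD _ _) _; rewrite mulrDl mul1r cabsM [cabs w * _]mulrC lerD2r.
    by apply: le_trans w2 _; rewrite -[leRHS]mul1r ler_wpM2r ?cabs_ge0 // ge_min lexx.
  move=> h; apply: (@le_trans _ _ (e / (2 * (1 + cabs E)) * ((1 + cabs E) * cabs w))).
    by rewrite ler_wpM2l // divr_ge0 ?ltW.
  have E1 : 1 + cabs E != 0 by rewrite gt_eqF // ltr_pwDl // cabs_ge0.
  by rewrite le_eqVlt; apply/orP; left; apply/eqP; field.
rewrite rnormZ; apply: (@le_trans _ _ (e / (2 * (1 + rnorm D)) * cabs w * (1 + rnorm D))).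
  apply: ler_pM; rewrite ?cabs_ge0 ?rnorm_ge0 ?lerDr //.
  by apply: le_trans w2 _; rewrite ler_wpM2r ?cabs_ge0 // ge_min lexx orbT.
have D1 : 1 + rnorm D != 0 by rewrite gt_eqF // ltr_pwDl // rnorm_ge0.
by rewrite le_eqVlt; apply/orP; left; apply/eqP; field.
Qed.

Lemma cdiff_affine (a b : R[i]) z : cdiff (fun w => a + b * w : CC R) z.
Proof.
by apply: cdiffD; [exact: cdiff_cst | apply: cdiffM; [exact: cdiff_cst|exact: cdiff_id]].
Qed.

End cderiv.

(** * Mean value property and harmonic majorants *)

Section goursat.
Context {R : realType} {X : normedModType R[i]}.

(** The midpoint rule on [[x, x + l]]. Midpoints make it exact on affine functions at every level
    [n], and level [n.+1] is the sum of level [n] over the two halves. *)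
Definition midsum (n : nat) (phi : R -> X) (x l : R) : X :=
  (l / 2 ^+ n)%:C *: \sum_(k < 2 ^ n) phi (x + l * ((k%:R + 2^-1) / 2 ^+ n)).

Lemma midsumS n phi x l :
  midsum n.+1 phi x l = midsum n phi x (l / 2) + midsum n phi (x + l / 2) (l / 2).
Proof.
rewrite /midsum -scalerDr expnS mul2n -addnn big_split_ord /=; congr (_ *: (_ + _)).
- by congr (_%:C); rewrite exprS; field; rewrite expf_neq0.
- by apply: eq_bigr => k _; congr (phi _); rewrite exprS; field; rewrite expf_neq0.
- apply: eq_bigr => k _; congr (phi _); rewrite exprS natrD natrX.
  by field; rewrite expf_neq0.
Qed.

Lemma midsum_affine n phi (x l : R) (A B : X) (eta : R) : 0 <= l ->
  (forall y, x <= y <= x + l -> rnorm (phi y - (A + y%:C *: B)) <= eta) ->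
  rnorm (midsum n phi x l - l%:C *: (A + (x + l / 2)%:C *: B)) <= l * eta.
Proof.
move=> l0; elim: n x l l0 => [|n IH] x l l0 h.
  rewrite /midsum expr0 divr1 expn0 big_ord1 /= add0r divr1 -scalerBr rnormZ cabsR.
  by rewrite ger0_norm // ler_wpM2l // h // ; apply/andP; split; nra.
have l20 : 0 <= l / 2 by rewrite divr_ge0.
rewrite midsumS.
have -> : midsum n phi x (l / 2) + midsum n phi (x + l / 2) (l / 2) -
    l%:C *: (A + (x + l / 2)%:C *: B) =
  (midsum n phi x (l / 2) - (l / 2)%:C *: (A + (x + l / 2 / 2)%:C *: B)) +
  (midsum n phi (x + l / 2) (l / 2) -
    (l / 2)%:C *: (A + (x + l / 2 + l / 2 / 2)%:C *: B)).
  rewrite !scalerDr !scalerA -!rmorphM /= !opprD !addrA.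
  have -> : l%:C *: A = (l / 2)%:C *: A + (l / 2)%:C *: A.
    by rewrite -scalerDl -rmorphD /= -splitr.
  have -> : (l * (x + l / 2))%:C *: B = (l / 2 * (x + l / 2 / 2))%:C *: B
     + (l / 2 * (x + l / 2 + l / 2 / 2))%:C *: B.
    by rewrite -scalerDl -rmorphD /=; congr (_%:C *: _); field.
  by zmod.
apply: le_trans (rnormD _ _) _.
have -> : l * eta = l / 2 * eta + l / 2 * eta by field.
apply: lerD; apply: IH => // y /andP[y1 y2]; apply: h; apply/andP; split; lra.
Qed.

Variable F : R -> R -> X.

(** Riemann sum of [F] against [dx + i dy] around the rectangle [[s, s + a] x [t, t + b]],
    counterclockwise. *)
Definition rectsum n s t a b : X :=
  midsum n (fun x => F x t) s a + 'i *: midsum n (F (s + a)) t b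
  - midsum n (fun x => F x (t + b)) s a - 'i *: midsum n (F s) t b.

Lemma rectsumS n s t a b : rectsum n.+1 s t a b =
  (rectsum n s t (a / 2) (b / 2) + rectsum n (s + a / 2) t (a / 2) (b / 2)) +
  (rectsum n s (t + b / 2) (a / 2) (b / 2) +
   rectsum n (s + a / 2) (t + b / 2) (a / 2) (b / 2)).
Proof.
rewrite /rectsum !midsumS !scalerDr -[s + a / 2 + a / 2]addrA -splitr.
by rewrite -[t + b / 2 + b / 2]addrA -splitr; zmod.
Qed.

Definition rdiff s t := exists D : X, forall e : R, 0 < e -> exists2 d : R, 0 < d &
  forall a b, `|a| + `|b| < d ->
    rnorm (F (s + a) (t + b) - F s t - (a +i* b) *: D) <= e * (`|a| + `|b|).

(** An affine function of [x + i y] has sum zero around the rectangle ([hv]), so only the remainder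
    counts: at most [e / 2 * (a + b)] along a boundary of length [2 (a + b)], whatever the level
    [n]. *)
Lemma rectsum_local s0 t0 (e : R) : rdiff s0 t0 -> 0 < e -> exists2 d : R, 0 < d &
  forall n (s t a b : R), 0 <= a -> 0 <= b -> a + b < d ->
    s <= s0 <= s + a -> t <= t0 <= t + b ->
    rnorm (rectsum n s t a b) <= e * (a + b) ^+ 2.
Proof.
move=> [D FD] e0; have [d d0 hd] := FD _ (divr_gt0 e0 (ltr0n R 2)).
exists d => // n s t a b a0 b0 abd /andP[s1 s2] /andP[t1 t2].
have key x y : s <= x <= s + a -> t <= y <= t + b ->
   rnorm (F x y - (F s0 t0 + ((x - s0) +i* (y - t0)) *: D)) <= e / 2 * (a + b).
  move=> /andP[x1 x2] /andP[y1 y2].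
  have hx : `|x - s0| <= a by rewrite ler_norml; apply/andP; split; lra.
  have hy : `|y - t0| <= b by rewrite ler_norml; apply/andP; split; lra.
  have := hd (x - s0) (y - t0) (le_lt_trans (lerD hx hy) abd).
  rewrite !subrKC opprD addrA => /le_trans; apply; apply: ler_wpM2l; last exact: lerD.
  by rewrite divr_ge0 // ltW.
pose A := F s0 t0.
have hH y : t <= y <= t + b ->
   rnorm (midsum n (fun x => F x y) s a -
    a%:C *: ((A + ((- s0) +i* (y - t0)) *: D) + (s + a / 2)%:C *: D))
     <= a * (e / 2 * (a + b)).
  move=> yb; apply: midsum_affine => // x xb; apply: le_trans (key x y xb yb).
  rewrite le_eqVlt; apply/orP; left; apply/eqP; congr (rnorm (_ - _)).
  rewrite -/A -addrA -scalerDl; congr (_ + _ *: _).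
  by apply/eqP; rewrite eq_complex /=; apply/andP; split; apply/eqP; ring.
have hV x : s <= x <= s + a ->
   rnorm (midsum n (F x) t b -
    b%:C *: ((A + ((x - s0) +i* (- t0)) *: D) + (t + b / 2)%:C *: ('i *: D)))
     <= b * (e / 2 * (a + b)).
  move=> xb; apply: midsum_affine => // y yb; apply: le_trans (key x y xb yb).
  rewrite le_eqVlt; apply/orP; left; apply/eqP; congr (rnorm (_ - _)).
  rewrite -/A -addrA scalerA -scalerDl; congr (_ + _ *: _).
  by apply/eqP; rewrite eq_complex /=; apply/andP; split; apply/eqP; ring.
have ta : t <= t <= t + b by rewrite lexx lerDl.
have tb : t <= t + b <= t + b by rewrite lexx lerDl b0.
have sa : s <= s <= s + a by rewrite lexx lerDl.
have sb : s <= s + a <= s + a by rewrite lexx lerDl a0.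
have := hH _ ta; have := hH _ tb; have := hV _ sa; have := hV _ sb.
rewrite /rectsum.
set V2 := midsum n (F (s + a)) t b; set V1 := midsum n (F s) t b.
set H1 := midsum n (fun x => F x t) s a; set H2 := midsum n (fun x => F x (t + b)) s a.
set v2 := b%:C *: _; set v1 := b%:C *: _; set h2 := a%:C *: _; set h1 := a%:C *: _.
move=> e2 e1 e4 e3.
have hv : h1 + 'i *: v2 - h2 - 'i *: v1 = 0.
  rewrite /h1 /h2 /v1 /v2 !scalerDr !scalerA.
  set cA := a%:C *: A; set dA := ('i * b%:C) *: A.
  rewrite (_ : _ - _ - _ = ((a%:C * ((- s0) +i* (t - t0))) *: D +
     (a%:C * (s + a / 2)%:C) *: D +
    (('i * (b%:C * ((s + a - s0) +i* (- t0)))) *: D + ('i * b%:C * (t + b / 2)%:C * 'i) *: D) -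
    ((a%:C * ((- s0) +i* (t + b - t0))) *: D + (a%:C * (s + a / 2)%:C) *: D) -
    (('i * (b%:C * ((s - s0) +i* (- t0)))) *: D + ('i * b%:C * (t + b / 2)%:C * 'i) *: D)));
    last by zmod.
  rewrite -!scalerDl -!scalerBl -[RHS](scale0r D); congr (_ *: _).
  by apply/eqP; rewrite eq_complex /=; apply/andP; split; apply/eqP; ring.
have -> : H1 + 'i *: V2 - H2 - 'i *: V1 =
  ((H1 - h1) + 'i *: (V2 - v2)) + (- (H2 - h2) + - ('i *: (V1 - v1))).
  by rewrite -[LHS]subr0 -hv !scalerBr; zmod.
have ci : cabs ('i : R[i]) = 1 by rewrite cabsE /= expr0n add0r expr1n sqrtr1.
apply: le_trans (rnormD _ _) _.
have -> : e * (a + b) ^+ 2 = (a * (e / 2 * (a + b)) + b * (e / 2 * (a + b))) +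
  (a * (e / 2 * (a + b)) + b * (e / 2 * (a + b))) by field.
apply: lerD; apply: le_trans (rnormD _ _) _; apply: lerD;
  by rewrite ?rnormN ?rnormZ ?ci ?mul1r.
Qed.

End goursat.

Lemma nested_interval {R : realType} (u v : nat -> R) :
  (forall n, u n <= u n.+1) -> (forall n, v n.+1 <= v n) -> (forall n, u n <= v n) ->
  exists x, forall n, u n <= x <= v n.
Proof.
move=> uS vS uv.
have um : {homo u : m n / (m <= n)%N >-> m <= n} by apply/nondecreasing_seqP.
have vm : {homo v : m n / (m <= n)%N >-> n <= m} by apply/nonincreasing_seqP.
have hub n : ubound (range u) (v n).
  move=> _ [m _ <-]; case: (leqP m n) => mn.
    by apply: le_trans (uv n); apply: um.
  by apply: le_trans (uv m) _; apply: vm; apply: ltnW.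
exists (sup (range u)) => n; apply/andP; split.
  by apply: ub_le_sup; [exists (v 0%N); exact: hub|exists n].
by apply: ge_sup; [exists (u 0%N); exists 0%N|exact: hub].
Qed.

Section goursat2.
Context {R : realType} {X : normedModType R[i]}.
Variable F : R -> R -> X.

(** Riemann sums stand for the contour integral, and a large integral is expressed by infinitely
    many large levels. One of the four quarters inherits this, since a quarter that fails does so
    from some level on. *)
Definition recur_big s t a b (c : R) :=
  forall N : nat, exists2 n, (N <= n)%N & c < rnorm (rectsum F n s t a b).

Lemma recur_bigS s t a b c : recur_big s t a b c ->
  exists2 p : R * R, ((s <= p.1) && (p.1 + a / 2 <= s + a) || (a < 0)) &&
                     ((t <= p.2) && (p.2 + b / 2 <= t + b) || (b < 0)) &
   recur_big p.1 p.2 (a / 2) (b / 2) (c / 4).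
Proof.
move=> h; apply: contrapT => no.
have hn p : ((s <= p.1) && (p.1 + a / 2 <= s + a) || (a < 0)) &&
       ((t <= p.2) && (p.2 + b / 2 <= t + b) || (b < 0)) ->
   exists N, forall n, (N <= n)%N -> rnorm (rectsum F n p.1 p.2 (a / 2) (b / 2)) <= c / 4.
  move=> hp; apply: contrapT => H; apply: no; exists p => // N.
  apply: contrapT => H2; apply: H; exists N => n Nn; rewrite leNgt; apply/negP => H3.
  by apply: H2; exists n.
have gs (x l : R) : (x <= x) && (x + l / 2 <= x + l) || (l < 0).
  by case: (ltP l 0) => [_|l0]; rewrite ?orbT // lexx orbF lerD2l /=; lra.
have gs2 (x l : R) : (x <= x + l / 2) && (x + l / 2 + l / 2 <= x + l) || (l < 0).
  case: (ltP l 0) => [_|l0]; rewrite ?orbT // -addrA -splitr lexx orbF andbT; lra.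
have [N1 h1] := hn (s, t) ltac:(by rewrite /= !gs).
have [N2 h2] := hn (s + a / 2, t) ltac:(by rewrite /= gs gs2).
have [N3 h3] := hn (s, t + b / 2) ltac:(by rewrite /= gs gs2).
have [N4 h4] := hn (s + a / 2, t + b / 2) ltac:(by rewrite /= !gs2).
have [[//|n] Nn] := h (N1 + N2 + N3 + N4).+1.
rewrite rectsumS ltNge => /negP; apply.
have -> : c = (c / 4 + c / 4) + (c / 4 + c / 4) by field.
apply: le_trans (rnormD _ _) _; apply: lerD; apply: le_trans (rnormD _ _) _; apply: lerD.
- by apply: h1; lia.
- by apply: h2; lia.
- by apply: h3; lia.
- by apply: h4; lia.
Qed.

Lemma goursat s t a b : 0 <= a -> 0 <= b ->
  (forall x y, s <= x <= s + a -> t <= y <= t + b -> rdiff F x y) ->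
  forall c : R, 0 < c -> exists N, forall n, (N <= n)%N ->
    rnorm (rectsum F n s t a b) <= c.
Proof.
move=> a0 b0 Fd c c0; apply: contrapT => no.
have big0 : recur_big s t a b c.
  move=> N; apply: contrapT => H; apply: no; exists N => n Nn; rewrite leNgt.
  by apply/negP => H3; apply: H; exists n.
pose good k (p p' : R * R) := [/\ p.1 <= p'.1, p'.1 + a / 2 ^+ k.+1 <= p.1 + a / 2 ^+ k,
   p.2 <= p'.2, p'.2 + b / 2 ^+ k.+1 <= p.2 + b / 2 ^+ k &
   recur_big p'.1 p'.2 (a / 2 ^+ k.+1) (b / 2 ^+ k.+1) (c / 4 ^+ k.+1)].
have step k p : recur_big p.1 p.2 (a / 2 ^+ k) (b / 2 ^+ k) (c / 4 ^+ k) ->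
    exists p', good k p p'.
  have ha : 0 <= a / 2 ^+ k by rewrite divr_ge0 // exprn_ge0.
  have hb : 0 <= b / 2 ^+ k by rewrite divr_ge0 // exprn_ge0.
  move=> /recur_bigS[p']; rewrite ![_ < 0]ltNge ha hb !orbF.
  move=> /andP[/andP[p1 p2]/andP[p3 p4]] hp.
  exists p'; rewrite /good !exprSr !invfM !mulrA; split=> //.
pose nx k p := if pselect (exists p', good k p p') is left H then projT1 (cid H) else p.
pose q := fix q k := if k is k'.+1 then nx k' (q k') else (s, t).
have hq k : recur_big (q k).1 (q k).2 (a / 2 ^+ k) (b / 2 ^+ k) (c / 4 ^+ k).
  elim: k => [|k IH]; first by rewrite /= !expr0 !divr1.
  rewrite [q k.+1]/= /nx; case: pselect => [H|/(_ (step _ _ IH))//].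
  by case: (cid H) => p' /= [].
have hg k : good k (q k) (q k.+1).
  rewrite [q k.+1]/= /nx; case: pselect => [H|/(_ (step _ _ (hq k)))//].
  by case: (cid H) => p' /=.
have [x hx] := @nested_interval R (fun k => (q k).1) (fun k => (q k).1 + a / 2 ^+ k)
  ltac:(by move=> k; have [] := hg k) ltac:(by move=> k; have [] := hg k)
  ltac:(by move=> k; rewrite lerDl divr_ge0 // exprn_ge0).
have [y hy] := @nested_interval R (fun k => (q k).2) (fun k => (q k).2 + b / 2 ^+ k)
  ltac:(by move=> k; have [] := hg k) ltac:(by move=> k; have [] := hg k)
  ltac:(by move=> k; rewrite lerDl divr_ge0 // exprn_ge0).
have xd := hx 0%N; have yd := hy 0%N; rewrite /= !expr0 !divr1 in xd yd.
(* With this tolerance the sums of the [k]-th rectangle are at most [c / (a + b + 1)^2 * ((a + b) /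
   2^k)^2 <= c / 4^k]; the 1 covers [a = b = 0]. *)
have ab0 : 0 < (a + b + 1) ^+ 2 by rewrite exprn_gt0 // ltr_wpDl // addr_ge0.
have [d d0 hd] := rectsum_local (Fd x y xd yd) (divr_gt0 c0 ab0).
have [k hk] : exists k, a / 2 ^+ k + b / 2 ^+ k < d.
  have [k hk] : exists k, (a + b) / d < k%:R.
    by exists (Num.Def.archi_bound ((a + b) / d)); apply: archi_boundP;
       rewrite divr_ge0 ?addr_ge0 // ltW.
  exists k; rewrite -mulrDl ltr_pdivrMr ?exprn_gt0 //.
  rewrite ltr_pdivrMr // in hk; apply: lt_le_trans hk _.
  by rewrite mulrC ler_wpM2l ?(ltW d0) // -natrX ler_nat ltnW // ltn_expl.
have [n _] := hq k 0%N; rewrite ltNge => /negP; apply.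
apply: le_trans (hd n _ _ _ _ _ _ hk (hx k) (hy k)) _; rewrite ?divr_ge0 ?exprn_ge0 //.
rewrite -mulrDl expr_div_n -exprM mulnC exprM (_ : 2 ^+ 2 = 4); last by ring.
rewrite mulrA ler_wpM2r ?invr_ge0 ?exprn_ge0 // mulrAC ler_pdivrMr // ler_wpM2l ?(ltW c0) //.
by rewrite ler_pXn2r ?nnegrE ?addr_ge0 // lerDl.
Qed.

End goursat2.

(** * The parametrisation of the circle and its first-order behaviour *)

Section unit_circle.
Context {R : realType}.

Lemma is_derive_first_order (f : R -> R) (D : R) : is_derive (0 : R) 1 f D ->
  forall e : R, 0 < e -> exists2 d : R, 0 < d &
    forall a, `|a| < d -> `|f a - f 0 - a * D| <= e * `|a|.
Proof.
move=> [+ <-] e e0 => /cvg_ex[/= l fl].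
have -> : 'D_1 f 0 = l by apply: cvg_lim fl.
move/cvgrPdist_le : fl => /(_ _ e0); rewrite near_withinE => /nbhs_ballP[d /= d0 h].
exists d => // a ad; have [->|a0] := eqVneq a 0.
  by rewrite subrr mul0r subr0 normr0 mulr0.
have /h/(_ a0) : ball (0 : R) d a by rewrite -ball_normE /= sub0r normrN.
rewrite addr0 -[a *: 1]/(a * 1) mulr1 -[_ *: _]/(a^-1 * (f a - f 0)) => H.
have -> : f a - f 0 - a * l = - (a * (l - a^-1 * (f a - f 0))) by field.
by rewrite normrN normrM mulrC ler_wpM2r.
Qed.

Definition cis (t : R) : R[i] := cos t +i* sin t.

Lemma cisD a b : cis (a + b) = cis a * cis b.
Proof.
by rewrite /cis cosD sinD; apply/eqP; rewrite eq_complex /=; apply/andP; split; apply/eqP; ring.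
Qed.

Lemma cis0 : cis 0 = 1.
Proof. by rewrite /cis cos0 sin0. Qed.

Lemma cis2pi : cis (2 * pi) = 1.
Proof. by rewrite /cis mulrC [pi * 2]mulr_natr cos2pi sin2pi. Qed.

Lemma cabs_cis t : cabs (cis t) = 1.
Proof. by rewrite cabsE /= cos2Dsin2 sqrtr1. Qed.

Lemma zeta_cis x : zeta x = cis (2 * pi * x). Proof. by []. Qed.

Lemma zetaD x y : zeta (x + y) = zeta x * zeta y :> R[i].
Proof. by rewrite !zeta_cis mulrDr cisD. Qed.

Lemma zeta0 : zeta 0 = 1 :> R[i].
Proof. by rewrite zeta_cis mulr0 cis0. Qed.

Lemma zeta1 : zeta 1 = 1 :> R[i].
Proof. by rewrite zeta_cis mulr1 cis2pi. Qed.

Lemma zetaX x n : zeta x ^+ n = zeta (n%:R * x) :> R[i].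
Proof.
by elim: n => [|n IH]; rewrite ?mul0r ?zeta0 // exprS IH -zetaD -natr1 mulrDl mul1r addrC.
Qed.

Lemma zeta_nat n : zeta n%:R = 1 :> R[i].
Proof. by rewrite -[n%:R]mulr1 -zetaX zeta1 expr1n. Qed.

Lemma zetaN x : zeta (- x) = (zeta x)^-1 :> R[i].
Proof.
have h : zeta x * zeta (- x) = 1 :> R[i] by rewrite -zetaD subrr zeta0.
have x0 : zeta x != 0 :> R[i].
  by apply/eqP => z0; move: h; rewrite z0 mul0r => /esym/eqP; rewrite oner_eq0.
by apply: (mulfI x0); rewrite h divff.
Qed.

Lemma cabs_zeta (x : R) : cabs (zeta x) = 1.
Proof. exact: cabs_cis. Qed.

Lemma zeta_neq0 (x : R) : zeta x != 0.
Proof. by rewrite -cabs_gt0 cabs_zeta. Qed.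

Lemma logpolar_first_order (e : R) : 0 < e -> exists2 d : R, 0 < d &
  forall a b, `|a| + `|b| < d ->
    cabs ((expR a)%:C * cis b - 1 - (a +i* b)) <= e * (`|a| + `|b|).
Proof.
(* Nine errors of size [e' * S] occur below: [1 + 2 + 1] in the real part and [4 + 1] in the
   imaginary part. *)
move=> e0; have [e' [e6 e'1 e'6]] : exists e', [/\ 0 < e', e' <= 1 & e' <= e / 9].
  by exists (Num.min 1 (e / 9)); rewrite lt_min ltr01 divr_gt0 // !ge_min !lexx orbT.
have [d1 d10 h1] := is_derive_first_order (@is_derive_expR R 0) e6.
have [d2 d20 h2] := is_derive_first_order (@is_derive_sin R 0) e6.
have [d3 d30 h3] := is_derive_first_order (@is_derive_cos R 0) e6.
exists (Num.min (Num.min d1 e') (Num.min d2 d3)); first by rewrite !lt_min d10 d20 d30 e6.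
move=> a b; rewrite !lt_min => /andP[/andP[ab1 ab2]/andP[ab3 ab4]].
have aab : `|a| <= `|a| + `|b| by rewrite lerDl.
have bab : `|b| <= `|a| + `|b| by rewrite lerDr.
have := h1 a (le_lt_trans aab ab1); rewrite expR0 mulr1 => ha.
have := h2 b (le_lt_trans bab ab3); rewrite sin0 cos0 subr0 mulr1 => hs.
have := h3 b (le_lt_trans bab ab4); rewrite cos0 sin0 oppr0 mulr0 subr0 => hc.
set S := `|a| + `|b| in aab bab ab1 ab2 ab3 ab4 *.
have S0 : 0 <= S by apply: le_trans aab.
have b1 : `|expR a - 1 - a| <= e' * S by apply: le_trans ha _; rewrite ler_wpM2l // ltW.
have b2 : `|sin b - b| <= e' * S by apply: le_trans hs _; rewrite ler_wpM2l // ltW.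
have b3 : `|cos b - 1| <= e' * S by apply: le_trans hc _; rewrite ler_wpM2l // ltW.
have eb : `|expR a - 1| <= 2 * S.
  rewrite (_ : expR a - 1 = (expR a - 1 - a) + a); last by ring.
  apply: le_trans (ler_normD _ _) _.
  have : e' * S <= 1 * S by apply: ler_wpM2r.
  lra.
have cb : `|sin b| <= 2 * S.
  rewrite (_ : sin b = (sin b - b) + b); last by ring.
  apply: le_trans (ler_normD _ _) _.
  have : e' * S <= 1 * S by apply: ler_wpM2r.
  lra.
have c1 : `|cos b| <= 1 by rewrite ler_norml cos_geN1 cos_le1.
apply: le_trans (cabs_le_ReIm _) _ => /=.
have -> : expR a * cos b - 0 * sin b - 1 - a =
   (expR a - 1 - a) + (expR a - 1) * (cos b - 1) + (cos b - 1) by ring.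
have -> : expR a * sin b + 0 * cos b - 0 - b = (expR a - 1) * sin b + (sin b - b) by ring.
have SS : S * S <= e' * S by rewrite ler_wpM2r // ltW.
have p1 : `|(expR a - 1) * (cos b - 1)| <= 2 * (e' * S).
  rewrite normrM; apply: (@le_trans _ _ (2 * S * (e' * S))); first exact: ler_pM.
  rewrite -mulrA ler_wpM2l // mulrA.
  apply: (@le_trans _ _ (e' * S * e')); first by rewrite mulrAC ler_wpM2r // ltW.
  by rewrite -[leRHS]mulr1 ler_wpM2l // mulr_ge0 // ltW.
have p2 : `|(expR a - 1) * sin b| <= 4 * (e' * S).
  rewrite normrM; apply: (@le_trans _ _ (2 * S * (2 * S))); first exact: ler_pM.
  lra.
have p3 : e' * S <= e / 9 * S by rewrite ler_wpM2r.
apply: (@le_trans _ _ ((e' * S + 2 * (e' * S) + e' * S) + (4 * (e' * S) + e' * S))); last lra.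
apply: lerD; last by apply: le_trans (ler_normD _ _) _; apply: lerD.
apply: le_trans (ler_normD _ _) _; apply: lerD => //.
by apply: le_trans (ler_normD _ _) _; apply: lerD.
Qed.
End unit_circle.

Lemma dyadic_avg_cst {R : realType} {X : normedModType R[i]} n (v : X) :
  (2 ^- n)%:C *: \sum_(k < 2 ^ n) v = v.
Proof.
rewrite sumr_const card_ord -scalerMnr scalerMnl -rmorphMn /= -mulr_natr natrX.
by rewrite mulVf ?scale1r // expf_neq0.
Qed.

Section mean_value.
Context {R : realType} {X : normedModType R[i]}.
Variable f : R[i] -> X.

Definition logpolar (s t : R) : X := f ((expR s)%:C * cis t).

Lemma logpolar_rdiff s t : cdiff f ((expR s)%:C * cis t) -> rdiff logpolar s t.
Proof.
set g := _ * _ => -[D fD]; exists (g *: D) => e e0.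
have g0 : 0 <= cabs g by exact: cabs_ge0.
have e1 : 0 < e / (4 * (1 + cabs g)) by rewrite divr_gt0 // mulr_gt0 // ltr_pwDl.
have e2 : 0 < Num.min 1 (e / (2 * (1 + cabs g) * (1 + rnorm D))).
  by rewrite lt_min ltr01 divr_gt0 // !mulr_gt0 // ltr_pwDl // rnorm_ge0.
have [d1 d10 h1] := fD _ e1; have [d2 d20 h2] := logpolar_first_order e2.
have d3 : 0 < d1 / (2 * (1 + cabs g)) by rewrite divr_gt0 // mulr_gt0 // ltr_pwDl.
exists (Num.min d2 (d1 / (2 * (1 + cabs g)))); first by rewrite lt_min d20 d3.
move=> a b; rewrite lt_min => /andP[/h2 ab1 ab2].
rewrite /logpolar -/g expRD cisD.
set S := `|a| + `|b| in ab1 ab2 *; have S0 : 0 <= S by rewrite addr_ge0.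
pose E := (expR a)%:C * cis b - 1.
have -> : (expR s * expR a)%:C * (cis t * cis b) = g + g * E.
  by rewrite /g /E rmorphM /=; ring.
rewrite -/E in ab1; clearbody E.
have ES : cabs E <= 2 * S.
  have -> : E = (E - (a +i* b)) + (a +i* b) by rewrite subrK.
  apply: le_trans (cabsD _ _) _.
  have -> : 2 * S = S + S by ring.
  apply: lerD; last exact: (cabs_le_ReIm (a +i* b)).
  apply: le_trans ab1 _; rewrite -[leRHS]mul1r ler_wpM2r // ge_min lexx //.
have gE : cabs (g * E) <= 2 * (1 + cabs g) * S.
  rewrite cabsM; apply: (@le_trans _ _ (cabs g * (2 * S))); first by rewrite ler_wpM2l.
  by rewrite mulrCA mulrA !ler_wpM2r // ler_wpM2l // lerDr.
have wd : cabs (g * E) < d1.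
  apply: le_lt_trans gE _; rewrite mulrC -ltr_pdivlMr // mulr_gt0 // ltr_pwDl //.
have := h1 _ wd => w1.
have -> : f (g + g * E) - f g - (a +i* b) *: (g *: D) =
  (f (g + g * E) - f g - (g * E) *: D) + (g * (E - (a +i* b))) *: D.
  by rewrite scalerA mulrBr scalerBl [(a +i* b) * g]mulrC; zmod.
apply: le_trans (rnormD _ _) _; rewrite [e]splitr mulrDl; apply: lerD.
  apply: le_trans w1 _; apply: (@le_trans _ _ (e / (4 * (1 + cabs g)) * (2 * (1 + cabs g) * S))).
    by rewrite ler_wpM2l // ltW.
  by rewrite le_eqVlt; apply/orP; left; apply/eqP; field; rewrite gt_eqF // ltr_pwDl.
rewrite rnormZ cabsM.
apply: (@le_trans _ _ ((1 + cabs g) * (e / (2 * (1 + cabs g) * (1 + rnorm D)) * S) *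
   (1 + rnorm D))).
  apply: ler_pM; rewrite ?mulr_ge0 ?cabs_ge0 ?rnorm_ge0 ?lerDr //.
  apply: ler_pM; rewrite ?cabs_ge0 ?lerDr //.
  by apply: le_trans ab1 _; rewrite ler_wpM2r // ge_min lexx orbT.
rewrite le_eqVlt; apply/orP; left; apply/eqP; field.
by rewrite !gt_eqF // ltr_pwDl // rnorm_ge0.
Qed.

Definition circ_avg n : X :=
  (2 ^- n)%:C *: \sum_(k < 2 ^ n) f (zeta ((k%:R + 2^-1) / 2 ^+ n)).

Hypothesis df : forall z : R[i], cabs z <= 1 -> cdiff f z.

(** On the rectangle [[- L, 0] x [0, 2 pi]] the horizontal sides cancel by periodicity; the right
    side is the mean over the unit circle and the left one the mean over the circle of radius
    [exp (- L)], where [f] is within [e / 2] of [f 0]. *)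
Lemma mean_value (e : R) : 0 < e ->
  exists N, forall n, (N <= n)%N -> rnorm (circ_avg n - f 0) <= e.
Proof.
move=> e0.
have [d d0 hd] := cdiff_cont (df (z := 0) ltac:(by rewrite cabs0 ler01)) (divr_gt0 e0 (ltr0n R 2)).
(* [exp L >= 1 + L > 1 / d], hence [exp (- L) < d]. *)
pose L := d^-1 + 1.
have L0 : 0 < L by rewrite addr_gt0 // invr_gt0.
have small t : rnorm (f ((expR (- L))%:C * cis t) - f 0) <= e / 2.
  apply: ltW; apply: hd; rewrite subr0 cabsM cabs_cis mulr1 cabsR ger0_norm ?expR_ge0 //.
  rewrite expRN invf_plt ?posrE ?expR_gt0 //.
  by apply: lt_le_trans (expR_ge1Dx _); rewrite /L; lra.
have pi0 : 0 < 2 * pi :> R by rewrite mulr_gt0 // pi_gt0.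
have [N hN] := @goursat R X logpolar (- L) 0 L (2 * pi) (ltW L0) (ltW pi0)
  ltac:(move=> x y /andP[_ x0] _; apply: logpolar_rdiff; apply: df;
    by rewrite cabsM cabs_cis mulr1 cabsR ger0_norm ?expR_ge0 // -expR0 ler_expR;
       rewrite addNr in x0) _ (mulr_gt0 pi0 (divr_gt0 e0 (ltr0n R 2))).
exists N => n /hN.
have midE s : midsum n (logpolar s) 0 (2 * pi) =
  (2 * pi)%:C *: ((2 ^- n)%:C *:
    \sum_(k < 2 ^ n) f ((expR s)%:C * zeta ((k%:R + 2^-1) / 2 ^+ n))).
  rewrite /midsum scalerA -rmorphM /=; congr (_ *: _).
  by apply: eq_bigr => k _; rewrite add0r.
rewrite /rectsum add0r.
have -> : (fun x => logpolar x (2 * pi)) = fun x => logpolar x 0.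
  by apply/funext => x; rewrite /logpolar cis2pi cis0.
rewrite addNr; set H := midsum n (fun x => logpolar x 0) _ _; move: H => H.
rewrite (midE 0) (midE (- L)).
set M0 := (2 ^- n)%:C *: _; set M1 := (2 ^- n)%:C *: _.
have -> : H + 'i *: ((2 * pi)%:C *: M0) - H - 'i *: ((2 * pi)%:C *: M1) =
   ('i * (2 * pi)%:C) *: (M0 - M1).
  by rewrite scalerBr -!scalerA; zmod.
have ci : cabs ('i : R[i]) = 1 by rewrite cabsE /= expr0n add0r expr1n sqrtr1.
rewrite rnormZ cabsM ci mul1r cabsR gtr0_norm // ler_pM2l // => h.
have -> : circ_avg n = M0.
  rewrite /M0 /circ_avg expR0; congr (_ *: _).
  by apply: eq_bigr => k _; rewrite mul1r.
have h2 : rnorm (M1 - f 0) <= e / 2.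
  rewrite -{1}(dyadic_avg_cst n (f 0)).
  rewrite -scalerBr -sumrB rnormZ cabsR ger0_norm ?invr_ge0 ?exprn_ge0 //.
  apply: (@le_trans _ _ (2 ^- n * \sum_(k < 2 ^ n) (e / 2))).
    rewrite ler_wpM2l ?invr_ge0 ?exprn_ge0 //; apply: le_trans (rnorm_sum _ _ _) _.
    by apply: ler_sum => k _; rewrite zeta_cis; apply: small.
  by rewrite sumr_const card_ord -[_ *+ 2 ^ n]mulr_natl natrX mulKf // expf_neq0.
have -> : M0 - f 0 = (M0 - M1) + (M1 - f 0) by zmod.
by apply: le_trans (rnormD _ _) _; rewrite [e]splitr; apply: lerD.
Qed.

End mean_value.

(** * Chords, arcs and polar coordinates *)

Section circle_metric.
Context {R : realType}.
Implicit Types x y t : R.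

Lemma norm_sin_le t : `|sin t| <= `|t|.
Proof.
wlog t0 : t / 0 <= t.
  move=> H; case: (lerP 0 t) => [/H//|tn].
  by rewrite -normrN -sinN -[`|t|]normrN; apply: H; rewrite oppr_ge0 ltW.
move: t0; rewrite le_eqVlt => /orP[/eqP <-|t0]; first by rewrite sin0.
have [c _] := MVT t0 (fun x _ => is_derive_sin x) (continuous_subspaceT (@continuous_sin R)).
rewrite sin0 !subr0 => ->; rewrite normrM ler_piMl //.
by rewrite ler_norml cos_geN1 cos_le1.
Qed.

Lemma norm_cos_sub1_le t : `|cos t - 1| <= `|t|.
Proof.
wlog t0 : t / 0 <= t.
  move=> H; case: (lerP 0 t) => [/H//|tn].
  by rewrite -cosN -[`|t|]normrN; apply: H; rewrite oppr_ge0 ltW.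
move: t0; rewrite le_eqVlt => /orP[/eqP <-|t0]; first by rewrite cos0 subrr.
have [c _] := MVT t0 (fun x _ => is_derive_cos x) (continuous_subspaceT (@continuous_cos R)).
rewrite cos0 !subr0 => ->; rewrite normrM ler_piMl // normrN.
by rewrite ler_norml sin_geN1 sin_le1.
Qed.

Lemma zeta_sub x y : cabs (zeta x - zeta y) = cabs (zeta (x - y) - 1 : R[i]).
Proof.
rewrite -[LHS]mul1r -(cabs_zeta (- y)) -cabsM mulrBr -!zetaD addNr zeta0.
by rewrite [- y + x]addrC.
Qed.

(** Real and imaginary parts contribute at most [2 pi |t|] each, and [pi < 4]. *)
Lemma zeta_sub1_le t : cabs (zeta t - 1) <= 16 * `|t|.
Proof.
have p4 : pi < 4 :> R by have := @pihalf_lt2 R; lra.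
have pp := @pi_gt0 R.
apply: le_trans (cabs_le_ReIm _) _ => /=; rewrite subr0.
apply: (@le_trans _ _ (`|2 * pi * t| + `|2 * pi * t|)).
  by apply: lerD; [exact: norm_cos_sub1_le|exact: norm_sin_le].
rewrite normrM gtr0_norm ?mulr_gt0 //.
have := normr_ge0 t; nra.
Qed.

Lemma zeta_lip x y : cabs (zeta x - zeta y) <= 16 * `|x - y|.
Proof. by rewrite zeta_sub zeta_sub1_le. Qed.

(** For [|t| >= 1/4] the cosine is at most 0, so the chord is at least 1. Smaller arguments are
    doubled: [zeta (2 t) - 1 = (zeta t - 1) (zeta t + 1)], whose second factor has modulus at most
    2. *)
Lemma zeta_chord t : `|t| <= 2^-1 -> 2 * `|t| <= cabs (zeta t - 1).
Proof.
wlog t0 : t / 0 <= t.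
  move=> H; case: (lerP 0 t) => [/H//|tn].
  have -> : cabs (zeta t - 1) = cabs (zeta (- t) - 1).
    by have := zeta_sub 0 t; rewrite sub0r zeta0 cabsB.
  by rewrite -normrN; apply: H; rewrite oppr_ge0 ltW.
rewrite ger0_norm //.
suff H : forall n s, 2 ^- n.+2 <= s -> s <= 2^-1 -> 2 * s <= cabs (zeta s - 1 : R[i]).
  move: t0; rewrite le_eqVlt => /orP[/eqP <-|t0] t2; first by rewrite mulr0 cabs_ge0.
  have [n hn] : exists n, 2 ^- n.+2 <= t.
    have [k hk] : exists k, t^-1 < k%:R.
      by exists (Num.Def.archi_bound t^-1); apply: archi_boundP; rewrite invr_ge0 ltW.
    exists k; rewrite invf_ple ?posrE ?exprn_gt0 //; apply: (le_trans (ltW hk)).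
    rewrite -natrX ler_nat; apply: (leq_trans (ltnW (ltn_expl k (ltnSn 1)))).
    by rewrite leq_pexp2l // leqW // leqW.
  exact: H hn t2.
elim=> [|n IH] s s1 s2.
  have ps : pi / 2 <= 2 * pi * s by have := @pi_gt0 R; rewrite -[2 ^- 2]/((2 ^+ 2)^-1) in s1; nra.
  have ps2 : 2 * pi * s <= pi by have := @pi_gt0 R; nra.
  have c0 : cos (2 * pi * s) <= 0.
    have := @cos_ge0_pihalf R (pi - 2 * pi * s) _; rewrite cosB cospi sinpi mul0r addr0 mulN1r oppr_ge0.
    apply; apply/andP; split; lra.
  apply: (@le_trans _ _ 1); first by lra.
  apply: le_trans (ler_Re _); rewrite /= ler_normr; apply/orP; right; lra.
case: (lerP (2 ^- 2) s) => [s4|s4].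
  by apply: IH s2; apply: le_trans s4; rewrite lef_pV2 ?posrE ?exprn_gt0 // ler_eXn2l // ltr1n.
have h : 2 * (2 * s) <= cabs (zeta (2 * s) - 1).
  apply: IH; last by rewrite -[2 ^- 2]/((2 ^+ 2)^-1) in s4; lra.
  by move: s1; rewrite exprS invfM => s1; lra.
have e : zeta (2 * s) - 1 = (zeta s - 1) * (zeta s + 1) :> R[i].
  by rewrite -zetaX; ring.
rewrite e cabsM in h.
have h2 : cabs (zeta s + 1) <= 2 by apply: le_trans (cabsD _ _) _; rewrite cabs_zeta cabs1; lra.
have := cabs_ge0 (zeta s - 1); nra.
Qed.

Lemma polar_unit (w : R[i]) : cabs w = 1 -> exists2 x, 0 <= x < 1 & w = zeta x.
Proof.
move=> w1; have := cabs_sqr w; rewrite w1 expr1n.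
case: w w1 => a b _ /= ab.
have a1 : -1 <= a <= 1 by rewrite -ler_norml -(@ler_pXn2r _ 2) ?nnegrE // expr1n real_normK ?num_real //; nra.
have pp := @pi_gt0 R.
have t0 := acos_ge0 a1; have t1 := acos_lepi a1.
have ct : cos (acos a) = a by rewrite acosK // in_itv.
have st : sin (acos a) = `|b|.
  by rewrite sin_acos // -[RHS]sqrtr_sqr; congr Num.sqrt; rewrite ab; ring.
have p2 : 2 * pi != 0 :> R by rewrite gt_eqF // mulr_gt0.
case: (lerP 0 b) => b0.
  exists (acos a / (2 * pi)).
    apply/andP; split; first by rewrite divr_ge0 // mulr_ge0 // ltW.
    by rewrite ltr_pdivrMr ?mulr_gt0 // mul1r; lra.
  by rewrite /zeta mulrCA divff // mulr1 ct st ger0_norm.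
exists (1 - acos a / (2 * pi)).
  have h : 0 < acos a.
    rewrite lt_def t0 andbT; apply/eqP => h; move: st; rewrite h sin0 => /esym/eqP.
    by rewrite normr_eq0 => /eqP b00; rewrite b00 ltxx in b0.
  apply/andP; split; last by rewrite gtrBl divr_gt0 // mulr_gt0.
  by rewrite subr_ge0 ler_pdivrMr ?mulr_gt0 // mul1r; lra.
rewrite zetaD zeta1 mul1r /zeta mulrN mulrCA divff // mulr1 cosN sinN ct st.
by rewrite ltr0_norm // opprK.
Qed.

Lemma polar (w : R[i]) : exists2 x, 0 <= x < 1 & w = (cabs w)%:C * zeta x.
Proof.
have [->|w0] := eqVneq w 0.
  by exists 0; rewrite ?cabs0 ?mul0r // lexx ltr01.
have c0 : (cabs w)%:C != 0 :> R[i] by rewrite -cabs_gt0 cabsR gtr0_norm cabs_gt0.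
have [|x x01 ex] := @polar_unit (w / (cabs w)%:C).
  by rewrite cabsM cabsV cabsR ger0_norm ?cabs_ge0 // divff // cabs_eq0.
by exists x => //; rewrite -ex mulrC mulfVK.
Qed.

End circle_metric.

Lemma Re_scale {R : realType} (a : R) (w : CC R) :
  complex.Re (a%:C *: w) = a * complex.Re w.
Proof. by case: w => x y; rewrite -[LHS]/(a * x - 0 * y) mul0r subr0. Qed.

(** * Maximum principle and harmonic majorants *)

Section maximum_principle.
Context {R : realType} {X : normedModType R[i]}.

(** Both sides are limits of averages over the same nodes of the circle, where the inequality holds
    termwise. *)
Lemma mean_value_dominated (f : R[i] -> X) (Psi : R[i] -> CC R) :
  (forall z, cabs z <= 1 -> cdiff f z) -> (forall z, cabs z <= 1 -> cdiff Psi z) ->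
  (forall w, cabs w = 1 -> rnorm (f w) <= complex.Re (Psi w)) ->
  rnorm (f 0) <= complex.Re (Psi 0).
Proof.
move=> df dP h; apply/ler_addgt0Pr => e e0.
have e2 : 0 < e / 2 by rewrite divr_gt0.
have [N1 h1] := mean_value df e2; have [N2 h2] := mean_value dP e2.
have /h1 := leq_addr N2 N1; have /h2 := leq_addl N1 N2.
set n := (N1 + N2)%N => a1 a2.
have b1 : rnorm (circ_avg f n) <= complex.Re (circ_avg Psi n).
  rewrite /circ_avg rnormZ cabsR ger0_norm ?invr_ge0 ?exprn_ge0 //.
  rewrite [leRHS](_ : _ = 2 ^- n * complex.Re (\sum_(k < 2 ^ n)
    Psi (zeta ((k%:R + 2^-1) / 2 ^+ n)))); last exact: Re_scale.
  rewrite ler_wpM2l ?invr_ge0 ?exprn_ge0 // Re_sum; apply: le_trans (rnorm_sum _ _ _) _.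
  by apply: ler_sum => k _; apply: h; rewrite cabs_zeta.
have b2 : complex.Re (circ_avg Psi n) - complex.Re (Psi 0) <= e / 2.
  by rewrite -ReB; apply: le_trans (ler_norm _) _; apply: le_trans (ler_Re _) a1.
have := rnorm_sub (f 0) (circ_avg f n); rewrite rnormB.
lra.
Qed.

Lemma max_principle (f : R[i] -> X) B :
  (forall z, cabs z <= 1 -> cdiff f z) ->
  (forall w, cabs w = 1 -> rnorm (f w) <= B) -> rnorm (f 0) <= B.
Proof.
move=> df h; apply: (@mean_value_dominated f (fun=> B%:C)) => // z _.
exact: cdiff_cst.
Qed.

(** The automorphism of the disc that sends 0 to [z]; composition with it moves statements about the
    centre to [z]. *)
Definition moebius (z w : R[i]) : R[i] := (w + z) / (1 + z^*%C * w).

Lemma moebius_den (z w : R[i]) : cabs z < 1 -> cabs w <= 1 -> 1 + z^*%C * w != 0.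
Proof.
move=> z1 w1; rewrite -cabs_gt0.
have h : cabs (z^*%C * w) < 1.
  rewrite cabsM cabs_conj; apply: le_lt_trans z1.
  by rewrite ler_piMr ?cabs_ge0.
have := cabs_sub 1 (- (z^*%C * w)); rewrite cabs1 cabsN opprK; lra.
Qed.

Lemma cabs_moebius (z w : R[i]) : cabs z < 1 -> cabs w <= 1 ->
  1 - cabs (moebius z w) ^+ 2 =
   (1 - cabs z ^+ 2) * (1 - cabs w ^+ 2) / cabs (1 + z^*%C * w) ^+ 2.
Proof.
move=> z1 w1; have d0 := moebius_den z1 w1.
have c0 : cabs (1 + z^*%C * w) != 0 by rewrite cabs_eq0.
rewrite /moebius cabsM cabsV expr_div_n.
apply: (mulIf (expf_neq0 2 c0)); rewrite mulrBl !mulfVK ?expf_neq0 // mul1r.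
by rewrite !cabs_sqr; case: z {z1 d0 c0} => a b; case: w {w1} => c d /=; ring.
Qed.

Lemma moebius_circle (z w : R[i]) : cabs z < 1 -> cabs w = 1 -> cabs (moebius z w) = 1.
Proof.
move=> z1 w1; have w1' : cabs w <= 1 by rewrite w1.
have := cabs_moebius z1 w1'; rewrite w1 expr1n subrr mulr0 mul0r.
by move=> /eqP; rewrite subr_eq0 eq_sym sqrp_eq1 ?cabs_ge0 // => /eqP.
Qed.

Lemma moebius_disc (z w : R[i]) : cabs z < 1 -> cabs w <= 1 -> cabs (moebius z w) <= 1.
Proof.
move=> z1 w1; rewrite -(@ler_pXn2r _ 2) ?nnegrE ?cabs_ge0 // expr1n -subr_ge0.
rewrite cabs_moebius // mulr_ge0 ?invr_ge0 ?exprn_ge0 ?cabs_ge0 // mulr_ge0 //.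
  by rewrite subr_ge0 expr_le1 ?cabs_ge0 // ltW.
by rewrite subr_ge0 expr_le1 ?cabs_ge0.
Qed.

Lemma cdiff_moebius (z w : R[i]) : cabs z < 1 -> cabs w <= 1 ->
  cdiff (fun u => moebius z u : CC R) w.
Proof.
move=> z1 w1; apply: cdiffM.
  by apply: cdiffD; [exact: cdiff_id|exact: cdiff_cst].
apply: cdiffV; first exact: moebius_den.
exact: cdiff_affine.
Qed.

Lemma harmonic_majorant1 (f : R[i] -> X) (Psi : R[i] -> CC R) z :
  (forall z, cabs z <= 1 -> cdiff f z) -> (forall z, cabs z <= 1 -> cdiff Psi z) ->
  (forall w, cabs w = 1 -> rnorm (f w) <= complex.Re (Psi w)) ->
  cabs z < 1 -> rnorm (f z) <= complex.Re (Psi z).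
Proof.
move=> df dP h z1.
have := @mean_value_dominated (fun w => f (moebius z w)) (fun w => Psi (moebius z w)).
rewrite /moebius mulr0 add0r addr0 divr1 -/moebius; apply.
- move=> w w1; apply: (@cdiff_comp _ _ f (fun u => moebius z u)); first exact: cdiff_moebius.
  by apply: df; apply: moebius_disc.
- move=> w w1; apply: (@cdiff_comp _ _ Psi (fun u => moebius z u)); first exact: cdiff_moebius.
  by apply: dP; apply: moebius_disc.
- by move=> w w1; apply: h; apply: moebius_circle.
Qed.

(* Normalising [Psi] to be real at the given point turns the comparison
   function [|Psi| ^ m * Re Psi] there into [(Re Psi) ^ m.+1]. *)
Lemma harmonic_majorant (f : R[i] -> X) (Psi : R[i] -> CC R) m z :
  (forall z, cabs z <= 1 -> cdiff f z) -> (forall z, cabs z <= 1 -> cdiff Psi z) ->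
  (forall z, cabs z <= 1 -> 0 < complex.Re (Psi z)) ->
  (forall w, cabs w = 1 -> rnorm (f w) <= complex.Re (Psi w) ^+ m.+1) ->
  cabs z < 1 -> rnorm (f z) <= complex.Re (Psi z) ^+ m.+1.
Proof.
move=> df dP P0 h z1.
pose Phi : R[i] -> CC R := fun w => Psi w + (- (0 +i* complex.Im (Psi z))).
have RePhi w : complex.Re (Phi w) = complex.Re (Psi w).
  by rewrite /Phi; case: (Psi w) => a b /=; rewrite oppr0 addr0.
have Phige w : complex.Re (Psi w) <= cabs (Phi w).
  by rewrite -RePhi; apply: le_trans (ler_norm _) (ler_Re _).
have Phi0 w : cabs w <= 1 -> Phi w != 0.
  by move=> w1; rewrite -cabs_gt0; apply: lt_le_trans (P0 _ w1) (Phige w).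
have Phiz : cabs (Phi z) = complex.Re (Psi z).
  rewrite /Phi; have := P0 _ (ltW z1); case: (Psi z) => a b /= a0.
  by rewrite cabsE /= subrr expr0n /= oppr0 !addr0 sqrtr_sqr gtr0_norm.
have := @harmonic_majorant1 (fun w => ((Phi w ^+ m)^-1 : CC R) *: f w) Psi z.
rewrite rnormZ cabsV cabsX Phiz => H.
rewrite exprS -ler_pdivrMr ?exprn_gt0 ?P0 ?(ltW z1) // mulrC; apply: H => //.
- move=> w w1; apply: cdiffZ; last exact: df.
  apply: cdiffV; first by rewrite expf_neq0 // Phi0.
  by apply: cdiffX; apply: cdiffD; [exact: dP|exact: cdiff_cst].
- move=> w w1; have w1' : cabs w <= 1 by rewrite w1.
  rewrite rnormZ cabsV cabsX mulrC ler_pdivrMr ?exprn_gt0 ?cabs_gt0 ?Phi0 //.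
  apply: le_trans (h _ w1) _; rewrite exprS ler_wpM2l ?(ltW (P0 _ w1')) //.
  by rewrite lerXn2r ?nnegrE ?cabs_ge0 ?(ltW (P0 _ w1')).
Qed.

End maximum_principle.

(** * Area integrals *)

Section measure_aux.
Context {R : realType}.
Notation mu := (@lebesgue_measure R).
Notation mu2 := ((@lebesgue_measure R) \x (@lebesgue_measure R))%E.
Import HBNNSimple.

(** The integral is the supremum over simple functions below, so a comparison at the points where
    [f] is positive suffices. This serves for Stolz angles and tents, whose measurability is not at
    hand. *)
Lemma le_integral_ge0 d (T : measurableType d) (m : {measure set T -> \bar R})
    (A B : set T) (f g : T -> \bar R) :
  (forall x, A x -> 0 <= f x)%E -> (forall x, B x -> 0 <= g x)%E ->
  (forall x, A x -> (0 < f x)%E -> B x /\ (f x <= g x)%E) ->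
  (\int[m]_(x in A) f x <= \int[m]_(x in B) g x)%E.
Proof.
move=> f0 g0 fg; rewrite !ge0_integralE //.
apply: ereal_sup_le => _ [h hf <-]; exists h => //= x.
apply: le_trans (hf x) _; rewrite !patchE; case: ifPn => xA; last first.
  by case: ifPn => // xB; apply: g0; rewrite inE in xB.
rewrite inE in xA; have := f0 _ xA; rewrite le_eqVlt => /orP[/eqP <-|fx].
  by case: ifPn => // xB; apply: g0; rewrite inE in xB.
by have [xB fgx] := fg _ xA fx; rewrite mem_set.
Qed.

(** The push-forward of Lebesgue measure by a translation agrees with it on half-open intervals,
    hence everywhere. *)
Lemma integral_translate (F : measurableTypeR R -> \bar R) (a : R) : measurable_fun setT F ->
  (forall x, 0 <= F x)%E -> (\int[mu]_x F (x + a)%R = \int[mu]_x F x)%E.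
Proof.
move=> mF F0.
have mphi : measurable_fun [set: measurableTypeR R] (fun x : measurableTypeR R => x + a : measurableTypeR R).
  exact: measurable_funD.
apply: etrans (esym (ge0_integral_pushforward mphi mu measurableT mF _)) _.
  by move=> y _; apply: F0.
pose nu : {measure set (measurableTypeR R) -> \bar R} :=
  measure_function_pushforward__canonical__measure_function_Measure mu mphi.
apply: (@eq_measure_integral _ _ _ _ mu nu) => A mA _.
rewrite -[LHS]/(nu A); apply/esym; apply: (@lebesgue_measure_unique R nu) => // X.
move=> [[x y] _ <-]; rewrite /nu /= /pushforward.
have -> : (fun x0 => x0 + a)%R @^-1` `]x, y] = `]x - a, y - a]%classic.
  apply/seteqP; split => z /=; rewrite !in_itv /= => /andP[h1 h2]; apply/andP; split; lra.
rewrite !lebesgue_measure_itv /= !lte_fin ltrD2r; case: ifP => // _.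
by rewrite -!EFinB; congr (_%:E); ring.
Qed.

(** Invariance of integrals of nonnegative functions: the form that composes, and that Fubini's
    theorem gives for shears. *)
Definition area_preserving (phi : R * R -> R * R) :=
  measurable_fun setT phi /\
  forall F : R * R -> \bar R, measurable_fun setT F -> (forall p, 0 <= F p)%E ->
    (\int[mu2]_p F (phi p) = \int[mu2]_p F p)%E.

Lemma area_preserving_comp phi psi :
  area_preserving phi -> area_preserving psi -> area_preserving (phi \o psi).
Proof.
move=> [mphi hphi] [mpsi hpsi]; split; first exact: measurableT_comp.
move=> F mF F0; rewrite -(hphi F mF F0); apply: (hpsi (F \o phi)) => [|p].
  exact: measurableT_comp.
exact: F0.
Qed.

Lemma area_preserving_shear1 (a c : R) :
  area_preserving (fun p => (p.1 + a * p.2 + c, p.2)).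
Proof.
have mphi : measurable_fun setT (fun p : R * R => (p.1 + a * p.2 + c, p.2)).
  apply/measurable_fun_pair => /=; last exact: measurable_snd.
  by apply: measurable_funD => //; apply: measurable_funD => //; apply: measurable_funM.
split=> // F mF F0.
rewrite (fubini_tonelli2 (m1 := mu) (m2 := mu) _ (measurableT_comp mF mphi) (fun p => F0 _)) //.
rewrite (fubini_tonelli2 (m1 := mu) (m2 := mu) _ mF F0).
apply: eq_integral => y _; rewrite /fubini_G /=.
under eq_integral do rewrite -addrA.
apply: (@integral_translate (fun x => F (x, y))) => //.
exact: measurableT_comp.
Qed.

Lemma area_preserving_shear2 (a c : R) :
  area_preserving (fun p => (p.1, p.2 + a * p.1 + c)).
Proof.
have mphi : measurable_fun setT (fun p : R * R => (p.1, p.2 + a * p.1 + c)).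
  apply/measurable_fun_pair => /=; first exact: measurable_fst.
  by apply: measurable_funD => //; apply: measurable_funD => //; apply: measurable_funM.
split=> // F mF F0.
rewrite (fubini_tonelli1 (m1 := mu) (m2 := mu) _ (measurableT_comp mF mphi) (fun p => F0 _)) //.
rewrite (fubini_tonelli1 (m1 := mu) (m2 := mu) _ mF F0).
apply: eq_integral => x _; rewrite /fubini_F /=.
under eq_integral do rewrite -addrA.
apply: (@integral_translate (fun y => F (x, y))) => //.
exact: measurableT_comp.
Qed.

(* A rotation by an angle [t] other than [pi] is the product of the shears of
   parameters [- tan (t / 2)], [sin t], [- tan (t / 2)]. *)
Lemma area_preserving_rotation (a b c s : R) : c ^+ 2 + s ^+ 2 = 1 -> c != -1 ->
  area_preserving (fun p => (a + (c * p.1 - s * p.2), b + (s * p.1 + c * p.2))).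
Proof.
move=> cs c1; pose t := - s / (1 + c).
have c0 : 1 + c != 0 by apply: contra c1 => /eqP h; apply/eqP; lra.
have -> : (fun p : R * R => (a + (c * p.1 - s * p.2), b + (s * p.1 + c * p.2))) =
   (fun p => (p.1, p.2 + 0 * p.1 + b)) \o ((fun p => (p.1 + t * p.2 + a, p.2)) \o
   ((fun p => (p.1, p.2 + s * p.1 + 0)) \o (fun p => (p.1 + t * p.2 + 0, p.2)))).
  have e1 : t * (1 + c) = - s by rewrite /t mulfVK.
  have e2 : t * s = c - 1.
    apply: (mulIf c0); rewrite mulrAC e1 (_ : (c - 1) * (1 + c) = c ^+ 2 - 1); last by ring.
    by rewrite -cs; ring.
  clearbody t; apply/funext => -[x y] /=; congr pair.
    rewrite [RHS](_ : _ = x + (t * y) *+ 2 + t * s * (x + t * y) + a); last by ring.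
    rewrite e2 [RHS](_ : _ = c * x + t * (1 + c) * y + a); last by ring.
    by rewrite e1; ring.
  rewrite [RHS](_ : _ = y + s * x + t * s * y + b); last by ring.
  by rewrite e2; ring.
apply: area_preserving_comp; first exact: area_preserving_shear2.
apply: area_preserving_comp; first exact: area_preserving_shear1.
by apply: area_preserving_comp;
  [exact: area_preserving_shear2|exact: area_preserving_shear1].
Qed.

(** An open set is the union of the boxes with rational centre and radius [1 / (n + 1)] that it
    contains, enumerated by [unpickle]. *)
Lemma measurable_open2 (A : set (R * R)) :
  (forall p, A p -> exists2 e : R, 0 < e &
    forall q, `|q.1 - p.1| < e -> `|q.2 - p.2| < e -> A q) -> measurable A.
Proof.
move=> oA.
pose box (a b : rat) (n : nat) : set (R * R) :=
  `]ratr a - n.+1%:R^-1, ratr a + n.+1%:R^-1[%classic `*`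
  `]ratr b - n.+1%:R^-1, ratr b + n.+1%:R^-1[%classic.
pose U (i : nat) : set (R * R) := if @unpickle (rat * rat * nat)%type i is Some (a, b, n) then
   (if pselect (box a b n `<=` A) then box a b n else set0) else set0.
have -> : A = \bigcup_i U i.
  apply/seteqP; split => [[x y] Axy|p [i _]]; last first.
    rewrite /U; case: unpickle => // -[[a b] n].
    by case: pselect => // h; apply: h.
  have [e e0 he] := oA _ Axy.
  have [n hn] : exists n, n.+1%:R^-1 < e / 2.
    have [n hn] : exists n, (e / 2)^-1 < n%:R.
      by exists (Num.Def.archi_bound (e / 2)^-1); apply: archi_boundP;
        rewrite invr_ge0 divr_ge0 // ltW.
    exists n; rewrite invf_plt ?posrE ?divr_gt0 //; apply: lt_trans hn _.
    by rewrite ltr_nat.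
  have n0 : 0 < n.+1%:R^-1 :> R by rewrite invr_gt0.
  have itv0 (z : R) : z - n.+1%:R^-1 < z + n.+1%:R^-1.
    by rewrite ltrBlDr -addrA ltrDl addr_gt0.
  have [a ha] := @rat_in_itvoo R _ _ (itv0 x).
  have [b hb] := @rat_in_itvoo R _ _ (itv0 y).
  move: ha hb; rewrite !in_itv /= => /andP[a1 a2] /andP[b1 b2].
  exists (pickle (a, b, n)); first exact: I.
  rewrite /U pickleK.
  case: pselect => [hb|].
    by split; rewrite /= in_itv /= ltrBlDr ?a2 ?b2 -ltrBlDr ?a1 ?b1.
  move=> H; exfalso; apply: H => -[x' y'] [/=]; rewrite !in_itv /= => /andP[x1 x2] /andP[y1 y2].
  by apply: he => /=; rewrite ltr_norml; move: n0 x1 x2 y1 y2 a1 a2 b1 b2 hn;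
    move: n.+1%:R^-1 => e'; lra.
apply: bigcupT_measurable => i; rewrite /U; case: unpickle => [[[a b] n]|]; last exact: measurable0.
case: pselect => [hb|nb]; last exact: measurable0.
by apply: measurableX; exact: measurable_itv.
Qed.

Lemma measurable_cont_patch (D : set (R * R)) (u : R * R -> R) :
  (forall p, D p -> exists2 e : R, 0 < e &
    forall q, `|q.1 - p.1| < e -> `|q.2 - p.2| < e -> D q) ->
  (forall p, D p -> forall e : R, 0 < e -> exists2 d : R, 0 < d &
    forall q, `|q.1 - p.1| < d -> `|q.2 - p.2| < d -> `|u q - u p| < e) ->
  measurable_fun setT (u \_ D).
Proof.
move=> oD cu; have mD : measurable D by exact: measurable_open2.
apply/(measurable_restrictT _ mD).
apply: (measurability _ (RGenOInfty.measurableE R)) => _ [_ [x ->] <-].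
rewrite setIC; apply: measurable_open2 => p [/=]; rewrite in_itv /= andbT => xu Dp.
have [e1 e10 h1] := oD _ Dp.
have [e2 e20 h2] := cu _ Dp (u p - x) ltac:(by rewrite subr_gt0).
exists (Num.min e1 e2); first by rewrite lt_min e10 e20.
move=> q; rewrite !lt_min => /andP[a1 a2] /andP[b1 b2]; split; last exact: h1.
rewrite /= in_itv /= andbT; have := h2 _ a2 b2; rewrite ltr_norml => /andP[]; lra.
Qed.

End measure_aux.

(** * Convexity inequalities for real powers *)

Section powers.
Context {R : realType}.
Implicit Types x y a : R.

(** Young's inequality [x * 1 <= x^a / a + 1 / b] with [1 / b = 1 - 1 / a]. *)
Lemma bernoulli_powR x a : 0 <= x -> 1 <= a -> 1 + a * (x - 1) <= x `^ a.
Proof.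
move=> x0; rewrite le_eqVlt => /orP[/eqP <-|a1]; first by rewrite powRr1 //; lra.
have a0 : 0 < a by lra.
have b0 : 0 < 1 - a^-1 by rewrite subr_gt0 invf_lt1.
have := @conjugate_powR R x 1 a (1 - a^-1)^-1 x0 ler01 a0.
rewrite invr_gt0 invrK powR1 mul1r mulr1 => /(_ b0 ltac:(ring)) h.
have : a * x <= a * (x `^ a / a + (1 - a^-1)) by rewrite ler_pM2l.
rewrite mulrDr mulrCA mulrBr divff ?gt_eqF // !mulr1; lra.
Qed.

(** Bernoulli's inequality at [x / y], scaled by [y^a]: the graph of [x^a] lies above its tangent at
    [y]. *)
Lemma powR_tangent x y a : 0 <= x -> 0 <= y -> 1 <= a ->
  y `^ a + a * y `^ (a - 1) * (x - y) <= x `^ a.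
Proof.
move=> x0; rewrite le_eqVlt => /orP[/eqP <-|y0] a1.
  rewrite powR0 ?add0r; last by rewrite gt_eqF // (lt_le_trans ltr01).
  move: a1; rewrite le_eqVlt => /orP[/eqP <-|a1].
    by rewrite subrr powRr0 powRr1 // subr0 !mul1r.
  by rewrite powR0 ?mulr0 ?mul0r ?powR_ge0 // subr_eq0 gt_eqF.
have h := @bernoulli_powR (x / y) a (divr_ge0 x0 (ltW y0)) a1.
have -> : x `^ a = y `^ a * (x / y) `^ a.
  by rewrite -powRM ?divr_ge0 ?(ltW y0) // mulrC mulfVK // gt_eqF.
have -> : y `^ (a - 1) = y `^ a / y.
  by rewrite powRB ?(gt_eqF y0) ?implybT // powRr1 // ltW.
have -> : y `^ a + a * (y `^ a / y) * (x - y) = y `^ a * (1 + a * (x / y - 1)).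
  by field; rewrite gt_eqF.
by rewrite ler_wpM2l // powR_ge0.
Qed.

(** The tangents at the mean [S / W] are summed, and their linear terms cancel. The total weight [W]
    is arbitrary, whence the factor [W^(a - 1)]. *)
Lemma jensen_powR (I : eqType) (r : seq I) (w x : I -> R) a : 1 <= a ->
  (forall i, 0 <= w i) -> (forall i, 0 <= x i) ->
  (\sum_(i <- r) w i * x i) `^ a <=
    (\sum_(i <- r) w i) `^ (a - 1) * \sum_(i <- r) w i * x i `^ a.
Proof.
move=> a1 w0 x0; set W := \sum_(i <- r) w i; set S := \sum_(i <- r) w i * x i.
have W0 : 0 <= W by exact: sumr_ge0.
have S0 : 0 <= S by apply: sumr_ge0 => i _; exact: mulr_ge0.
have T0 : 0 <= \sum_(i <- r) w i * x i `^ a.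
  by apply: sumr_ge0 => i _; rewrite mulr_ge0 // powR_ge0.
move: W0; rewrite le_eqVlt => /orP[/eqP W0|W0].
  have -> : S = 0.
    apply/eqP; rewrite /S psumr_eq0 => [|i _]; last exact: mulr_ge0.
    apply/allP => i ir; apply/eqP.
    have /eqP := esym W0; rewrite /W psumr_eq0 // => /allP/(_ i ir)/eqP ->.
    by rewrite mul0r.
  rewrite powR0 ?mulr_ge0 ?powR_ge0 // gt_eqF //; lra.
have y0 : 0 <= S / W by rewrite divr_ge0 // ltW.
have : \sum_(i <- r) w i * ((S / W) `^ a + a * (S / W) `^ (a - 1) * (x i - S / W)) <=
       \sum_(i <- r) w i * x i `^ a.
  by apply: ler_sum => i _; rewrite ler_wpM2l //; apply: powR_tangent.
have -> : \sum_(i <- r) w i * ((S / W) `^ a + a * (S / W) `^ (a - 1) * (x i - S / W)) =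
   W * (S / W) `^ a.
  under eq_bigr do rewrite mulrDr mulrCA mulrBr.
  rewrite big_split /= -mulr_suml -mulr_sumr sumrB -mulr_suml -/W -/S.
  by rewrite [W * (S / W)]mulrC mulfVK ?gt_eqF // subrr mulr0 addr0.
move=> h; apply: (@le_trans _ _ (W `^ (a - 1) * (W * (S / W) `^ a))); last first.
  by rewrite ler_wpM2l // powR_ge0.
rewrite mulrA -[X in _ * X * _](powRr1 (ltW W0)) -powRD ?(gt_eqF W0) ?implybT // subrK.
by rewrite -powRM ?(ltW W0) // mulrC mulfVK // gt_eqF.
Qed.

Lemma powR_sum_le x y a : 0 <= x -> 0 <= y -> 0 <= a ->
  (x + y) `^ a <= 2 `^ a * (x `^ a + y `^ a).
Proof.
move=> x0 y0 a0.
apply: (@le_trans _ _ ((2 * Num.max x y) `^ a)).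
  apply: ge0_ler_powR; rewrite ?nnegrE ?mulr_ge0 ?addr_ge0 //.
    by rewrite le_max x0.
  rewrite mulr2n mulrDl mul1r; apply: lerD; by rewrite le_max lexx ?orbT.
rewrite powRM // ?le_max ?x0 // ler_wpM2l ?powR_ge0 //.
by case: (leP x y) => _; rewrite ?lerDl ?lerDr powR_ge0.
Qed.

End powers.

(** * The area mean value inequality *)

Section area_mean.
Context {R : realType}.
Notation mu := (@lebesgue_measure R).
Notation mu2 := ((@lebesgue_measure R) \x (@lebesgue_measure R))%E.

(** The factorisation into shears fails at the half-turn only, which is the square of the
    quarter-turn. *)
Lemma area_preserving_unit (z0 w : R[i]) : cabs w = 1 ->
  area_preserving (fun p : R * R => (complex.Re (z0 + w * toC p), complex.Im (z0 + w * toC p))).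
Proof.
have key a b c s : c ^+ 2 + s ^+ 2 = 1 -> c != -1 -> area_preserving (fun p : R * R =>
     (complex.Re ((a +i* b) + (c +i* s) * toC p), complex.Im ((a +i* b) + (c +i* s) * toC p))).
  move=> cs c1; have := area_preserving_rotation a b cs c1.
  congr area_preserving; apply/funext => -[x y] /=.
  by congr pair; ring.
move=> w1; have := cabs_sqr w; rewrite w1 expr1n.
case: w w1 => c s w1 /= /esym cs; case: z0 => a b.
have [c1|c1] := eqVneq c (-1); last exact: key.
have s0 : s = 0 by apply/eqP; rewrite -sqrf_eq0; apply/eqP; move: cs; rewrite c1; lra.
have i1 : (0 : R) ^+ 2 + 1 ^+ 2 = 1 by rewrite expr0n expr1n add0r.
have i2 : (0 : R) != -1 by rewrite eq_sym oppr_eq0 oner_eq0.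
have := area_preserving_comp (key a b 0 1 i1 i2) (key 0 0 0 1 i1 i2).
congr area_preserving; apply/funext => -[x y] /=; rewrite c1 s0.
by congr pair; ring.
Qed.

Lemma cabs_toC (p : R * R) e : `|p.1| < e -> `|p.2| < e -> cabs (toC p) < 2 * e.
Proof. by move=> h1 h2; apply: le_lt_trans (cabs_le_ReIm _) _ => /=; lra. Qed.

Lemma toCB (p q : R * R) : toC p - toC q = toC (p.1 - q.1, p.2 - q.2).
Proof. by []. Qed.

Definition copen (D : set R[i]) := forall z, D z -> exists2 e : R, 0 < e &
  forall w, cabs (w - z) < e -> D w.

Lemma measurable_toC (D : set R[i]) : copen D -> measurable (@toC R @^-1` D).
Proof.
move=> oD; apply: measurable_open2 => p Dp; have [e e0 he] := oD _ Dp.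
exists (e / 2); first by rewrite divr_gt0.
move=> q h1 h2; apply: he; rewrite toCB; have -> : e = 2 * (e / 2) by field.
exact: cabs_toC.
Qed.

Lemma measurable_cont (D : set R[i]) (u : R[i] -> R) : copen D ->
  (forall z, D z -> forall e : R, 0 < e -> exists2 d : R, 0 < d &
    forall w, cabs (w - z) < d -> `|u w - u z| < e) ->
  measurable_fun setT (fun p : R * R => (u \_ D) (toC p)).
Proof.
move=> oD cu; have := @measurable_cont_patch R (@toC R @^-1` D) (u \o @toC R) _ _.
rewrite (_ : (u \o @toC R) \_ _ = fun p => (u \_ D) (toC p)); first apply.
- move=> p Dp; have [e e0 he] := oD _ Dp.
  exists (e / 2); first by rewrite divr_gt0.
  move=> q h1 h2; apply: he; rewrite toCB; have -> : e = 2 * (e / 2) by field.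
  exact: cabs_toC.
- move=> p Dp e /(cu _ Dp)[d d0 hd].
  exists (d / 2); first by rewrite divr_gt0.
  move=> q h1 h2; apply: hd; rewrite toCB; have -> : d = 2 * (d / 2) by field.
  exact: cabs_toC.
- by apply/funext => p; rewrite !patchE.
Qed.

Lemma copen_ball z e : copen [set w : R[i] | cabs (w - z) < e].
Proof.
move=> w /= we; exists (e - cabs (w - z)); first by rewrite subr_gt0.
move=> u ue; rewrite -(subrKA w) addrC; apply: le_lt_trans (cabsD _ _) _; lra.
Qed.

Lemma cabs_continuous (X : normedModType R[i]) (f : R[i] -> X) z : cdiff f z ->
  forall e : R, 0 < e -> exists2 d : R, 0 < d &
    forall w, cabs (w - z) < d -> `|rnorm (f w) - rnorm (f z)| < e.
Proof.
move=> /cdiff_cont fc e /fc[d d0 hd]; exists d => // w /hd h.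
apply: le_lt_trans h; rewrite ler_norml rnorm_sub andbT lerNl opprB rnormB.
exact: rnorm_sub.
Qed.

Lemma square_in_disc (e : R) (p : R * R) : 0 < e ->
  `[(- (e / 2)), (e / 2)]%classic p.1 -> `[(- (e / 2)), (e / 2)]%classic p.2 ->
  cabs (toC p) < e.
Proof.
move=> e0 /=; rewrite !in_itv /= -!ler_norml => h1 h2.
rewrite -(@ltr_pXn2r _ 2) ?nnegrE ?cabs_ge0 ?(ltW e0) // cabs_sqr /=.
apply: (@le_lt_trans _ _ ((e / 2) ^+ 2 + (e / 2) ^+ 2)).
  by rewrite -(real_normK (num_real p.1)) -(real_normK (num_real p.2)) lerD //
    lerXn2r ?nnegrE // divr_ge0 // ltW.
by nra.
Qed.

Lemma mu_sym_itv (e : R) : 0 < e -> mu `[(- (e / 2)), (e / 2)]%classic = e%:E.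
Proof.
move=> e0; rewrite lebesgue_measure_itv /= lte_fin ifT; last by lra.
by rewrite -EFinD; congr (_%:E); field.
Qed.

Lemma limn_einf_sup (u : (\bar R)^nat) : limn_einf u = ereal_sup (range (einfs u)).
Proof. by rewrite limn_einf_lim; apply: cvg_lim => //; exact: cvg_einfs_sup. Qed.

Lemma dyadic_weights n : \sum_(k <- index_iota 0 (2 ^ n)%N) 2 ^- n = 1 :> R.
Proof.
by rewrite sumr_const_nat subn0 -[_ *+ _]mulr_natr natrX mulVf ?expf_neq0.
Qed.

(** [G n] averages [2^n] rotated copies of [F] about [xi] and has the same integral. At a fixed
    point, Jensen's inequality and the mean value property on the circle through that point bound
    its lower limit from below by [|h xi|^q]; Fatou's lemma concludes. *)
Lemma area_mean_value (h : R[i] -> CC R) (xi : R[i]) (e q : R) : 0 < e -> 1 <= q ->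
  (forall z, cabs (z - xi) < e -> cdiff h z) ->
  ((e ^+ 2 * cabs (h xi) `^ q)%:E <=
    area_int [set z | (cabs (z - xi) < e)%R] (fun z => (cabs (h z) `^ q)%R))%E.
Proof.
move=> e0 q1 dh.
set B := [set z | (cabs (z - xi) < e)%R].
pose F (p : R * R) : \bar R := (((fun z => cabs (h z)) \_ B) (toC p) `^ q)%:E.
have mF : measurable_fun setT F.
  apply/measurable_EFinP; apply: (measurableT_comp (measurable_powR q)).
  apply: measurable_cont; first exact: copen_ball.
  by move=> z /dh; apply: cabs_continuous.
have F0 p : (0 <= F p)%E by rewrite lee_fin powR_ge0.
have FB z : B z -> F (complex.Re z, complex.Im z) = (cabs (h z) `^ q)%:E.
  move=> Bz; rewrite /F (_ : toC _ = z); last by case: (z).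
  by rewrite patchE mem_set.
have -> : area_int B (fun z => cabs (h z) `^ q) = (\int[mu2]_p F p)%E.
  rewrite /area_int integral_mkcond; apply: eq_integral => p _.
  rewrite /F !patchE; have -> : (p \in @toC R @^-1` B) = (toC p \in B).
    by apply/idP/idP; rewrite !inE.
  by case: ifPn => // _; rewrite powR0 // gt_eqF // (lt_le_trans ltr01).
pose tau n k : R[i] := zeta ((k%:R + 2^-1) / 2 ^+ n).
pose rot n k (p : R * R) :=
  (complex.Re (xi + tau n k * toC p), complex.Im (xi + tau n k * toC p)).
pose G n (p : R * R) : \bar R := (\sum_(k <- index_iota 0 (2 ^ n)%N) ((2 ^- n)%:E * F (rot n k p)))%E.
have arot n k : area_preserving (rot n k) by apply: area_preserving_unit; exact: cabs_zeta.
have mFr n k : measurable_fun setT (F \o rot n k) by apply: measurableT_comp => //; case: (arot n k).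
have mG n : measurable_fun setT (G n).
  by apply: emeasurable_sum => k; apply: measurable_funeM; exact: mFr.
have G0 n p : (0 <= G n p)%E.
  by apply: sume_ge0 => k _; apply: mule_ge0 => //; rewrite lee_fin invr_ge0 exprn_ge0.
have intG n : (\int[mu2]_p G n p = \int[mu2]_p F p)%E.
  rewrite ge0_integral_sum //; first last.
  - by move=> k p _; apply: mule_ge0 => //; rewrite lee_fin invr_ge0 exprn_ge0.
  - by move=> k; apply: measurable_funeM; exact: mFr.
  transitivity (\sum_(k <- index_iota 0 (2 ^ n)%N) ((2 ^- n)%:E * \int[mu2]_p F p))%E.
    apply: eq_bigr => k _.
    have c0 : 0 <= 2 ^- n :> R by rewrite invr_ge0 exprn_ge0.
    apply: etrans (ge0_integralZl_EFin mu2 measurableT (fun p _ => F0 (rot n k p)) (mFr n k) c0) _.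
    have aF := (arot n k).2 F mF F0.
    rewrite /comp.
    rewrite aF.
    by [].
  move: (\int[mu2]_p F p)%E => I.
  transitivity ((\sum_(k <- index_iota 0 (2 ^ n)%N) (2 ^- n)%:E) * I)%E.
    by rewrite ge0_sume_distrl // => k _; rewrite lee_fin invr_ge0 exprn_ge0.
  by rewrite sumEFin dyadic_weights mul1e.
(* The square of side [e] lies in the disc of radius [e]; its area is the factor [e^2]. *)
pose W : set (R * R) := `[(- (e / 2)), (e / 2)]%classic `*` `[(- (e / 2)), (e / 2)]%classic.
have mW : measurable W by apply: measurableX; exact: measurable_itv.
have muW : mu2 W = (e ^+ 2)%:E.
  rewrite product_measure1E; [|exact: measurable_itv|exact: measurable_itv].
  by apply: etrans (congr2 mule (mu_sym_itv e0) (mu_sym_itv e0)) _; rewrite -EFinM.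
have lower p : W p -> ((cabs (h xi) `^ q)%:E <= limn_einf (G ^~ p))%E.
  move=> [p1 p2].
  have pe : cabs (toC p) < e by exact: (square_in_disc e0 p1 p2).
  have tB n k : B (xi + toC p * tau n k).
    by rewrite /B /= addrAC subrr add0r cabsM cabs_zeta mulr1.
  pose g (t : R[i]) : CC R := h (xi + toC p * t).
  have dg t : cabs t <= 1 -> cdiff g t.
    move=> t1; apply: (@cdiff_comp _ _ h (fun t => xi + toC p * t)); first exact: cdiff_affine.
    apply: dh; rewrite addrAC subrr add0r cabsM; apply: le_lt_trans pe.
    by rewrite ler_piMr ?cabs_ge0.
  have g0 : g 0 = h xi by rewrite /g mulr0 addr0.
  have GE n : ((rnorm (circ_avg g n) `^ q)%:E <= G n p)%E.
    rewrite /G (eq_bigr (fun k => (2 ^- n * (cabs (g (tau n k)) `^ q))%:E)); last first.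
      by move=> k _; rewrite /rot [tau n k * _]mulrC FB // EFinM.
    rewrite sumEFin lee_fin.
    apply: (@le_trans _ _ ((\sum_(k <- index_iota 0 (2 ^ n)%N) 2 ^- n * cabs (g (tau n k))) `^ q)).
      apply: ge0_ler_powR; rewrite ?nnegrE ?rnorm_ge0 ?(le_trans ler01 q1) //.
        by apply: sumr_ge0 => k _; rewrite mulr_ge0 ?cabs_ge0 ?invr_ge0 ?exprn_ge0.
      rewrite /circ_avg rnormZ cabsR ger0_norm ?invr_ge0 ?exprn_ge0 //.
      rewrite -mulr_sumr ler_wpM2l ?invr_ge0 ?exprn_ge0 // big_mkord.
      exact: rnorm_sum.
    have c0 : 0 <= 2 ^- n :> R by rewrite invr_ge0 exprn_ge0.
    apply: (le_trans (jensen_powR _ q1 (fun=> c0) (fun k => cabs_ge0 _))).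
    by rewrite dyadic_weights powR1 mul1r.
  rewrite limn_einf_sup.
  apply/lee_addgt0Pr => eta eta0.
  pose y := cabs (h xi); have y0 : 0 <= y by exact: cabs_ge0.
  (* The slope of [x^q] at [y], plus 1 to make it positive. *)
  pose c := 1 + q * y `^ (q - 1).
  have c0 : 0 < c by rewrite /c ltr_pwDl // mulr_ge0 ?powR_ge0 // (le_trans ler01 q1).
  have [N hN] := mean_value dg (divr_gt0 eta0 c0).
  apply: (@le_trans _ _ (einfs (G ^~ p) N + eta%:E)%E); last first.
    by rewrite leeD2r //; apply: ereal_sup_ubound; exists N.
  rewrite -leeBlDr // -EFinB; apply: le_ereal_inf_tmp => _ [n /= Nn <-].
  apply: le_trans (GE n); rewrite lee_fin; have := hN n Nn; rewrite g0 => hn.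
  have d1 : y - rnorm (circ_avg g n) <= eta / c.
    by apply: le_trans (rnorm_sub (h xi) _) _; rewrite rnormB.
  apply: le_trans (powR_tangent (rnorm_ge0 _) y0 q1).
  rewrite -/y lerD2l lerNl -mulrN opprB.
  apply: (@le_trans _ _ (q * y `^ (q - 1) * (eta / c))).
    by rewrite ler_wpM2l // mulr_ge0 ?powR_ge0 // (le_trans ler01 q1).
  rewrite mulrCA -[leRHS]mulr1 ler_wpM2l ?(ltW eta0) // ler_pdivrMr // mul1r /c lerDr //.
have fat := fatou mu2 mW (fun n => measurable_funTS (mG n)) (fun n p _ => G0 n p).
 apply: (@le_trans _ _ (\int[mu2]_(p in W) limn_einf (G ^~ p))%E).
  rewrite mulrC EFinM -muW -(@integral_cst _ _ _ mu2 W mW).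
  apply: le_integral_ge0 => [p _|p Wp|p Wp _]; first by rewrite lee_fin powR_ge0.
    by apply: le_trans (lower p Wp); rewrite lee_fin powR_ge0.
  by split=> //; exact: lower.
apply: le_trans fat _; rewrite limn_einf_sup.
apply: ge_ereal_sup => _ [n _ <-]; rewrite -(intG n).
apply: (@le_trans _ _ (\int[mu2]_(p in W) G n p)%E).
  by apply: ereal_inf_lbound; exists n => /=.
by apply: le_integral_ge0 => [p _|p _|p _ _]; rewrite ?G0 //; split.
Qed.

End area_mean.

Lemma powR_le {R : realType} (r x y : R) : 0 <= r -> 0 <= x -> x <= y -> x `^ r <= y `^ r.
Proof.
move=> r0 x0 xy; apply: ge0_ler_powR => //; rewrite nnegrE //.
exact: le_trans xy.
Qed.

Lemma powR_prod {R : realType} (I : Type) (r : seq I) (F : I -> R) a :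
  (forall i, 0 <= F i) -> (\prod_(i <- r) F i) `^ a = \prod_(i <- r) F i `^ a.
Proof.
move=> F0; elim: r => [|i r IH]; first by rewrite !big_nil powR1.
by rewrite !big_cons powRM ?IH // prodr_ge0.
Qed.

Section scaled_comparison.
Context {R : realType}.
Import HBNNSimple.

Lemma le_integral_scale d (T : measurableType d) (m : {measure set T -> \bar R})
    (A B : set T) (f g : T -> \bar R) (c : R) : 0 < c ->
  (forall x, A x -> 0 <= f x)%E -> (forall x, B x -> 0 <= g x)%E ->
  (forall x, A x -> (0 < f x)%E -> B x /\ (f x <= c%:E * g x)%E) ->
  (\int[m]_(x in A) f x <= c%:E * \int[m]_(x in B) g x)%E.
Proof.
move=> c0 f0 g0 fg; rewrite !ge0_integralE //.
apply: ge_ereal_sup => _ [h hf <-].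
have ci : 0 <= c^-1 by rewrite invr_ge0 ltW.
have -> : sintegral m h = (c%:E * sintegral m (scale_nnsfun h ci))%E.
  by rewrite sintegralrM muleA -EFinM divff ?gt_eqF // mul1e.
rewrite lee_pmul2l // ?lte_fin //; apply: ereal_sup_ubound.
exists (scale_nnsfun h ci) => //= x; rewrite EFinM lee_pdivrMl //.
apply: le_trans (hf x) _; rewrite !patchE; case: ifPn => xA; last first.
  apply: mule_ge0; first by rewrite lee_fin ltW.
  by case: ifPn => // xB; apply: g0; rewrite inE in xB.
rewrite inE in xA; have := f0 _ xA; rewrite le_eqVlt => /orP[/eqP <-|fx].
  apply: mule_ge0; first by rewrite lee_fin ltW.
  by case: ifPn => // xB; apply: g0; rewrite inE in xB.
by have [xB fgx] := fg _ xA fx; rewrite mem_set.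
Qed.

End scaled_comparison.

Lemma Re_affine {R : realType} (a b : R) (w : R[i]) :
  complex.Re (a%:C + b%:C * w) = a + b * complex.Re w.
Proof. by case: w => x y /=; rewrite mul0r subr0. Qed.

Lemma Im_affine {R : realType} (a b : R) (w : R[i]) :
  complex.Im (a%:C + b%:C * w) = b * complex.Im w.
Proof. by case: w => x y /=; rewrite mul0r addr0 add0r. Qed.

(** * Pointwise bound from the tent condition *)

Section tents.
Context {R : realType}.

(** The left-hand side is convex in [z] and at most 3 on the generating set: [0 + 3] at [zt], and
    [3/2 + 3/2] where [|w| = 1/2]. The bound passes to the convex hull. *)
Lemma stolz_sub (zt z : R[i]) : cabs zt = 1 -> stolz zt z ->
  cabs (z - zt) + 3 * cabs z <= 3.
Proof.
move=> zt1 H; apply: (H [set z | cabs (z - zt) + 3 * cabs z <= 3]); split=> [a b t /= ha hb /andP[t0 t1]|w [->|/= w2]] /=.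
- have -> : t%:C * a + (1 - t)%:C * b - zt = t%:C * (a - zt) + (1 - t)%:C * (b - zt).
    by rewrite rmorphB /=; ring.
  have h1 := cabsD (t%:C * (a - zt)) ((1 - t)%:C * (b - zt)).
  have h2 := cabsD (t%:C * a) ((1 - t)%:C * b).
  rewrite !cabsM !cabsR !ger0_norm ?subr_ge0 // in h1 h2.
  nra.
- by rewrite subrr cabs0 zt1; lra.
- by have := cabsD w (- zt); rewrite cabsN zt1 w2; lra.
Qed.

Lemma cabs_polar (r x : R) : 0 <= r -> cabs (r%:C * zeta x) = r.
Proof. by move=> r0; rewrite cabsM cabs_zeta mulr1 cabsR ger0_norm. Qed.

(** By [stolz_sub], a Stolz angle through [z] has its vertex within [3 (1 - |z|)] of [z]. *)
Lemma tent_intro j k (z : R[i]) : cabs z < 1 ->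
  (forall x, cabs (z - zeta x) <= 3 * (1 - cabs z) -> dyadic_arc j k (zeta x)) ->
  tent (dyadic_arc j k) z.
Proof.
move=> z1 h; split=> // -[zt [/= zt1 nI] sz].
have [x _ ex] := polar_unit zt1; apply: nI; rewrite ex; apply: h.
by rewrite -ex; have := stolz_sub zt1 sz; lra.
Qed.

Lemma dyadic_arc_intro j k (y : R) : 2 ^- j * k%:R <= y < 2 ^- j * k.+1%:R ->
  @dyadic_arc R j k (zeta y).
Proof. by move=> h; exists y => //=; rewrite in_itv. Qed.

Lemma half_turn (x : R) : 0 <= x < 1 ->
  exists2 y : R, -2^-1 <= y <= 2^-1 & zeta y = zeta x :> R[i].
Proof.
move=> /andP[x0 x1]; case: (lerP x 2^-1) => h.
  by exists x => //; apply/andP; split=> //; lra.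
exists (x - 1); first by apply/andP; split; lra.
by rewrite zetaD zetaN zeta1 invr1 mulr1.
Qed.

Lemma near_zeta (w : R[i]) (al e : R) : cabs w = 1 -> cabs (w - zeta al) <= e ->
  exists y, [/\ `|y| <= 2^-1, 2 * `|y| <= e & w = zeta (al + y)].
Proof.
move=> w1 we; have [x x01 ex] : exists2 x, 0 <= x < 1 & w / zeta al = zeta x.
  by apply: polar_unit; rewrite cabsM cabsV w1 cabs_zeta invr1 mulr1.
have [y yh ey] := half_turn x01.
have hy : `|y| <= 2^-1 by rewrite ler_norml.
have e1 : w = zeta al * zeta y by rewrite ey -ex mulrC mulfVK // zeta_neq0.
exists y; split => //; last by rewrite zetaD.
apply: le_trans (zeta_chord hy) _; apply: le_trans we; rewrite e1.
by rewrite -{2}[zeta al]mulr1 -mulrBr cabsM cabs_zeta mul1r.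
Qed.

End tents.

Lemma dyadic_scale {R : realType} (e : R) : 0 < e -> e <= 1 ->
  exists j : nat, e <= 2 ^- j < 2 * e.
Proof.
move=> e0 e1; have [n hn] : exists n : nat, 2 ^- n < 2 * e.
  have [k hk] : exists k, (2 * e)^-1 < k%:R.
    by exists (Num.Def.archi_bound (2 * e)^-1); apply: archi_boundP; rewrite invr_ge0 mulr_ge0 // ltW.
  exists k; rewrite invf_plt ?posrE ?exprn_gt0 ?mulr_gt0 //; apply: (lt_trans hk).
  by rewrite -natrX ltr_nat ltn_expl.
have ex : exists n : nat, (2 ^- n : R) < 2 * e by exists n.
case: (ex_minnP ex) => j hj jmin; exists j; rewrite hj andbT.
case: j hj jmin => [|j] hj jmin; first by rewrite expr0 invr1.
have : 2 * e <= 2 ^- j by rewrite leNgt; apply/negP => /jmin; rewrite ltnn.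
by rewrite exprS invfM; lra.
Qed.

Lemma dyadic_index {R : realType} (x : R) j : 0 <= x < 1 ->
  exists2 k, (k < 2 ^ j)%N & 2 ^- j * k%:R <= x < 2 ^- j * k.+1%:R.
Proof.
move=> /andP[x0 x1]; have P0 : 0 < 2 ^+ j :> R by rewrite exprn_gt0.
have /truncn_itv/andP[h1 h2] : 0 <= 2 ^+ j * x by rewrite mulr_ge0 // ltW.
exists (Num.truncn (2 ^+ j * x)).
  rewrite -(ltr_nat R) natrX; apply: (le_lt_trans h1).
  by rewrite -[ltRHS]mulr1 ltr_pM2l.
by rewrite ler_pdivrMl // h1 ltr_pdivlMl.
Qed.

Lemma arc_depth {R : realType} (c u : R) :
  0 < u -> c <= 1 - u / 100 -> 1 - u * (115 / 1000) <= c -> u / 100 <= 1 - c <= u.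
Proof. by move=> u0 c1 c2; apply/andP; split; lra. Qed.

Lemma left_half_cell {R : realType} (a u x y v : R) : 16 * v <= u -> 0 < v -> a <= x ->
  x <= a + u / 2 -> 0 < y -> y <= 12 / 10 * v -> a <= x + y < a + u.
Proof. by move=> h1 h2 h3 h4 h5 h6; apply/andP; split; lra. Qed.

Lemma right_half_cell {R : realType} (a u x y v : R) : 16 * v <= u -> 0 < v -> x < a + u ->
  a + u / 2 < x -> y < 0 -> - (12 / 10 * v) <= y -> a <= x + y < a + u.
Proof. by move=> h1 h2 h3 h4 h5 h6; apply/andP; split; lra. Qed.

Section tent_condition.
Context {R : realType}.
Variables (s q kap : R) (h : R[i] -> CC R).
Hypothesis s0 : s < 0.
Hypothesis q1 : 1 <= q.
Hypothesis kap0 : 0 <= kap.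
Hypothesis dh : forall z, cabs z < 1 -> cdiff h z.

Definition tent_density (z : R[i]) : R :=
  ((1 - cabs z) `^ (- s) * cabs (h z)) `^ q * (1 - cabs z)^-1.

Hypothesis tents : forall j k, (k < 2 ^ j)%N ->
  (area_int (tent (dyadic_arc j k)) tent_density <= (kap * 2 ^- j)%:E)%E.

Let q0 : 0 < q. Proof. exact: lt_le_trans ltr01 q1. Qed.

Lemma tent_density_ge0 z : cabs z < 1 -> 0 <= tent_density z.
Proof. by move=> z1; rewrite mulr_ge0 ?powR_ge0 // invr_ge0 subr_ge0 ltW. Qed.

Lemma powR_h z : cabs z < 1 ->
  cabs (h z) `^ q = tent_density z * (1 - cabs z) `^ (s * q) * (1 - cabs z).
Proof.
move=> z1; have d0 : 0 < 1 - cabs z by rewrite subr_gt0.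
rewrite /tent_density powRM ?powR_ge0 ?cabs_ge0 // -powRrM mulNr powRN.
by field; rewrite !gt_eqF ?powR_gt0.
Qed.

(** In the area mean, [|h|^q] is the tent density times [(1 - |z|)^(s q) * (1 - |z|)]. As [s q < 0],
    the smallest depth [d1] controls the first power and the largest depth [d2] the second. *)
Lemma local_bound j k xi (e d1 d2 : R) : (k < 2 ^ j)%N -> 0 < e -> 0 < d1 -> 0 < d2 ->
  (forall z, cabs (z - xi) < e -> tent (dyadic_arc j k) z) ->
  (forall z, cabs (z - xi) < e -> d1 <= 1 - cabs z <= d2) ->
  e ^+ 2 * cabs (h xi) `^ q <= kap * 2 ^- j * (d1 `^ (s * q) * d2).
Proof.
move=> kj e0 d10 d20 bt bd.
have c0 : 0 < d1 `^ (s * q) * d2 by rewrite mulr_gt0 // powR_gt0.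
rewrite -lee_fin.
have dB z : cabs (z - xi) < e -> cdiff h z by move=> /bt[? _]; exact: dh.
apply: le_trans (area_mean_value e0 q1 dB) _.
apply: (@le_trans _ _ ((d1 `^ (s * q) * d2)%:E * area_int (tent (dyadic_arc j k)) tent_density)%E).
  apply: le_integral_scale => //.
  - by move=> p _; rewrite lee_fin powR_ge0.
  - by move=> p [/= p1 _]; rewrite lee_fin tent_density_ge0.
  - move=> p Bp _; split; first exact: bt.
    have [p1 _] := bt _ Bp; have /andP[b1 b2] := bd _ Bp.
    rewrite -EFinM lee_fin powR_h // mulrC mulrCA mulrC ler_wpM2r ?tent_density_ge0 //.
    rewrite mulrC ler_pM ?powR_ge0 ?subr_ge0 ?(ltW p1) //.
    have -> : s * q = - (- s * q) by ring.
    rewrite !powRN lef_pV2 ?posrE ?powR_gt0 // ?(lt_le_trans d10) //.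
    apply: powR_le => //; last exact: ltW.
    by rewrite mulr_ge0 ?oppr_ge0 ?(ltW s0) // ltW.
rewrite [in leRHS]mulrC [in leRHS]EFinM lee_pmul2l ?lte_fin //; exact: tents.
Qed.

Definition wq z := ((1 - cabs z) `^ (- s) * cabs (h z)) `^ q.

Lemma wqE z : cabs z < 1 -> cabs (h z) `^ q = wq z * (1 - cabs z) `^ (s * q).
Proof.
by move=> z1; rewrite powR_h // /tent_density -/(wq z); field; rewrite gt_eqF // subr_gt0.
Qed.

Lemma wq_ge0 z : 0 <= wq z. Proof. exact: powR_ge0. Qed.

Lemma tent_whole z : cabs z < 1 -> tent (@dyadic_arc R 0 0) z.
Proof.
move=> z1; split=> // -[zt [/= zt1 nI] _]; apply: nI.
have [x /andP[x0 x1] ->] := polar_unit zt1.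
by apply: dyadic_arc_intro; rewrite expr0 invr1 mulr0 mulr1 x0.
Qed.

(** From the disc of radius [d / 2] about [z]: [(d / 2)^2 |h z|^q <= kap (d / 2)^(s q) 2 d]. *)
Definition apriori_const : R := 8 * 2 `^ (- (s * q)).

(** The tent here is that of the whole circle. Its arc has length 1 instead of a multiple of
    [1 - |z|], which costs the factor [1 / (1 - |z|)]. *)
Lemma wq_apriori z : cabs z < 1 -> wq z <= apriori_const * kap / (1 - cabs z).
Proof.
move=> z1; set d := 1 - cabs z; have d0 : 0 < d by rewrite subr_gt0.
have d20 : 0 < d / 2 by rewrite divr_gt0.
have hb w : cabs (w - z) < d / 2 -> d / 2 <= 1 - cabs w <= 2 * d.
  move=> h1; have := cabs_sub w z; have := cabs_sub z w; rewrite (cabsB z w) /d => h2 h3.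
  by apply/andP; split; rewrite /d in h1 *; lra.
have := @local_bound 0 0 z (d / 2) (d / 2) (2 * d) isT d20 d20 (mulr_gt0 (ltr0n R 2) d0) _ hb.
have ht w : cabs (w - z) < d / 2 -> tent (@dyadic_arc R 0 0) w.
  by move=> /hb/andP[h1 _]; apply: tent_whole; rewrite -subr_gt0; exact: lt_le_trans h1.
move=> /(_ ht); rewrite expr0 invr1 mulr1 wqE // -/d.
rewrite (_ : (d / 2) `^ (s * q) = d `^ (s * q) * 2 `^ (- (s * q))); last first.
  by rewrite powRM ?invr_ge0 ?(ltW d0) // -powR_inv1 // -powRrM mulN1r.
have P0 : 0 < d `^ (s * q) by rewrite powR_gt0.
have T0 : 0 < 2 `^ (- (s * q)) :> R by rewrite powR_gt0.
rewrite /apriori_const; set P := d `^ _ in P0 *; set T := 2 `^ _ in T0 *; set W := wq z => H.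
rewrite ler_pdivlMr //.
have dP : 0 < d * P / 4 by rewrite divr_gt0 ?mulr_gt0.
rewrite -(ler_pM2l dP).
rewrite [leLHS](_ : _ = (d / 2) ^+ 2 * (W * P)); last by field.
by apply: (le_trans H); rewrite le_eqVlt; apply/orP; left; apply/eqP; field.
Qed.

(** From discs of radius [d / 200] at depth between [d / 100] and [d], in the tent of an arc shorter
    than [32 d]. *)
Definition arc_const : R := 32 * (200 ^+ 2) * 100 `^ (- (s * q)).

Lemma sin_pos_half (y : R) : 0 < sin (2 * pi * y) -> `|y| <= 2^-1 -> 0 < y.
Proof.
move=> sy; rewrite ler_norml => /andP[y1 y2]; rewrite ltNge; apply/negP => y0.
have pp := @pi_gt0 R.
have := @sin_ge0_pi R (2 * pi * (- y)).
rewrite mulrN sinN; suff -> : 0 <= - (2 * pi * y) <= pi by move=> /(_ isT); lra.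
by apply/andP; split; nra.
Qed.

Lemma sin_neg_half (y : R) : sin (2 * pi * y) < 0 -> `|y| <= 2^-1 -> y < 0.
Proof.
move=> sy y1; rewrite -oppr_gt0; apply: sin_pos_half; last by rewrite normrN.
by rewrite mulrN sinN oppr_gt0.
Qed.

(* The tangential directions (12 +- 5i) / 13 lead from [z0] out of the Stolz
   angles over the ends of a dyadic arc of length comparable with [1 - |z0|],
   that is into its tent. *)
Lemma arc_bound (al d : R) : 0 <= al < 1 -> 0 < d -> d <= 16^-1 ->
  exists2 sg : R, sg = 1 \/ sg = -1 &
  forall w, cabs (w - ((9 / 10) +i* (sg * (3 / 8)))) <= 100^-1 ->
    cabs (h (((1 - d)%:C + d%:C * w) * zeta al)) `^ q <= arc_const * kap * d `^ (s * q).
Proof.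
move=> al01 d0 d16.
(* The arc has length in [[16 d, 32 d)], so that either half is longer than the angular displacement
   [12/10 d] met below. *)
have [j /andP[j1 j2]] := @dyadic_scale R (16 * d) ltac:(by rewrite mulr_gt0) ltac:(by lra).
have [k kj /andP[k1 k2]] := dyadic_index j al01.
rewrite -(natr1 k) mulrDr mulr1 in k2.
set l := 2 ^- j in j1 j2 k1 k2.
(* From the left half of the arc the move is towards larger angles, from the right half towards
   smaller ones. *)
pose lft := al <= l * k%:R + l / 2.
pose sg : R := if lft then 1 else -1.
have sg1 : sg = 1 \/ sg = -1 by rewrite /sg; case: ifP => _; [left|right].
have cdir : cabs ((9 / 10) +i* (sg * (3 / 8))) = 39 / 40.
  rewrite cabsE /=; apply: (@pexpIrn _ 2); rewrite ?nnegrE ?sqrtr_ge0 //.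
  by rewrite sqr_sqrtr ?addr_ge0 ?sqr_ge0 //; case: sg1 => ->; field.
exists sg => // w hw.
set xi := _ * zeta al.
have key z : cabs (z - xi) < d / 200 ->
    tent (dyadic_arc j k) z /\ d / 100 <= 1 - cabs z <= d.
  move=> hz.
  pose w' : R[i] := (z / zeta al - (1 - d)%:C) / d%:C.
  have dC0 : d%:C != 0 :> R[i] by rewrite -cabs_gt0 cabsR gtr0_norm.
  have zw' : z = ((1 - d)%:C + d%:C * w') * zeta al.
    by rewrite /w' [d%:C * _]mulrC mulfVK // subrKC mulfVK // zeta_neq0.
  (* [3/200 = 1/100 + 1/200]: the distance allowed for [w], and that of [z] from [xi] in units of
     [d]. *)
  have hw' : cabs (w' - ((9 / 10) +i* (sg * (3 / 8)))) <= 3 / 200.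
    have e1 : w' - w = (z - xi) / zeta al / d%:C.
      by rewrite /xi /w'; field; rewrite dC0 zeta_neq0.
    have e2 : cabs (w' - w) <= 200^-1.
      rewrite e1 !cabsM !cabsV cabs_zeta invr1 mulr1 cabsR gtr0_norm //.
      by rewrite ler_pdivrMr // ltW //; move: hz; rewrite mulrC.
    rewrite -(subrKA w w'); apply: le_trans (cabsD _ _) _; lra.
  have hr : `|complex.Re w' - 9 / 10| <= 3 / 200.
    by have := ler_Re (w' - ((9 / 10) +i* (sg * (3 / 8)))); rewrite ReB; move/le_trans; apply.
  have hi : `|complex.Im w' - sg * (3 / 8)| <= 3 / 200.
    by have := ler_Im (w' - ((9 / 10) +i* (sg * (3 / 8)))); rewrite ImB; move/le_trans; apply.
  rewrite ler_norml in hr; rewrite ler_norml in hi.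
  move: hr hi => /andP[r1 r2] /andP[i1 i2].
  have cw' : cabs w' <= 99 / 100.
    rewrite -(subrK ((9 / 10) +i* (sg * (3 / 8))) w').
    by apply: le_trans (cabsD _ _) _; rewrite cdir; lra.
  have cz : cabs z = cabs ((1 - d)%:C + d%:C * w').
    by rewrite zw' cabsM cabs_zeta mulr1.
  have d1 : 0 <= 1 - d by lra.
  have ub : cabs z <= 1 - d / 100.
    rewrite cz; apply: le_trans (cabsD _ _) _.
    rewrite cabsM !cabsR (ger0_norm d1) (gtr0_norm d0).
    have : d * cabs w' <= d * (99 / 100) by rewrite ler_wpM2l // ltW.
    lra.
  have lb : 1 - d * (1 - complex.Re w') <= cabs z.
    rewrite cz; apply: le_trans (ler_Re _); apply: le_trans (ler_norm _).
    by rewrite Re_affine; lra.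
  (* [Re w' >= 9/10 - 3/200 = 1 - 115/1000]. Three times this depth is [345/1000 d], less than the
     tangential displacement [(3/8 - 3/200) d = 36/100 d]; so the vertices of all Stolz angles
     through [z] lie strictly on one side of [al]. *)
  have lb2 : 1 - d * (115 / 1000) <= cabs z.
    apply: le_trans lb; rewrite lerD2l lerN2 ler_wpM2l ?(ltW d0) //; lra.
  split; last exact: arc_depth d0 ub lb2.
  apply: tent_intro; first by apply: le_lt_trans ub _; rewrite ltrBlDr ltrDl divr_gt0.
  move=> x hx.
  have [|y [y1 y2 ey]] := @near_zeta R (zeta x) al (24 / 10 * d) (cabs_zeta x).
    rewrite -(subrKA z (zeta x)); apply: le_trans (cabsD _ _) _.
    rewrite cabsB; have : cabs (z - zeta al) <= d * 2.
      have -> : z - zeta al = d%:C * (w' - 1) * zeta al.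
        by rewrite zw' rmorphB /=; ring.
      rewrite !cabsM cabs_zeta mulr1 cabsR (gtr0_norm d0) ler_wpM2l ?(ltW d0) //.
      by have := cabsD w' (- 1); rewrite cabsN cabs1; lra.
    lra.
  have hxy : cabs ((1 - d)%:C + d%:C * w' - zeta y) <= d * (345 / 1000).
    have -> : cabs ((1 - d)%:C + d%:C * w' - zeta y) = cabs (z - zeta x).
      by rewrite ey zetaD zw' -{2}[zeta y]mul1r -[LHS]mulr1 -(cabs_zeta al) -cabsM;
        congr cabs; ring.
    lra.
  have him : `|d * complex.Im w' - sin (2 * pi * y)| <= d * (345 / 1000).
    apply: le_trans hxy; apply: le_trans (ler_Im _).
    by rewrite ImB Im_affine.
  rewrite ler_norml in him; move: him => /andP[m1 m2].
  rewrite ey; apply: dyadic_arc_intro; rewrite -/l -(natr1 k) mulrDr mulr1.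
  clear lb lb2 ub hx hxy cz hw' zw' cw' hw.
  have y3 : `|y| <= 12 / 10 * d by lra.
  rewrite ler_norml in y3; move: y3 => /andP[y3 y4].
  move: (sg1) i1 i2; rewrite /sg /lft; case: ifP => hl _ i1 i2.
    have y0 : 0 < y.
      apply: sin_pos_half y1.
      have : d * (36 / 100) <= d * complex.Im w' by rewrite ler_wpM2l ?(ltW d0) //; lra.
      by lra.
    exact: left_half_cell j1 d0 k1 hl y0 y4.
  have y0 : y < 0.
    apply: sin_neg_half y1.
    have : d * complex.Im w' <= d * (- (36 / 100)) by rewrite ler_wpM2l ?(ltW d0) //; lra.
    by lra.
  move/negbT: hl; rewrite -ltNge => hl.
  exact: right_half_cell j1 d0 k2 hl y0 y3.
have e0 : 0 < d / 200 by rewrite divr_gt0.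
have d10 : 0 < d / 100 by rewrite divr_gt0.
have := @local_bound j k xi (d / 200) (d / 100) d kj e0 d10 d0
  (fun z hz => (key z hz).1) (fun z hz => (key z hz).2).
rewrite -/l (_ : (d / 100) `^ (s * q) = d `^ (s * q) * 100 `^ (- (s * q))); last first.
  by rewrite powRM ?invr_ge0 ?(ltW d0) // -powR_inv1 // -powRrM mulN1r.
have P0 : 0 < d `^ (s * q) by rewrite powR_gt0.
have T0 : 0 < 100 `^ (- (s * q)) :> R by rewrite powR_gt0.
rewrite /arc_const; set P := d `^ _ in P0 *; set T := 100 `^ _ in T0 *; set W := cabs _ `^ q => H.
have dd : 0 < (d / 200) ^+ 2 by rewrite exprn_gt0.
rewrite -(ler_pM2l dd); apply: (le_trans H).
have : kap * l * (P * T * d) <= kap * (32 * d) * (P * T * d).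
  rewrite ler_wpM2r ?mulr_ge0 ?(ltW P0) ?(ltW T0) ?(ltW d0) // ler_wpM2l //; lra.
by move/le_trans; apply; rewrite le_eqVlt; apply/orP; left; apply/eqP; field.
Qed.

End tent_condition.

(** * Improvement of a power bound on [h] *)

Section growth.
Context {R : realType}.
Variables (s q kap : R) (h : R[i] -> CC R).
Hypothesis s0 : s < 0.
Hypothesis q1 : 1 <= q.
Hypothesis kap0 : 0 <= kap.
Hypothesis dh : forall z, cabs z < 1 -> cdiff h z.
Hypothesis tents : forall j k, (k < 2 ^ j)%N ->
  (area_int (tent (dyadic_arc j k)) (tent_density s q h) <= (kap * 2 ^- j)%:E)%E.

Let q0 : 0 < q. Proof. exact: lt_le_trans ltr01 q1. Qed.

(* Apply the maximum principle to the product of the [h (z0 + c w^k t)], [w] the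
   primitive [L]-th root of unity: one factor always meets the good arc. *)
Lemma disc_product_bound (z0 : R[i]) (r B b : R) (L : nat) (c : R[i]) : (0 < L)%N ->
  cabs c <= r -> cabs z0 + r < 1 -> 0 <= B -> 0 <= b ->
  (forall t, cabs t = 1 -> cabs (h (z0 + c * t)) `^ q <= B) ->
  (forall t, cabs t = 1 -> cabs (t - 1) <= 16 / L%:R -> cabs (h (z0 + c * t)) `^ q <= b) ->
  (cabs (h z0) `^ q) ^+ L <= b * B ^+ L.-1.
Proof.
move=> L0 cr zr B0 b0 hB hb.
have LR : 0 < L%:R :> R by rewrite ltr0n.
pose om k : R[i] := zeta (k%:R / L%:R).
pose F (t : R[i]) : CC R := \prod_(k <- index_iota 0 L) h (z0 + c * om k * t).
have Fq t : cabs t = 1 -> cabs (F t) `^ q <= b * B ^+ L.-1.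
  move=> t1; have [y /andP[y0 y1] ey] := polar_unit t1.
  have FqE : cabs (F t) `^ q = \prod_(k < L) cabs (h (z0 + c * (om k * t))) `^ q.
    rewrite /F big_mkord cabs_prod; under eq_bigr do rewrite -mulrA.
    by rewrite powR_prod // => i; exact: cabs_ge0.
  (* The points [om k * t] are spaced by [1 / L] of a turn, so one of them is within [1 / L] of a
     turn from 1; 16 is the Lipschitz constant of [zeta]. *)
  have [k kL hk] : exists2 k : 'I_L, True & cabs (om k * t - 1) <= 16 / L%:R.
    move: y0; rewrite le_eqVlt => /orP[/eqP y0|y0].
      exists (Ordinal L0) => //; rewrite /om /= mul0r zeta0 mul1r ey -y0 zeta0 subrr cabs0.
      by rewrite divr_ge0.
    have hx : 0 <= (1 - y) * L%:R by rewrite mulr_ge0 // subr_ge0 ltW.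
    have /andP[k1 k2] := truncn_itv hx.
    have kL : (Num.truncn ((1 - y) * L%:R) < L)%N.
      rewrite -(ltr_nat R); apply: (le_lt_trans k1).
      by rewrite -[ltRHS]mul1r ltr_pM2r //; lra.
    exists (Ordinal kL) => //=; set k := Num.truncn _ in k1 k2 *.
    rewrite /om ey -zetaD.
    have -> : zeta (k%:R / L%:R + y) - 1 = zeta (k%:R / L%:R + y) - zeta 1 :> R[i].
      by rewrite zeta1.
    apply: le_trans (zeta_lip _ _) _; rewrite ler_wpM2l //.
    rewrite -natr1 in k2.
    have e1 : k%:R / L%:R <= 1 - y by rewrite ler_pdivrMr.
    have e2 : 1 - y <= k%:R / L%:R + L%:R^-1.
      by rewrite -[X in _ <= _ + X]mul1r -mulrDl ler_pdivlMr // ltW.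
    by rewrite ler_norml; apply/andP; split; lra.
  rewrite FqE (bigD1 k) //=; apply: ler_pM; rewrite ?powR_ge0 //.
  - by apply: prodr_ge0 => i _; exact: powR_ge0.
  - by apply: hb => //; rewrite cabsM cabs_zeta mul1r.
  - rewrite -[L.-1](_ : #|[pred i : 'I_L | i != k]| = _); last first.
      by rewrite cardC1 card_ord.
    rewrite -prodr_const; apply: ler_prod => i _; rewrite powR_ge0 /=; apply: hB.
    by rewrite cabsM cabs_zeta mul1r.
have M0 : 0 <= b * B ^+ L.-1 by rewrite mulr_ge0 // exprn_ge0.
have dF t : cabs t <= 1 -> cdiff F t.
  move=> t1; apply: cdiff_prod => k.
  apply: (@cdiff_comp _ _ h (fun t => z0 + c * om k * t)); first exact: cdiff_affine.
  apply: dh; apply: le_lt_trans zr; apply: le_trans (cabsD _ _) _; rewrite lerD2l.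
  rewrite !cabsM cabs_zeta mulr1; apply: le_trans cr.
  by rewrite ler_piMr ?cabs_ge0.
have := max_principle (B := (b * B ^+ L.-1) `^ q^-1) dF.
have -> : rnorm (F 0) = cabs (h z0) ^+ L.
  rewrite rnorm_cabs cabs_prod (eq_bigr (fun=> cabs (h z0))); last first.
    by move=> k _; rewrite mulr0 addr0.
  by rewrite prodr_const_nat subn0.
have Hb t : cabs t = 1 -> rnorm (F t) <= (b * B ^+ L.-1) `^ q^-1.
  move=> t1; rewrite rnorm_cabs -[leLHS]powRr1 ?cabs_ge0 // -(@divff _ q) ?gt_eqF //.
  by rewrite powRrM; apply: powR_le; rewrite ?invr_ge0 ?(ltW q0) ?powR_ge0 // Fq.
move=> /(_ Hb); have p0 : 0 <= cabs (h z0) ^+ L by rewrite exprn_ge0 // cabs_ge0.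
move=> /(powR_le (ltW q0) p0) H.
rewrite -powR_mulrn ?powR_ge0 // -powRrM mulrC powRrM powR_mulrn ?cabs_ge0 //.
by apply: (le_trans H); rewrite -powRrM mulVf ?gt_eqF // powRr1.
Qed.

(** The circle of radius [39/40 d] about [z] passes through the centre of the good arc of
    [arc_bound] and stays at depth at least [d / 40], which costs [40^(eta - s q) <= 40^(1 - s q)]
    on the general factors. As [16 / L <= 1/100], one factor falls into the good arc, where the
    bound is free of [eta]. *)
Lemma wq_step (L : nat) (M eta : R) : (0 < L)%N -> 16 / L%:R <= 100^-1 :> R -> 0 <= eta <= 1 -> 0 <= M ->
  (forall z, cabs z < 1 -> wq s q h z <= M * kap * (1 - cabs z) `^ (- eta)) ->
  forall z, cabs z < 1 -> 1 - cabs z <= 16^-1 ->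
   wq s q h z ^+ L <= arc_const s q * kap *
     (M * kap * 40 `^ (1 - s * q) * (1 - cabs z) `^ (- eta)) ^+ L.-1.
Proof.
move=> L0 L1 /andP[eta0 eta1] M0 hM z z1 d16; set d := 1 - cabs z in d16 *.
have LR : 0 < L%:R :> R by rewrite ltr0n.
have d0 : 0 < d by rewrite subr_gt0.
have [al al01 ez] := polar z.
have [sg sg1 hsg] := arc_bound s0 q1 kap0 dh tents al01 d0 d16.
pose u : R[i] := (9 / 10) +i* (sg * (3 / 8)).
have cu : cabs u = 39 / 40.
  rewrite cabsE /=; apply: (@pexpIrn _ 2); rewrite ?nnegrE ?sqrtr_ge0 //.
  by rewrite sqr_sqrtr ?addr_ge0 ?sqr_ge0 //; case: sg1 => ->; field.
pose P := d `^ (s * q); have P0 : 0 < P by rewrite powR_gt0.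
have C20 : 0 <= arc_const s q.
  by apply: mulr_ge0 (powR_ge0 _ _); apply: mulr_ge0 (ler0n _ _) (exprn_ge0 _ (ler0n _ _)).
have E0 : 0 <= d `^ (- eta) by exact: powR_ge0.
have F0 : 0 <= 40 `^ (1 - s * q) :> R by exact: powR_ge0.
have zE t : z + d%:C * zeta al * u * t = ((1 - d)%:C + d%:C * (u * t)) * zeta al.
  by rewrite {1}ez -[cabs z](_ : 1 - d = _); [rewrite rmorphB /=; ring|rewrite /d; ring].
have Hprod := @disc_product_bound z (39 / 40 * d) (M * kap * 40 `^ (1 - s * q) * d `^ (- eta) * P)
  (arc_const s q * kap * P) L (d%:C * zeta al * u) L0.
have : (cabs (h z) `^ q) ^+ L <= arc_const s q * kap * P *
   (M * kap * 40 `^ (1 - s * q) * d `^ (- eta) * P) ^+ L.-1.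
  apply: Hprod.
  - by rewrite !cabsM cabs_zeta mulr1 cu cabsR gtr0_norm // mulrC.
  - by rewrite /d; have := d0; rewrite /d; lra.
  - exact: mulr_ge0 (mulr_ge0 (mulr_ge0 (mulr_ge0 M0 kap0) F0) E0) (ltW P0).
  - exact: mulr_ge0 (mulr_ge0 C20 kap0) (ltW P0).
  - move=> t t1; set w := z + _.
    have wz : cabs w <= cabs z + 39 / 40 * d.
      apply: le_trans (cabsD _ _) _.
      by rewrite !cabsM cabs_zeta t1 cu cabsR gtr0_norm // !mulr1 [39 / 40 * d]mulrC.
    have dw : d / 40 <= 1 - cabs w by rewrite /d in wz *; lra.
    have dw0 : 0 < 1 - cabs w by apply: lt_le_trans dw; rewrite divr_gt0.
    have w1 : cabs w < 1 by rewrite -subr_gt0.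
    rewrite (@wqE R s q h _ w1).
    apply: (@le_trans _ _ (M * kap * (1 - cabs w) `^ (- eta) * (1 - cabs w) `^ (s * q))).
      by rewrite ler_wpM2r ?powR_ge0 // hM.
    rewrite -mulrA -powRD ?(gt_eqF dw0) ?implybT // -![in leRHS]mulrA [leRHS]mulrA.
    rewrite ler_wpM2l ?mulr_ge0 //.
    have -> : - eta + s * q = - (eta - s * q) by ring.
    have sq0 : 0 <= - (s * q) by rewrite oppr_ge0 nmulr_rle0 // ltW.
    have esq : 0 <= eta - s * q by rewrite addr_ge0.
    apply: (@le_trans _ _ ((d / 40) `^ (- (eta - s * q)))).
      rewrite !powRN lef_pV2 ?posrE ?powR_gt0 ?divr_gt0 //.
      by apply: powR_le => //; rewrite divr_ge0 // ltW.
    rewrite powRM ?invr_ge0 ?(ltW d0) //.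
    have -> : (40^-1 : R) `^ (- (eta - s * q)) = 40 `^ (eta - s * q).
      by rewrite -powR_inv1 // -powRrM mulN1r opprK.
    have -> : d `^ (- (eta - s * q)) = d `^ (- eta) * P.
      by rewrite /P -powRD ?(gt_eqF d0) ?implybT //; congr (_ `^ _); ring.
    rewrite [leLHS]mulrC ler_wpM2r ?mulr_ge0 ?(ltW P0) // ler_powR //; last by lra.
    by rewrite ler1n.
  - move=> t t1 ht; rewrite zE; apply: hsg.
    rewrite -/u -{2}[u]mulr1 -mulrBr cabsM cu.
    apply: (@le_trans _ _ (39 / 40 * (16 / L%:R))); first by rewrite ler_wpM2l.
    apply: le_trans L1; rewrite ler_piMl ?divr_ge0 ?(ltW LR) //; lra.
rewrite (@wqE R s q h _ z1) -/d -/P exprMn [in leRHS]exprMn.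
have PL : 0 < P ^+ L by rewrite exprn_gt0.
rewrite -[leRHS](_ : arc_const s q * kap * (M * kap * 40 `^ (1 - s * q) * d `^ (- eta)) ^+ L.-1 * P ^+ L = _).
  by rewrite ler_pM2r.
by rewrite -[in P ^+ L](prednK L0) exprS; ring.
Qed.

End growth.

(** A division-free form of [r^n <= 1 / (1 + n (1 - r))], which gives the speed at which [r^n] tends
    to 0. *)
Lemma exprn_le_inv {R : realType} (r : R) n : 0 <= r -> r <= 1 ->
  r ^+ n * (1 + n%:R * (1 - r)) <= 1.
Proof.
move=> r0 r1; elim: n => [|n IH]; first by rewrite expr0 mul0r addr0 mulr1.
apply: le_trans IH; rewrite exprS -mulrA mulrCA ler_wpM2l ?exprn_ge0 //.
have n0 : 0 <= n%:R :> R by [].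
rewrite -(natr1 n) -subr_ge0 [X in 0 <= X](_ : _ = (1 - r) * ((1 - r) * (n%:R + 1))); last by ring.
by apply: mulr_ge0; [|apply: mulr_ge0]; rewrite ?subr_ge0 ?addr_ge0.
Qed.

Section bloch.
Context {R : realType}.
Variables (s q : R).
Hypothesis s0 : s < 0.
Hypothesis q1 : 1 <= q.

Let q0 : 0 < q. Proof. exact: lt_le_trans ltr01 q1. Qed.

Lemma apriori_const_ge0 : 0 <= apriori_const s q.
Proof. by apply: mulr_ge0 (ler0n _ _) (powR_ge0 _ _). Qed.

Lemma arc_const_ge0 : 0 <= arc_const s q.
Proof.
by apply: mulr_ge0 (powR_ge0 _ _); apply: mulr_ge0 (ler0n _ _) (exprn_ge0 _ (ler0n _ _)).
Qed.

(** The [L]-th root of [wq_step] turns the exponent [eta] into [eta (1 - 1 / L)]. Because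
    [arc_const * Th^(L - 1) <= M], the constant [M] reproduces itself and survives any number of
    iterations. *)
Lemma bloch_bound : exists2 M : R, 0 <= M & forall (kap : R) (h : R[i] -> CC R), 0 <= kap ->
  (forall z, cabs z < 1 -> cdiff h z) ->
  (forall j k, (k < 2 ^ j)%N ->
    (area_int (tent (dyadic_arc j k)) (tent_density s q h) <= (kap * 2 ^- j)%:E)%E) ->
  forall z, cabs z < 1 -> wq s q h z <= M * kap.
Proof.
have [L hL] : exists L : nat, 16 * 100 < L%:R :> R.
  by exists (Num.Def.archi_bound (16 * 100 : R)); apply: archi_boundP; rewrite mulr_ge0.
have LR : 0 < L%:R :> R by apply: lt_trans hL; rewrite mulr_gt0.
have L0 : (0 < L)%N by rewrite -(ltr_nat R).
have L1 : 16 / L%:R <= 100^-1 :> R.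
  rewrite ler_pdivrMr // mulrC ler_pdivlMr //; exact: ltW.
pose Th : R := 40 `^ (1 - s * q); have Th0 : 0 <= Th by exact: powR_ge0.
(* The first summand serves the initial exponent 1 and the range [1 - |z| > 1/16], the second one
   the iteration. *)
pose M : R := 16 * apriori_const s q + arc_const s q * Th ^+ L.-1.
have MC1 : 16 * apriori_const s q <= M by rewrite /M lerDl mulr_ge0 ?arc_const_ge0 // exprn_ge0.
have MC2 : arc_const s q * Th ^+ L.-1 <= M by rewrite /M lerDr mulr_ge0 ?apriori_const_ge0.
have C10 := apriori_const_ge0.
have M0 : 0 <= M by apply: le_trans MC1; rewrite mulr_ge0.
clearbody M.
exists (2 * M); first by rewrite mulr_ge0.
move=> kap h kap0 dh tents.
pose th : R := 1 - L%:R^-1.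
have Li : 0 < L%:R^-1 :> R by rewrite invr_gt0.
have Li1 : L%:R^-1 <= 1 :> R by rewrite invf_le1 // ler1n.
have th0 : 0 <= th by rewrite subr_ge0.
have th1 : th <= 1 by rewrite gerBl ltW.
have thL : th * L%:R = (L.-1)%:R.
  by rewrite mulrBl mul1r mulVf ?gt_eqF // -{1}(prednK L0) -natr1 addrK.
have iter n z : cabs z < 1 -> wq s q h z <= M * kap * (1 - cabs z) `^ (- (th ^+ n)).
  elim: n z => [|n IH] z z1; have d0 : 0 < 1 - cabs z by rewrite subr_gt0.
    apply: le_trans (wq_apriori s0 q1 dh tents z1) _.
    rewrite expr0 powR_inv1 ?(ltW d0) // ler_wpM2r ?invr_ge0 ?(ltW d0) // ler_wpM2r //.
    by apply: le_trans MC1; lra.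
  have d1 : 1 - cabs z <= 1 by rewrite gerBl cabs_ge0.
  have eta0 : 0 <= th ^+ n by rewrite exprn_ge0.
  have eta1 : th ^+ n <= 1 by rewrite exprn_ile1.
  have E0 : 0 <= (1 - cabs z) `^ (- th ^+ n.+1) by exact: powR_ge0.
  case: (lerP (1 - cabs z) 16^-1) => d16; last first.
    apply: le_trans (wq_apriori s0 q1 dh tents z1) _.
    apply: (@le_trans _ _ (M * kap * 1)).
      rewrite mulr1 mulrAC ler_wpM2r // ler_pdivrMr //.
      apply: le_trans (_ : 16 * apriori_const s q * 16^-1 <= _); first by lra.
      by apply: ler_pM; rewrite ?mulr_ge0 // ltW.
    rewrite ler_wpM2l ?mulr_ge0 // powRN -[leLHS]invr1 lef_pV2 ?posrE ?powR_gt0 //.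
    have := @powR_le R (th ^+ n.+1) (1 - cabs z) 1 (exprn_ge0 _ th0) (ltW d0) d1.
    by rewrite powR1.
  have := @wq_step R s q kap h s0 q1 kap0 dh tents L M (th ^+ n) L0 L1.
  rewrite eta0 eta1 => /(_ isT M0 IH z z1 d16) H.
  set d := 1 - cabs z in d0 d1 E0 d16 H *.
  rewrite -(@ler_pXn2r _ L L0) ?nnegrE ?wq_ge0 ?mulr_ge0 //.
  apply: (le_trans H).
  have -> : (M * kap * d `^ (- th ^+ n.+1)) ^+ L =
      M * M ^+ L.-1 * kap ^+ L * (d `^ (- th ^+ n)) ^+ L.-1.
    rewrite !exprMn -{1}(prednK L0) exprS; congr (_ * _).
    rewrite -(powR_mulrn L (powR_ge0 d _)) -(powR_mulrn L.-1 (powR_ge0 d _)).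
    rewrite -[LHS]powRrM -[RHS]powRrM; congr (_ `^ _).
    by rewrite exprS -thL; ring.
  rewrite -/Th !exprMn [X in _ <= _ * X * _](_ : _ = kap * kap ^+ L.-1); last first.
    by rewrite -exprS prednK.
  rewrite (_ : arc_const s q * kap * _ = arc_const s q * Th ^+ L.-1 *
    (M ^+ L.-1 * (kap * kap ^+ L.-1) * (d `^ (- th ^+ n)) ^+ L.-1)); last by ring.
  rewrite (_ : M * _ * _ * _ = M *
    (M ^+ L.-1 * (kap * kap ^+ L.-1) * (d `^ (- th ^+ n)) ^+ L.-1)); last by ring.
  by rewrite ler_wpM2r // !mulr_ge0 ?exprn_ge0 ?powR_ge0.
move=> z z1; have d0 : 0 < 1 - cabs z by rewrite subr_gt0.
set d := 1 - cabs z in d0.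
(* For fixed [z] the remaining factor [d^(- th^n) <= 2^(N th^n)] is at most 2 as soon as
   [N th^n <= 1]; hence the 2 in the constant. *)
have [N hN] : exists N : nat, d^-1 < N%:R.
  by exists (Num.Def.archi_bound d^-1); apply: archi_boundP; rewrite invr_ge0 ltW.
have hN2 : d^-1 <= 2 ^+ N.
  by apply: (le_trans (ltW hN)); rewrite -natrX ler_nat ltnW // ltn_expl.
have [n hn] : exists n : nat, L%:R * N%:R < n%:R :> R.
  by exists (Num.Def.archi_bound (L%:R * N%:R : R)); apply: archi_boundP; rewrite mulr_ge0.
have hth : N%:R * th ^+ n <= 1.
  have e1 : 1 - th = L%:R^-1 by rewrite /th opprB addrC subrK.
  have := exprn_le_inv n th0 th1; rewrite e1 => h1.
  apply: le_trans h1; rewrite mulrC ler_wpM2l ?exprn_ge0 //.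
  have : N%:R <= n%:R / L%:R :> R by rewrite ler_pdivlMr // mulrC ltW.
  lra.
apply: (le_trans (iter n z z1)); rewrite -/d -[2 * M * kap]mulrA mulrC.
rewrite ler_wpM2r ?mulr_ge0 // powRN -powR_inv1 ?powR_ge0 // -powRrM mulrC powRrM powR_inv1 ?(ltW d0) //.
apply: (@le_trans _ _ ((2 ^+ N) `^ (th ^+ n))).
  by apply: powR_le; rewrite ?exprn_ge0 // invr_ge0 ltW.
rewrite -powR_mulrn // -powRrM -[leRHS]powRr1 //.
by rewrite ler_powR // ler1n.
Qed.

End bloch.

(** * Carleson embedding on finite dyadic trees *)

Section tree.
Context {R : realType}.
Variable n : nat.
Implicit Types (w a F : nat -> nat -> R) (l : 'I_(2 ^ n)) (A t : R).

(** The leaves are the [2^n] cells of generation [n]; this is the cell of generation [j] around leaf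
    [l]. *)
Definition anc (j l : nat) := (l %/ 2 ^ (n - j))%N.

Lemma anc_anc i j l : (i <= j <= n)%N -> (anc j l %/ 2 ^ (j - i))%N = anc i l.
Proof.
move=> /andP[ij jn]; rewrite /anc -divnMA -expnD; congr (_ %/ 2 ^ _)%N; lia.
Qed.

Lemma anc_lt j l : (j <= n)%N -> (anc j l < 2 ^ j)%N.
Proof.
by move=> jn; rewrite ltn_divLR ?expn_gt0 // -expnD subnKC.
Qed.

Lemma sum_anc j (G : nat -> R) : (j <= n)%N ->
  \sum_(l < 2 ^ n) G (anc j l) = 2 ^+ (n - j) * \sum_(k < 2 ^ j) G k.
Proof.
move=> jn; rewrite (partition_big (fun l : 'I_(2 ^ n) => Ordinal (anc_lt l jn)) xpredT) //=.
rewrite mulr_sumr; apply: eq_bigr => k _.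
rewrite (eq_bigr (fun=> G k)); last by move=> l /eqP <-.
rewrite sumr_const -[LHS]mulr_natl; congr (_ * _).
rewrite -natrX; congr (_%:R).
have key (m : nat) (lo : nat) : (lo + m <= 2 ^ n)%N ->
    #|[pred l : 'I_(2 ^ n) | (lo <= l < lo + m)%N]| = m.
  move=> hm.
  have f (i : 'I_m) : (lo + i < 2 ^ n)%N by apply: leq_trans hm; rewrite ltn_add2l.
  rewrite -[RHS](card_ord m) -[RHS](card_imset _ (f := fun i => Ordinal (f i))); last first.
    by move=> x y /(congr1 val) /= /addnI /val_inj.
  rewrite -cardsE; apply: eq_card => x; rewrite !inE; apply/idP/imsetP.
    move=> /andP[h1 h2]; have hx : (x - lo < m)%N by lia.
    by exists (Ordinal hx) => //; apply: val_inj => /=; rewrite subnKC.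
  by case=> i _ -> /=; rewrite leq_addr ltn_add2l ltn_ord.
rewrite -(key (2 ^ (n - j))%N (k * 2 ^ (n - j))%N); last first.
  rewrite -mulSnr -[X in (_ <= 2 ^ X)%N](subnKC jn) expnD.
  by rewrite leq_mul2r ltn_ord orbT.
apply: eq_card => l; rewrite !inE -?val_eqE /=. rewrite unfold_in /= eqnE /anc -mulSnr.
by rewrite eqn_leq -ltnS ltn_divLR ?expn_gt0 // leq_divRL ?expn_gt0 // andbC.
Qed.

(** The Carleson condition on the tree cut off at generation [n]; the nodes [(j, k)] under
    [(j0, i0)] are those with [k %/ 2^(j - j0) = i0]. *)
Definition carleson A a := forall j0 i0, (j0 <= n)%N ->
  \sum_(j0 <= j < n) \sum_(k < 2 ^ j | (k %/ 2 ^ (j - j0))%N == i0) a j k <= A * 2 ^- j0.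

(** A node of generation [j] has [2^(n - j)] leaves, so the weight [2^j] turns the sum over leaves
    into [2^n] times a sum over nodes, to which the condition applies under each node of generation
    [j0]. *)
Lemma tree_atom A a j0 (G : nat -> R) : carleson A a -> (forall k, 0 <= G k) -> (j0 <= n)%N ->
  \sum_(l < 2 ^ n) G (anc j0 l) * \sum_(j0 <= j < n) a j (anc j l) * 2 ^+ j <=
    A * \sum_(l < 2 ^ n) G (anc j0 l).
Proof.
move=> hA G0 j0n.
have e1 : \sum_(l < 2 ^ n) G (anc j0 l) * \sum_(j0 <= j < n) a j (anc j l) * 2 ^+ j =
  2 ^+ n * \sum_(i < 2 ^ j0) G i *
    \sum_(j0 <= j < n) \sum_(k < 2 ^ j | (k %/ 2 ^ (j - j0))%N == i) a j k.
  under eq_bigr do rewrite mulr_sumr.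
  rewrite exchange_big /=.
  transitivity (\sum_(j0 <= j < n) 2 ^+ n * \sum_(k < 2 ^ j) G (k %/ 2 ^ (j - j0))%N * a j k).
    apply: eq_big_nat => j /andP[j1 j2].
    rewrite (eq_bigr (fun l : 'I_(2 ^ n) => (fun k => G (k %/ 2 ^ (j - j0))%N * (a j k * 2 ^+ j)) (anc j l))); last first.
      by move=> l _ /=; rewrite anc_anc // j1 ltnW.
    rewrite (sum_anc (fun k => G (k %/ 2 ^ (j - j0))%N * (a j k * 2 ^+ j))) 1?ltnW //.
    under eq_bigr do rewrite mulrA.
    by rewrite -mulr_suml -[in RHS](subnK (ltnW j2)) exprD; ring.
  rewrite -mulr_sumr; congr (_ * _).
  under [RHS]eq_bigr do rewrite mulr_sumr.
  rewrite [RHS]exchange_big /=; apply: eq_big_nat => j /andP[j1 j2].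
  have kl (k : 'I_(2 ^ j)) : (k %/ 2 ^ (j - j0) < 2 ^ j0)%N.
    by rewrite ltn_divLR ?expn_gt0 // -expnD subnKC.
  rewrite (partition_big (fun k : 'I_(2 ^ j) => Ordinal (kl k)) xpredT) //=.
  apply: eq_bigr => i _; rewrite mulr_sumr; apply: eq_big => k; first by rewrite -val_eqE.
  by move=> /eqP <-.
rewrite e1 sum_anc //.
apply: (@le_trans _ _ (2 ^+ n * \sum_(i < 2 ^ j0) G i * (A * 2 ^- j0))).
  by rewrite ler_wpM2l ?exprn_ge0 //; apply: ler_sum => i _; rewrite ler_wpM2l // hA.
rewrite -mulr_suml exprB ?unitfE // le_eqVlt; apply/orP; left; apply/eqP; ring.
Qed.

Definition running_max w j k := \big[Num.max/0]_(i < j.+1) w i (k %/ 2 ^ (j - i))%N.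

Lemma running_max_ge w j k i : (i <= j)%N -> w i (k %/ 2 ^ (j - i))%N <= running_max w j k.
Proof.
rewrite -ltnS => ij.
exact: (@le_bigmax _ _ _ 0 (fun i : 'I_j.+1 => w i (k %/ 2 ^ (j - i))%N) (Ordinal ij)).
Qed.

Lemma running_max_ge0 w j k : 0 <= running_max w j k.
Proof. exact: bigmax_ge_id. Qed.

Lemma running_maxS w j k : running_max w j (k %/ 2)%N <= running_max w j.+1 k.
Proof.
apply: bigmax_le; first exact: running_max_ge0.
move=> i _; have ij : (i <= j)%N by rewrite -ltnS.
rewrite -divnMA -expnS -(subSn ij).
exact: running_max_ge (leqW ij).
Qed.

(** Summation by parts along a branch: [running_max] is the sum of its increments [D i >= 0], each a
    function of the ancestor of generation [i], and [tree_atom] treats them one by one. *)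
Lemma tree1 A w a : carleson A a -> (forall j k, 0 <= w j k) -> (forall j k, 0 <= a j k) ->
  \sum_(l < 2 ^ n) \sum_(j < n) w j (anc j l) * (a j (anc j l) * 2 ^+ j) <=
  A * \sum_(l < 2 ^ n) \big[Num.max/0]_(j < n) w j (anc j l).
Proof.
move=> hA w0 a0.
pose F := running_max w.
pose D i k := F i k - (if i is i'.+1 then F i' (k %/ 2)%N else 0).
have D0 i k : 0 <= D i k.
  by case: i => [|i]; rewrite /D subr_ge0 ?running_max_ge0 // running_maxS.
have FE j l : (j <= n)%N -> F j (anc j l) = \sum_(i < j.+1) D i (anc i l).
  elim: j => [|j IH] jn; first by rewrite big_ord1 /D subr0.
  rewrite big_ord_recr /= -IH 1?ltnW // /D.
  have -> : (anc j.+1 l %/ 2)%N = anc j l.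
    by have := @anc_anc j j.+1 l; rewrite subSnn expn1; apply; rewrite leqnSn.
  by rewrite addrC subrK.
apply: (@le_trans _ _ (\sum_(l < 2 ^ n) \sum_(j < n) F j (anc j l) * (a j (anc j l) * 2 ^+ j))).
  apply: ler_sum => l _; apply: ler_sum => j _; rewrite ler_wpM2r ?mulr_ge0 ?exprn_ge0 //.
  by have := running_max_ge w (anc j l) (leqnn j); rewrite subnn expn0 divn1.
apply: (@le_trans _ _ (\sum_(i < n) A * \sum_(l < 2 ^ n) D i (anc i l))); last first.
  rewrite -mulr_sumr exchange_big /=.
  have A0 : 0 <= A.
    have := hA 0%N 0%N (leq0n n); rewrite expr0 invr1 mulr1; apply: le_trans.
    by apply: sumr_ge0 => j _; apply: sumr_ge0 => k _.
  rewrite ler_wpM2l //; apply: ler_sum => l _.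
  have [n0|n0] := posnP n.
    have e0 (i : 'I_n) : False by case: i => i; rewrite n0.
    rewrite big1 => [|i _]; first exact: bigmax_ge_id.
    by case: (e0 i).
  have -> : \sum_(i < n) D i (anc i l) = F n.-1 (anc n.-1 l).
    by rewrite FE ?leq_pred // prednK.
  apply: bigmax_le => [|i _]; first exact: bigmax_ge_id.
  have il : (i < n)%N by apply: leq_trans (ltn_ord i) _; rewrite prednK.
  rewrite anc_anc; last by rewrite leq_pred andbT -ltnS ltn_ord.
  exact: (@le_bigmax _ _ _ 0 (fun j : 'I_n => w j (anc j l)) (Ordinal il)).
rewrite (eq_bigr (fun l : 'I_(2 ^ n) => \sum_(i < n) D i (anc i l) *
    \sum_(i <= j < n) a j (anc j l) * 2 ^+ j)); last first.
  move=> l _.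
  transitivity (\sum_(j < n) \sum_(i < n | (i <= j)%N) D i (anc i l) * (a j (anc j l) * 2 ^+ j)).
    apply: eq_bigr => j _; rewrite (FE j l (ltnW (ltn_ord j))) mulr_suml.
    rewrite (big_ord_widen n (fun i => D i (anc i l) * (a j (anc j l) * 2 ^+ j))) //.
  rewrite (exchange_big_dep xpredT) //=; apply: eq_bigr => i _.
  by rewrite mulr_sumr big_geq_mkord.
rewrite exchange_big /=; apply: ler_sum => i _.
by apply: (tree_atom hA) => //; exact: ltnW.
Qed.

(** Each step of the partial sums is bounded through the tangent at its upper end:
    [x^t - y^t <= t x^(t - 1) (x - y)]. *)
Lemma sum_powR_le t N (f : nat -> R) : 1 <= t -> (forall j, 0 <= f j) ->
  (\sum_(j < N) f j) `^ t <= t * \sum_(j < N) f j * (\sum_(i < j.+1) f i) `^ (t - 1).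
Proof.
move=> t1 f0; elim: N => [|N IH].
  by rewrite !big_ord0 mulr0 powR0 // gt_eqF // (lt_le_trans ltr01).
rewrite [in leRHS]big_ord_recr /= mulrDr.
set x := (\sum_(i < N.+1) f i); have xE : x = \sum_(i < N) f i + f N by rewrite /x big_ord_recr.
set y := \sum_(i < N) f i in IH xE.
have y0 : 0 <= y by exact: sumr_ge0.
have x0 : 0 <= x by rewrite xE addr_ge0.
have := powR_tangent y0 x0 t1.
rewrite [y - x](_ : _ = - f N); last by rewrite xE; ring.
move: (x `^ t) (x `^ (t - 1)) (y `^ t) IH => X X1 Y; set Z := _ * \sum_(_ < _) _ => IH; lra.
Qed.

Definition tree_const A t : R := 2 * (t * A * (2 * t * A) `^ (t - 1)) + (1 + A).

Lemma bigmax_powR N (f : nat -> R) t : 0 < t -> (forall j, 0 <= f j) ->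
  \big[Num.max/0]_(j < N) (f j `^ t) = (\big[Num.max/0]_(j < N) f j) `^ t.
Proof.
move=> t0 f0.
suff [] : \big[Num.max/0]_(j < N) (f j `^ t) = (\big[Num.max/0]_(j < N) f j) `^ t /\
          0 <= \big[Num.max/0]_(j < N) f j by [].
elim/big_rec2: _ => [|i x y _ [-> x0]]; first by rewrite powR0 // gt_eqF.
split; last by rewrite le_max f0.
case: (leP (f i) x) => h; [apply/max_idPr|apply/max_idPl].
  exact: powR_le (ltW t0) (f0 i) h.
exact: powR_le (ltW t0) x0 (ltW h).
Qed.

(** The linear case [tree1] is applied to [w^t] if [t <= 1]; if [t > 1], to [w] times the power
    [t - 1] of the partial sums, followed by an absorption. *)
Lemma tree_sum A t w a : 0 <= A -> 0 < t -> carleson A a ->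
  (forall j k, 0 <= w j k) -> (forall j k, 0 <= a j k) ->
  \sum_(l < 2 ^ n) (\sum_(j < n) w j (anc j l) * (a j (anc j l) * 2 ^+ j)) `^ t <=
  tree_const A t * \sum_(l < 2 ^ n) (\big[Num.max/0]_(j < n) w j (anc j l)) `^ t.
Proof.
move=> A0 t0 hA w0 a0.
pose M l := \big[Num.max/0]_(j < n) w j (anc j l).
pose S l := \sum_(j < n) w j (anc j l) * (a j (anc j l) * 2 ^+ j).
have M0 l : 0 <= M l by exact: bigmax_ge_id.
have c0 j k : 0 <= w j k * (a j k * 2 ^+ j) by rewrite !mulr_ge0 // exprn_ge0.
have S0 l : 0 <= S l by exact: sumr_ge0.
have wM l (j : 'I_n) : w j (anc j l) <= M l.
  exact: (@le_bigmax _ _ _ 0 (fun j : 'I_n => w j (anc j l)) j).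
have T0 : 0 <= \sum_(l < 2 ^ n) M l `^ t by apply: sumr_ge0 => l _; exact: powR_ge0.
have K0 : 0 <= 2 * (t * A * (2 * t * A) `^ (t - 1)).
  by rewrite !mulr_ge0 ?powR_ge0 // ltW.
rewrite -/(S _) -/(M _).
case: (lerP t 1) => t1.
  apply: (@le_trans _ _ ((1 + A) * \sum_(l < 2 ^ n) M l `^ t)); last first.
    by rewrite ler_wpM2r // /tree_const lerDr.
  pose T l := \sum_(j < n) w j (anc j l) `^ t * (a j (anc j l) * 2 ^+ j).
  have Tge0 l : 0 <= T l.
    by apply: sumr_ge0 => j _; rewrite mulr_ge0 ?powR_ge0 // mulr_ge0 // exprn_ge0.
  have sT : \sum_(l < 2 ^ n) T l <= A * \sum_(l < 2 ^ n) M l `^ t.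
    have := @tree1 A (fun j k => w j k `^ t) a hA (fun j k => powR_ge0 _ _) a0.
    rewrite [X in _ <= A * X](eq_bigr (fun l : 'I_(2 ^ n) => M l `^ t)) //.
    by move=> l _; rewrite (bigmax_powR n (f := fun j => w j (anc j l))).
  rewrite mulrDl mul1r; apply: le_trans (lerD (lexx _) sT); rewrite -big_split /=.
  apply: ler_sum => l _.
  (* From [w <= M^(1 - t) w^t]. If [T <= M^t], then [S <= M]; otherwise [M <= T^(1/t)] and
     [S <= T^(1/t)]. Either way [S^t <= M^t + T]. *)
  have ST : S l <= M l `^ (1 - t) * T l.
    rewrite mulr_sumr; apply: ler_sum => j _.
    rewrite [leRHS]mulrA ler_wpM2r ?mulr_ge0 ?exprn_ge0 //.
    rewrite -{1}[w j _](powRr1 (w0 _ _)) -{1}(subrK t 1) powRD ?subrK ?oner_eq0 //.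
    by rewrite ler_wpM2r ?powR_ge0 // powR_le // subr_ge0.
  case: (lerP (T l) (M l `^ t)) => h.
    apply: (@le_trans _ _ (M l `^ t)); last by rewrite lerDl.
    apply: powR_le (ltW t0) (S0 l) _.
    apply: (le_trans ST); apply: (@le_trans _ _ (M l `^ (1 - t) * M l `^ t)).
      by rewrite ler_wpM2l ?powR_ge0.
    by rewrite -powRD ?subrK ?oner_eq0 // powRr1.
  apply: (@le_trans _ _ (T l)); last by rewrite lerDr powR_ge0.
  have MT : M l <= T l `^ t^-1.
    rewrite -[leLHS]powRr1 // -(@divff _ t) ?gt_eqF // powRrM.
    by rewrite powR_le ?invr_ge0 ?powR_ge0 // ltW.
  have : S l <= T l `^ t^-1.
    apply: (le_trans ST); apply: (@le_trans _ _ ((T l `^ t^-1) `^ (1 - t) * T l)).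
      by rewrite ler_wpM2r // powR_le // subr_ge0.
    have e1 : t^-1 * (1 - t) + 1 = t^-1 by field; rewrite gt_eqF.
    by rewrite -powRrM -{2}[T l]powRr1 // -powRD ?e1 // invr_eq0 (gt_eqF t0).
  move=> /(powR_le (ltW t0) (S0 l)) /le_trans; apply.
  by rewrite -powRrM mulVf ?gt_eqF // powRr1.
apply: (@le_trans _ _ (2 * (t * A * (2 * t * A) `^ (t - 1)) * \sum_(l < 2 ^ n) M l `^ t)); last first.
  by rewrite ler_wpM2r // /tree_const lerDl addr_ge0.
have t10 : 0 <= t - 1 by rewrite subr_ge0 ltW.
pose sg j k := \sum_(i < j.+1) w i (k %/ 2 ^ (j - i))%N * (a i (k %/ 2 ^ (j - i))%N * 2 ^+ i).
have sg0 j k : 0 <= sg j k by exact: sumr_ge0.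
have sgE (l : 'I_(2 ^ n)) (j : 'I_n) : sg j (anc j l) =
    \sum_(i < j.+1) w i (anc i l) * (a i (anc i l) * 2 ^+ i).
  by apply: eq_bigr => i _; rewrite anc_anc // -ltnS ltn_ord ltnW.
have sgS (l : 'I_(2 ^ n)) (j : 'I_n) : sg j (anc j l) <= S l.
  rewrite sgE (big_ord_widen n (fun i => w i (anc i l) * (a i (anc i l) * 2 ^+ i))) //.
  by rewrite [leRHS](bigID (fun i : 'I_n => (i < j.+1)%N)) /= lerDl sumr_ge0.
have w'0 j k : 0 <= w j k * sg j k `^ (t - 1) by rewrite mulr_ge0 // powR_ge0.
have := @tree1 A (fun j k => w j k * sg j k `^ (t - 1)) a hA w'0 a0.
set Sg := \sum_(l < 2 ^ n) S l `^ t; set Tg := \sum_(l < 2 ^ n) M l `^ t => h.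
have h1 : Sg <= t * (A * \sum_(l < 2 ^ n) M l * S l `^ (t - 1)).
  apply: (@le_trans _ _ (t * \sum_(l < 2 ^ n) \sum_(j < n)
     w j (anc j l) * sg j (anc j l) `^ (t - 1) * (a j (anc j l) * 2 ^+ j))).
    rewrite mulr_sumr; apply: ler_sum => l _.
    apply: le_trans (sum_powR_le n (ltW t1) (fun j => c0 j (anc j l))) _.
    rewrite ler_wpM2l ?(ltW t0) // le_eqVlt; apply/orP; left; apply/eqP.
    by apply: eq_bigr => j _; rewrite sgE mulrAC.
  rewrite ler_wpM2l ?(ltW t0) //; apply: (le_trans h); rewrite ler_wpM2l //.
  apply: ler_sum => l _; apply: bigmax_le => [|j _]; first by rewrite mulr_ge0 ?powR_ge0.
  by apply: ler_pM; rewrite ?powR_ge0 // powR_le.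
(* Where [S >= 2 t A M] the product is at most [S^t / 2], to be absorbed on the left of [h1];
   elsewhere [S^(t - 1) <= (2 t A M)^(t - 1)]. *)
have h2 : t * (A * \sum_(l < 2 ^ n) M l * S l `^ (t - 1)) <=
    2^-1 * Sg + t * A * (2 * t * A) `^ (t - 1) * Tg.
  rewrite !mulr_sumr -big_split /=; apply: ler_sum => l _.
  have tA0 : 0 <= 2 * t * A by rewrite !mulr_ge0 // ltW.
  have pS (x : R) : 0 <= x -> x * x `^ (t - 1) = x `^ t.
    move=> x0; rewrite -{1}[x]powRr1 // -powRD; first by rewrite addrC subrK.
    by rewrite addrC subrK (gt_eqF t0).
  case: (lerP (2 * t * A * M l) (S l)) => hl.
    apply: (@le_trans _ _ (2^-1 * S l `^ t)); last first.
      by rewrite lerDl !mulr_ge0 ?powR_ge0 // ltW.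
    rewrite -(pS (S l)) // !mulrA ler_wpM2r ?powR_ge0 //; lra.
  apply: (@le_trans _ _ (t * A * (2 * t * A) `^ (t - 1) * M l `^ t)); last first.
    by rewrite lerDr mulr_ge0 ?powR_ge0 ?invr_ge0.
  rewrite -(pS (M l)) // [leRHS](_ : _ = t * A * M l * ((2 * t * A) `^ (t - 1) * M l `^ (t - 1))); last by ring.
  rewrite !mulrA -[leRHS]mulrA -powRM // ler_wpM2l ?mulr_ge0 ?(ltW t0) //.
  by rewrite powR_le // ltW.
have := le_trans h1 h2; set K := t * A * _ in K0 *; lra.
Qed.

End tree.

(** * Whitney boxes *)

Section whitney.
Context {R : realType}.
Implicit Types (z : R[i]) (x y t al : R).

Lemma sin_turn_ge0 x : 0 <= x <= 2^-1 -> 0 <= sin (2 * pi * x).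
Proof.
by move=> /andP[x0 x1]; apply: sin_ge0_pi; have := @pi_gt0 R; move=> p0; apply/andP; split; nra.
Qed.

Lemma sin_turn_lt0 x : - 2^-1 < x < 0 -> sin (2 * pi * x) < 0.
Proof.
move=> /andP[x0 x1]; rewrite -[x]opprK mulrN sinN oppr_lt0; apply: sin_gt0_pi.
by have := @pi_gt0 R; move=> p0; apply/andP; split; nra.
Qed.

Lemma sin_turnS x : sin (2 * pi * (x + 1)) = sin (2 * pi * x).
Proof. by rewrite mulrDr mulr1 mulrC [2 * pi]mulrC mulr_natr sinD2pi mulrC. Qed.

(** An angle outside the sector violates one of the two signs, according to the half-turn in which
    it lies; differences beyond half a turn are first brought back by a full turn. *)
Lemma sector_polar al a dl : 0 <= al < 1 -> 0 <= a -> a + dl <= 1 -> 0 < dl <= 4^-1 ->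
  0 <= sin (2 * pi * (al - a)) -> sin (2 * pi * (al - (a + dl))) < 0 -> a <= al < a + dl.
Proof.
move=> /andP[al0 al1] a0 b1 /andP[d0 d1] h1 h2; apply/andP; split.
  rewrite leNgt; apply/negP => ha; case: (ltP (- 2^-1) (al - a)) => hm.
    have := @sin_turn_lt0 (al - a); rewrite hm /= subr_lt0 ha => /(_ isT); lra.
  have := @sin_turn_ge0 (al - (a + dl) + 1); rewrite sin_turnS.
  suff -> : 0 <= al - (a + dl) + 1 <= 2^-1 by move=> /(_ isT); lra.
  by apply/andP; split; lra.
rewrite ltNge; apply/negP => hb; case: (leP (al - (a + dl)) 2^-1) => hm.
  have := @sin_turn_ge0 (al - (a + dl)); rewrite hm subr_ge0 hb /= => /(_ isT); lra.
have := @sin_turn_lt0 (al - a - 1); rewrite -sin_turnS subrK.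
suff -> : - 2^-1 < al - a - 1 < 0 by move=> /(_ isT); lra.
by apply/andP; split; lra.
Qed.

(** The depth is at most half the cell width [2^-j]: the angular displacement in a Stolz angle, at
    most twice the depth, then stays within one cell. *)
Definition level j z := 2 ^- j.+2 < 1 - cabs z <= 2 ^- j.+1.

(* Generation [0] is the central disc, shared by all [k]; generation [1] is empty,
   so that the sectors of the others are intersections of two half-planes. *)
Definition whit (j k : nat) : set R[i] :=
  match j with
  | 0 => [set z | cabs z < 1 /\ 8^-1 < 1 - cabs z]
  | 1 => set0
  | _ => [set z | level j z /\ (0 <= complex.Im (z / zeta (2 ^- j * k%:R)) /\
                   complex.Im (z / zeta (2 ^- j * k.+1%:R)) < 0)]
  end.

Lemma Im_polar (r x y : R) : complex.Im (r%:C * zeta x / zeta y) = r * sin (2 * pi * (x - y)).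
Proof. by rewrite -mulrA -zetaN -zetaD /= mul0r addr0. Qed.

Lemma whit_lt1 j k z : whit j k z -> cabs z < 1.
Proof.
case: j => [|[|j]] //=; first by case.
by move=> [/andP[h _] _]; rewrite -subr_gt0; apply: lt_trans h; rewrite invr_gt0 exprn_gt0.
Qed.

Lemma dyadic_frac j : (1 < j)%N -> (0 : R) < (2 : R) ^- j <= 4^-1.
Proof.
move=> j1; rewrite invr_gt0 exprn_gt0 //= lef_pV2 ?posrE ?exprn_gt0 //.
by rewrite [leLHS](_ : _ = 2 ^+ 2); [rewrite ler_eXn2l // ltr1n|ring].
Qed.

Lemma dyadic_mul j k : (k < 2 ^ j)%N -> 2 ^- j * k%:R + 2 ^- j <= 1 :> R.
Proof.
move=> kj; rewrite -{2}[2 ^- j]mulr1 -mulrDr natr1 ler_pdivrMl ?exprn_gt0 // mulr1.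
by rewrite -natrX ler_nat.
Qed.

Lemma whit_polar j k z : (1 < j)%N -> (k < 2 ^ j)%N -> whit j k z ->
  level j z /\ exists al, [/\ 0 <= al < 1, 2 ^- j * k%:R <= al < 2 ^- j * k%:R + 2 ^- j &
     z = (cabs z)%:C * zeta al].
Proof.
move=> j1 kj; have [al al01 ez] := polar z.
case: j j1 kj => [|[|j]] // j1 kj [lev [h1 h2]]; split => //; exists al; split => //.
have cz : 0 < cabs z.
  move/andP: lev => [_ lev]; have : 2 ^- j.+3 <= 2^-1 :> R.
    by rewrite lef_pV2 ?posrE ?exprn_gt0 // -[leLHS]expr1 ler_eXn2l // ltr1n.
  lra.
rewrite {1}ez Im_polar pmulr_rge0 // in h1.
rewrite {1}ez Im_polar pmulr_rlt0 // -(natr1 k) [_ * (k%:R + 1)]mulrDr mulr1 in h2.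
have a0 : 0 <= 2 ^- j.+2 * k%:R :> R by rewrite mulr_ge0 // invr_ge0 exprn_ge0.
exact: (sector_polar al01 a0 (dyadic_mul kj) (dyadic_frac j1) h1 h2).
Qed.

Lemma whit_intro j k z al : (1 < j)%N -> level j z -> z = (cabs z)%:C * zeta al ->
  2 ^- j * k%:R <= al < 2 ^- j * k.+1%:R -> whit j k z.
Proof.
move=> j1 lev ez /andP[a1 a2].
have /andP[d0 d1] := dyadic_frac j1.
case: j j1 lev a1 a2 d0 d1 => [|[|j]] // j1 lev a1 a2 d0 d1.
have cz : 0 < cabs z.
  move/andP: lev => [_ lev]; have : 2 ^- j.+3 <= 2^-1 :> R.
    by rewrite lef_pV2 ?posrE ?exprn_gt0 // -[leLHS]expr1 ler_eXn2l // ltr1n.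
  lra.
split=> //; rewrite {1 2}ez !Im_polar pmulr_rge0 // pmulr_rlt0 //.
rewrite -(natr1 k) [_ * (k%:R + 1)]mulrDr mulr1 in a2 *.
split; first by apply: sin_turn_ge0; apply/andP; split; lra.
by apply: sin_turn_lt0; apply/andP; split; lra.
Qed.

Lemma level_inj j j' z : level j z -> level j' z -> j = j'.
Proof.
move=> h h'; apply/eqP; rewrite eqn_leq; apply/andP; split; rewrite leqNgt; apply/negP.
- move=> lt; move/andP: h => [_ h]; move/andP: h' => [h' _].
  have : 2 ^- j.+1 <= 2 ^- j'.+2 :> R by rewrite lef_pV2 ?posrE ?exprn_gt0 // ler_eXn2l // ltr1n.
  lra.
- move=> lt; move/andP: h => [h _]; move/andP: h' => [_ h'].
  have : 2 ^- j'.+1 <= 2 ^- j.+2 :> R by rewrite lef_pV2 ?posrE ?exprn_gt0 // ler_eXn2l // ltr1n.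
  lra.
Qed.

Lemma zeta_inj x y : 0 <= x < 1 -> 0 <= y < 1 -> zeta x = zeta y :> R[i] -> x = y.
Proof.
move=> /andP[x0 x1] /andP[y0 y1] e.
have key (t : R) : `|t| <= 2^-1 -> zeta t = 1 :> R[i] -> t = 0.
  move=> /zeta_chord + e1; rewrite e1 subrr cabs0 => h; apply/eqP.
  by rewrite -normr_eq0 eq_le normr_ge0 andbT; lra.
have e1 : zeta (x - y) = 1 :> R[i] by rewrite zetaD zetaN e divff // zeta_neq0.
case: (leP (x - y) 2^-1) => h1; last first.
  have : x - y - 1 = 0.
    by apply: key; rewrite ?zetaD ?zetaN ?zeta1 -?zetaN -?zetaD ?e1 ?invr1 ?mulr1 // ler_norml; apply/andP; split; lra.
  lra.
case: (leP (- 2^-1) (x - y)) => h2.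
  have : x - y = 0 by apply: key => //; rewrite ler_norml h2 h1.
  lra.
have : x - y + 1 = 0.
  by apply: key; rewrite ?(zetaD (x - y)) ?e1 ?zeta1 ?mulr1 // ler_norml; apply/andP; split; lra.
lra.
Qed.

Lemma whit_inj j k j' k' z : (1 < j)%N -> (1 < j')%N -> (k < 2 ^ j)%N -> (k' < 2 ^ j')%N ->
  whit j k z -> whit j' k' z -> j = j' /\ k = k'.
Proof.
move=> j1 j'1 kj kj' /(whit_polar j1 kj)[lev [al [al01 ha ez]]].
move=> /(whit_polar j'1 kj')[lev' [al' [al'01 ha' ez']]].
have ej := level_inj lev lev'; split => //; subst j'.
have cz : cabs z != 0.
  apply/eqP => z0; move/andP: lev => [_]; rewrite z0 subr0 leNgt => /negP; apply.
  by rewrite invf_lt1 ?exprn_gt0 // exprn_egt1 // ltr1n.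
have eal : al = al'.
  apply: zeta_inj => //; have : (cabs z)%:C * zeta al = (cabs z)%:C * zeta al' by rewrite -ez -ez'.
  by apply: mulfI; rewrite -cabs_eq0 cabsR normr_eq0.
subst al'.
have P0 : 0 < 2 ^- j :> R by rewrite invr_gt0 exprn_gt0.
have SE (m : nat) : 2 ^- j * m%:R + 2 ^- j = 2 ^- j * m.+1%:R :> R.
  by rewrite -(natr1 m) mulrDr mulr1.
move: ha ha'; rewrite (SE k) (SE k') => /andP[h1 h2] /andP[h3 h4].
have := le_lt_trans h1 h4; have := le_lt_trans h3 h2.
rewrite !ltr_pM2l // !ltr_nat !ltnS => l1 l2; apply/eqP; by rewrite eqn_leq l1 l2.
Qed.

Lemma level_exists z : 0 < 1 - cabs z -> 1 - cabs z <= 8^-1 -> exists2 j, (1 < j)%N & level j z.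
Proof.
move=> d0 d8.
have [j /andP[j1 j2]] := @dyadic_scale R (2 * (1 - cabs z)) ltac:(lra) ltac:(lra).
exists j.
  case: j j1 j2 => [|[|j]] // _; first by rewrite expr0 invr1; lra.
  by rewrite expr1; lra.
by rewrite /level !exprS !invfM; apply/andP; split; lra.
Qed.

(* The neighbours [k - 1], [k], [k + 1] of [k] modulo [2 ^ j], for [e = 0, 1, 2]. *)
Definition nb (j k e : nat) := ((k + 2 ^ j + e - 1) %% 2 ^ j)%N.

Lemma nb_lt j k e : (nb j k e < 2 ^ j)%N.
Proof. by rewrite ltn_mod expn_gt0. Qed.

Definition idx j x := Num.truncn (2 ^+ j * x).

Lemma idx_itv j x : 0 <= x -> 2 ^- j * (idx j x)%:R <= x < 2 ^- j * (idx j x).+1%:R.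
Proof.
move=> x0; have /truncn_itv/andP[h1 h2] : 0 <= 2 ^+ j * x by rewrite mulr_ge0 // exprn_ge0.
by rewrite ler_pdivrMl ?exprn_gt0 // h1 ltr_pdivlMl ?exprn_gt0.
Qed.

Lemma idx_lt j x : 0 <= x < 1 -> (idx j x < 2 ^ j)%N.
Proof.
move=> /andP[x0 x1]; rewrite -(ltr_nat R) natrX.
have /truncn_itv/andP[h1 h2] : 0 <= 2 ^+ j * x by rewrite mulr_ge0 // exprn_ge0.
by apply: (le_lt_trans h1); rewrite -[ltRHS]mulr1 ltr_pM2l // exprn_gt0.
Qed.

Let nb_wrap_left (a b P : nat) : (a + P < b.+2 -> b < P -> a + P + 0 - 1 = b)%N.
Proof. lia. Qed.

Let nb_inner (a b P : nat) : (a < b.+2 -> b < a.+2 -> b < P -> a + P + (b + 1 - a) - 1 = b + P)%N.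
Proof. lia. Qed.

Let nb_offset (a b : nat) : (b < a.+2 -> b + 1 - a < 3)%N.
Proof. lia. Qed.

Let nb_wrap_right (a b P : nat) : (b + P < a.+2 -> a < P -> a + P + 2 - 1 = b + P + P)%N.
Proof. lia. Qed.

(** [stolz_sub] bounds the distance from [z] to [zeta x] by [3 (1 - |z|)], the projection of [z] to
    the circle adds [1 - |z|], and half the total bounds the angle [y]: at most [2^-j], one cell.
    The three cases distinguish whether [x + y] leaves [[0, 1)]. *)
Lemma stolz_whit x z : 0 <= x < 1 -> stolz (zeta x) z -> cabs z < 1 ->
  exists j e, (e < 3)%N /\ whit j (nb j (idx j x) e) z.
Proof.
move=> /[dup] x01 /andP[x0 x1] sz z1; have d0 : 0 < 1 - cabs z by rewrite subr_gt0.
have hz := stolz_sub (cabs_zeta x) sz.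
case: (ltP 8^-1 (1 - cabs z)) => d8; first by exists 0%N, 0%N.
have [j j1 lev] := level_exists d0 d8.
have [al _ ez] := polar z.
have /andP[_ dj] := lev.
have [|y [y1 y2 ey]] := @near_zeta R (zeta al) x (4 * (1 - cabs z)) (cabs_zeta al).
  rewrite -(subrKA z (zeta al)); apply: le_trans (cabsD _ _) _.
  have : cabs (zeta al - z) = 1 - cabs z.
    rewrite {1}ez -{1}[zeta al]mul1r -mulrBl cabsM cabs_zeta mulr1.
    by rewrite -(rmorph1 (@real_complex R)) -rmorphB /= cabsR gtr0_norm.
  lra.
have yj : `|y| <= 2 ^- j by move: dj; rewrite exprS invfM; lra.
have P0 : 0 < 2 ^- j :> R by rewrite invr_gt0 exprn_gt0.
rewrite ler_norml in yj; move/andP: yj => [yj1 yj2].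
have /andP[i1 i2] := idx_itv j x0; set k := idx j x in i1 i2 *.
have kj : (k < 2 ^ j)%N by exact: idx_lt.
have fin (al' : R) e k' : 0 <= al' < 1 -> zeta al' = zeta al :> R[i] -> (e < 3)%N ->
  idx j al' = k' -> (k' < 2 ^ j)%N -> (k + 2 ^ j + e - 1 = k' %[mod 2 ^ j])%N ->
  exists j e, (e < 3)%N /\ whit j (nb j (idx j x) e) z.
  move=> /andP[a0 a1] ea e3 ek kk ke; exists j, e; split=> //.
  rewrite /nb -/k ke modn_small // -ek.
  by apply: (whit_intro j1 lev (al := al')); [rewrite ea|exact: idx_itv].
have nat_lt (a b : nat) : 2 ^- j * a%:R < 2 ^- j * b%:R :> R -> (a < b)%N.
  by rewrite ltr_pM2l // ltr_nat.
have PX : 2 ^- j * (2 ^ j)%:R = 1 :> R by rewrite natrX mulVf // expf_neq0.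
have SE (m : nat) : 2 ^- j * m.+1%:R = 2 ^- j * m%:R + 2 ^- j :> R.
  by rewrite -(natr1 m) mulrDr mulr1.
have DE (m : nat) : 2 ^- j * (m + 2 ^ j)%N%:R = 2 ^- j * m%:R + 1 :> R.
  by rewrite natrD mulrDr PX.
rewrite SE in i2.
case: (ltP (x + y) 0) => xy0.
  have h01 : 0 <= x + y + 1 < 1.
    apply/andP; split; last by lra.
    have := dyadic_mul kj; have : 0 <= 2 ^- j * k%:R :> R by rewrite mulr_ge0 // ltW.
    lra.
  have /andP[k1 k2] := idx_itv j (proj1 (andP h01)).
  have kk := idx_lt j h01; set k' := idx j _ in k1 k2 kk.
  rewrite SE in k2.
  have l1 : (k + 2 ^ j < k'.+2)%N by apply: nat_lt; rewrite !SE DE; lra.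
  apply: (fin (x + y + 1) 0%N k') => //; first by rewrite zetaD zeta1 mulr1.
  by congr (_ %% _)%N; apply: nb_wrap_left.
case: (ltP (x + y) 1) => xy1.
  have h01 : 0 <= x + y < 1 by rewrite xy0.
  have /andP[k1 k2] := idx_itv j (proj1 (andP h01)).
  have kk := idx_lt j h01; set k' := idx j _ in k1 k2 kk.
  rewrite SE in k2.
  have l1 : (k < k'.+2)%N by apply: nat_lt; rewrite !SE; lra.
  have l2 : (k' < k.+2)%N by apply: nat_lt; rewrite !SE; lra.
  apply: (fin (x + y) (k' + 1 - k)%N k') => //; first exact: nb_offset.
  by rewrite -(modnDr k'); congr (_ %% _)%N; apply: nb_inner.
have h01 : 0 <= x + y - 1 < 1.
  apply/andP; split; first by lra.
  have /andP[_ dj4] := dyadic_frac j1; lra.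
have /andP[k1 k2] := idx_itv j (proj1 (andP h01)).
have kk := idx_lt j h01; set k' := idx j _ in k1 k2 kk.
have l1 : (k' + 2 ^ j < k.+2)%N by apply: nat_lt; rewrite !SE DE; lra.
apply: (fin (x + y - 1) 2%N k') => //.
  by rewrite (zetaD (x + y)) zetaN zeta1 invr1 mulr1.
have -> : (k + 2 ^ j + 2 - 1 = k' + 2 ^ j + 2 ^ j)%N by exact: nb_wrap_right.
by rewrite !modnDr.
Qed.

End whitney.

(** * Discrete Poisson kernels *)

Section finite_operators.
Context {R : realType} {I : finType}.
Implicit Types (a b : I -> R) (L : I -> I -> R).

(** Lagrange's identity: the difference of the two sides is half the sum of the squares
    [(a i * b j - a j * b i)^2]. *)
Lemma cauchy_schwarz a b :
  (\sum_i a i * b i) ^+ 2 <= (\sum_i a i ^+ 2) * \sum_i b i ^+ 2.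
Proof.
have h : 0 <= \sum_i \sum_j (a i * b j - a j * b i) ^+ 2.
  by apply: sumr_ge0 => i _; apply: sumr_ge0 => j _; exact: sqr_ge0.
have e1 : (\sum_i a i ^+ 2) * \sum_i b i ^+ 2 = \sum_i \sum_j a i ^+ 2 * b j ^+ 2.
  by rewrite mulr_suml; apply: eq_bigr => i _; rewrite mulr_sumr.
have e2 : (\sum_i a i ^+ 2) * \sum_i b i ^+ 2 = \sum_i \sum_j a j ^+ 2 * b i ^+ 2.
  by rewrite e1 exchange_big.
have e3 : (\sum_i a i * b i) ^+ 2 = \sum_i \sum_j (a i * b i) * (a j * b j).
  by rewrite expr2 mulr_suml; apply: eq_bigr => i _; rewrite mulr_sumr.
suff e4 : \sum_i \sum_j (a i * b j - a j * b i) ^+ 2 =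
  2 * ((\sum_i a i ^+ 2) * \sum_i b i ^+ 2) - 2 * (\sum_i a i * b i) ^+ 2.
  by rewrite e4 in h; lra.
have -> : 2 * ((\sum_i a i ^+ 2) * \sum_i b i ^+ 2) - 2 * (\sum_i a i * b i) ^+ 2 =
  (\sum_i \sum_j a i ^+ 2 * b j ^+ 2) + (\sum_i \sum_j a j ^+ 2 * b i ^+ 2)
    - 2 * \sum_i \sum_j (a i * b i) * (a j * b j) by rewrite -e1 -e2 -e3; ring.
rewrite mulr_sumr -big_split -sumrB /=; apply: eq_bigr => i _.
rewrite mulr_sumr -big_split -sumrB /=; apply: eq_bigr => j _; ring.
Qed.

(* With [T = L b]: [|T|^2 = <L^* T, b>] and [|L^* T|^2 = <L L^* T, T> <= 2 C <L T, T>],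
   so if [M] is the best constant, then [M <= 2 C sqrt M]. *)
Lemma ttstar L (C : R) : 0 <= C -> (forall l k, 0 <= L l k) ->
  (forall l l', \sum_k L l k * L l' k <= C * (L l l' + L l' l)) ->
  forall b, (forall i, 0 <= b i) ->
  \sum_l (\sum_k L l k * b k) ^+ 2 <= (2 * C) ^+ 2 * \sum_i b i ^+ 2.
Proof.
move=> C0 L0 hL.
pose T b l := \sum_k L l k * b k.
have T0 b : (forall i, 0 <= b i) -> forall i, 0 <= T b i.
  by move=> b0 i; apply: sumr_ge0 => k _; rewrite mulr_ge0.
pose sq b := \sum_i b i ^+ 2.
have sq0 b : 0 <= sq b by apply: sumr_ge0 => i _; exact: sqr_ge0.
pose V := [set M : R | 0 <= M /\ forall b, (forall i, 0 <= b i) -> sq (T b) <= M * sq b].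
(* The Cauchy-Schwarz inequality in each row provides some constant; so the best one exists and can
   be compared with itself. *)
have V0 : V (\sum_l \sum_k L l k ^+ 2).
  split; first by apply: sumr_ge0 => l _; apply: sumr_ge0 => k _; exact: sqr_ge0.
  by move=> b b0; rewrite mulr_suml; apply: ler_sum => l _; exact: cauchy_schwarz.
have hV : has_inf V by split; [by exists (\sum_l \sum_k L l k ^+ 2)|exists 0 => x []].
pose M := inf V.
have M0 : 0 <= M by apply: lb_le_inf; [by case: hV|move=> x []].
have VM : V M.
  split=> // b b0; have := sq0 b; rewrite le_eqVlt => /orP[/eqP e|bp].
    by have [_ /(_ b b0)] := V0; rewrite -e !mulr0.
  rewrite -ler_pdivrMr //; apply: lb_le_inf; first by case: hV.
  by move=> x [_ /(_ b b0)]; rewrite ler_pdivrMr.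
have step : V (2 * C * Num.sqrt M).
  split; first by rewrite !mulr_ge0 // sqrtr_ge0.
  move=> b b0; pose t := T b; have t0 : forall i, 0 <= t i by exact: T0.
  pose ts k := \sum_l t l * L l k.
  have e1 : sq t = \sum_k ts k * b k.
    transitivity (\sum_l \sum_k t l * L l k * b k).
      apply: eq_bigr => l _; rewrite expr2 {2}/t /T mulr_sumr.
      by apply: eq_bigr => k _; rewrite mulrA.
    rewrite exchange_big; apply: eq_bigr => k _.
    by rewrite /ts mulr_suml.
  have e2 : sq ts = \sum_l \sum_l' t l * t l' * \sum_k L l k * L l' k.
    transitivity (\sum_k \sum_l \sum_l' t l * t l' * (L l k * L l' k)).
      apply: eq_bigr => k _; rewrite expr2 {1}/ts mulr_suml; apply: eq_bigr => l _.
      rewrite /ts mulr_sumr; apply: eq_bigr => l' _; ring.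
    rewrite exchange_big; apply: eq_bigr => l _; rewrite exchange_big.
    by apply: eq_bigr => l' _; rewrite mulr_sumr.
  have e3 : sq ts <= 2 * C * \sum_l t l * T t l.
    have -> : 2 * C * \sum_l t l * T t l =
        \sum_l \sum_l' t l * t l' * (C * (L l l' + L l' l)).
      transitivity (C * (\sum_l \sum_l' t l * t l' * L l l') +
                    C * (\sum_l \sum_l' t l * t l' * L l' l)).
        have f1 : \sum_l t l * T t l = \sum_l \sum_l' t l * t l' * L l l'.
          apply: eq_bigr => l _; rewrite /T mulr_sumr; apply: eq_bigr => k _; ring.
        have f2 : \sum_l t l * T t l = \sum_l \sum_l' t l * t l' * L l' l.
          rewrite f1 exchange_big; apply: eq_bigr => l _.
          by apply: eq_bigr => k _; rewrite [t k * t l]mulrC.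
        by rewrite -f1 -f2; ring.
      rewrite !mulr_sumr -big_split /=; apply: eq_bigr => l _.
      by rewrite !mulr_sumr -big_split /=; apply: eq_bigr => k _; ring.
    rewrite e2; apply: ler_sum => l _; apply: ler_sum => l' _.
    by apply: ler_wpM2l => //; rewrite mulr_ge0.
  have e4 : \sum_l t l * T t l <= Num.sqrt M * sq t.
    have h0 : 0 <= \sum_l t l * T t l by apply: sumr_ge0 => l _; rewrite mulr_ge0 // T0.
    rewrite -(@ler_pXn2r _ 2) ?nnegrE ?mulr_ge0 ?sqrtr_ge0 //.
    apply: le_trans (cauchy_schwarz _ _) _; rewrite exprMn sqr_sqrtr // expr2 -/(sq t).
    rewrite mulrCA; apply: ler_wpM2l => //; exact: (VM.2 t t0).
  have e5 : sq t ^+ 2 <= (2 * C * Num.sqrt M * sq b) * sq t.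
    rewrite {1}e1; apply: le_trans (cauchy_schwarz _ _) _; rewrite -/(sq ts) -/(sq b).
    have -> : 2 * C * Num.sqrt M * sq b * sq t = (2 * C * (Num.sqrt M * sq t)) * sq b by ring.
    apply: ler_wpM2r => //; apply: (le_trans e3); apply: ler_wpM2l e4.
    by rewrite mulr_ge0.
  have := sq0 t; rewrite le_eqVlt => /orP[/eqP <-|tp].
    by rewrite !mulr_ge0 // sqrtr_ge0.
  by rewrite expr2 ler_pM2r in e5.
have le : M <= 2 * C * Num.sqrt M by apply: ge_inf => //; case: hV.
have sM : Num.sqrt M <= 2 * C.
  have := sqrtr_ge0 M; rewrite le_eqVlt => /orP[/eqP <-|sp]; first by rewrite mulr_ge0.
  by move: le; rewrite -{1}(sqr_sqrtr M0) expr2 ler_pM2r.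
move=> b b0; apply: le_trans (VM.2 b b0) _; apply: ler_wpM2r => //.
by rewrite -(sqr_sqrtr M0) ler_pXn2r ?nnegrE ?sqrtr_ge0 // mulr_ge0.
Qed.

End finite_operators.

Section poisson_kernel.
Context {R : realType}.
Variable n : nat.
Implicit Types (r y : R).

Notation h := ((2 : R) ^- n).

Definition grid (k : nat) : R[i] := zeta (h * k%:R).

(** A model of the Poisson kernel at height [r] over [grid l]; with a sum in the denominator the
    triangle inequality applies directly. *)
Definition kern r (l k : nat) : R := r / (r + cabs (grid l - grid k)) ^+ 2.

Let h0 : 0 < h. Proof. by rewrite invr_gt0 exprn_gt0. Qed.
Let hN : h * (2 ^ n)%:R = 1. Proof. by rewrite natrX mulVf // expf_neq0. Qed.

Lemma kern_ge0 r l k : 0 < r -> 0 <= kern r l k.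
Proof. by move=> r0; rewrite divr_ge0 ?(ltW r0) // exprn_ge0 // addr_ge0 ?cabs_ge0 // ltW. Qed.

Lemma kern_shift r c l l' k : 0 < r -> 0 <= c -> cabs (grid l - grid l') <= c * r ->
  kern r l' k <= (1 + c) ^+ 2 * kern r l k.
Proof.
move=> r0 c0 hc; rewrite /kern.
set A := cabs (grid l - grid k); set B := cabs (grid l' - grid k).
have B0 : 0 <= B by exact: cabs_ge0.
have A0 : 0 <= A by exact: cabs_ge0.
have AB : A <= c * r + B by rewrite /A -(subrKA (grid l')); apply: le_trans (cabsD _ _) _; rewrite lerD2r.
rewrite mulrA ler_pdivrMr ?exprn_gt0 ?ltr_pwDl // mulrAC ler_pdivlMr ?exprn_gt0 ?ltr_pwDl //.
rewrite [_ ^+ 2 * r]mulrC -mulrA; apply: ler_wpM2l; first exact: ltW.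
rewrite -exprMn ler_pXn2r ?nnegrE ?mulr_ge0 ?addr_ge0 ?(ltW r0) //.
have : 0 <= c * B by rewrite mulr_ge0.
lra.
Qed.

(* [F y = y / (r + |y|)] has derivative [r / (r + |y|)^2]. *)
Lemma kern_telescope r (c : R) : h <= r ->
  (forall k, (k < 2 ^ n)%N -> 0 <= h * k%:R - c \/ h * k%:R - c <= - h) ->
  \sum_(k < 2 ^ n) h * (r / (r + `|h * k%:R - c|) ^+ 2) <= 4.
Proof.
move=> hr hc; have r0 : 0 < r by exact: lt_le_trans hr.
pose F (k : nat) := (h * k%:R - c) / (r + `|h * k%:R - c|).
have F1 k : `|F k| <= 1.
  rewrite /F normrM normfV; set y := `|h * k%:R - c|.
  have y0 : 0 <= y by exact: normr_ge0.
  rewrite gtr0_norm ?ltr_pwDl // ler_pdivrMr ?ltr_pwDl // mul1r; lra.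
(* The factor 2: consecutive denominators differ by [h <= r], so their ratio is at most 2. No step
   crosses [c], so the absolute value is linear on each step. *)
apply: (@le_trans _ _ (\sum_(0 <= k < 2 ^ n) 2 * (F k.+1 - F k))).
  rewrite big_mkord; apply: ler_sum => k _.
  have hS : h * k.+1%:R - c = h * k%:R - c + h by rewrite -(natr1 k) mulrDr mulr1; ring.
  have := hc k (ltn_ord k); rewrite /F hS.
  move: (h * k%:R - c) => y; move: h h0 hr => g g0 gr; case=> y0.
    rewrite !ger0_norm ?addr_ge0 ?(ltW g0) //.
    have p1 : 0 < r + y by rewrite ltr_pwDl.
    have p2 : 0 < r + (y + g) by rewrite ltr_pwDl // addr_ge0 // ltW.
    have -> : (y + g) / (r + (y + g)) - y / (r + y) = g * (r / ((r + y) * (r + (y + g)))).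
      by field; rewrite !gt_eqF.
    rewrite [leRHS]mulrCA; apply: ler_wpM2l; first exact: ltW.
    rewrite [leRHS]mulrCA; apply: ler_wpM2l; first exact: ltW.
    rewrite -[leLHS]div1r ler_pdivrMr ?exprn_gt0 // mulrAC ler_pdivlMr ?mulr_gt0 // mul1r expr2 [leRHS]mulrCA.
    apply: ler_wpM2l; first exact: ltW.
    lra.
  rewrite !ler0_norm; [|by lra|by lra].
  have p1 : 0 < r - y by lra.
  have p2 : 0 < r - (y + g) by lra.
  have -> : (y + g) / (r - (y + g)) - y / (r - y) = g * (r / ((r - y) * (r - (y + g)))).
    by field; rewrite !gt_eqF.
  rewrite [leRHS]mulrCA; apply: ler_wpM2l; first exact: ltW.
  rewrite [leRHS]mulrCA; apply: ler_wpM2l; first exact: ltW.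
  rewrite -[leLHS]div1r ler_pdivrMr ?exprn_gt0 // mulrAC ler_pdivlMr ?mulr_gt0 // mul1r expr2 [leRHS]mulrCA.
  apply: ler_wpM2l; first exact: ltW.
  lra.
rewrite -mulr_sumr telescope_sumr //.
have := F1 0%N; have := F1 (2 ^ n)%N; rewrite !ler_norml => /andP[_ a2] /andP[b1 _].
lra.
Qed.

(** The circle is unrolled: the representative of [h k - x] in [[- 1/2, 1/2]] is one of three
    translates, and [kern_telescope] bounds the sum for each by 4. *)
Lemma kern_sum r (l : 'I_(2 ^ n)) : h <= r -> \sum_(k < 2 ^ n) h * kern r l k <= 12.
Proof.
move=> hr; have r0 : 0 < r by exact: lt_le_trans hr.
pose P c k := h * (r / (r + `|h * k%:R - c|) ^+ 2).
pose x := h * l%:R.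
have P0 c k : 0 <= P c k.
  by rewrite mulr_ge0 ?(ltW h0) // divr_ge0 ?(ltW r0) // exprn_ge0 // addr_ge0 // ltW.
have xl : h * (l.+1)%:R <= 1 by rewrite -[leRHS]hN ler_pM2l // ler_nat.
have x0 : 0 <= x by rewrite mulr_ge0 // ltW.
apply: (@le_trans _ _ (\sum_(k < 2 ^ n) (P x k + P (x - 1) k + P (x + 1) k))).
  apply: ler_sum => k _.
  have k0 : 0 <= h * k%:R by rewrite mulr_ge0 // ltW.
  have k1 : h * (k.+1)%:R <= 1 by rewrite -[leRHS]hN ler_pM2l // ler_nat.
  have x1 : x < 1 by apply: lt_le_trans xl; rewrite ltr_pM2l // ltr_nat.
  have k1' : h * k%:R < 1 by apply: lt_le_trans k1; rewrite ltr_pM2l // ltr_nat.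
  have aux c : `|h * k%:R - c| <= cabs (grid l - grid k) -> h * kern r l k <= P c k.
    move=> hc; apply: ler_wpM2l; first exact: ltW.
    apply: ler_wpM2l; first exact: ltW.
    rewrite lef_pV2 ?posrE ?exprn_gt0 ?ltr_pwDl // ?cabs_ge0 //.
    by rewrite ler_pXn2r ?nnegrE ?addr_ge0 ?(ltW r0) ?cabs_ge0 // lerD2l.
  have chord y : zeta y = zeta (h * k%:R - x) :> R[i] -> `|y| <= 2^-1 ->
      `|y| <= cabs (grid l - grid k).
    move=> ey y2; have := zeta_chord y2; rewrite ey.
    rewrite -zeta_sub -/(grid k) -/(grid l) cabsB => h1; apply: le_trans h1.
    by have := normr_ge0 y; lra.
  have p1 := P0 x k; have p2 := P0 (x - 1) k; have p3 := P0 (x + 1) k.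
  have [y1|y1] := leP (h * k%:R - x) (- 2^-1).
    apply: (@le_trans _ _ (P (x - 1) k)); last by lra.
    apply: aux; apply: chord; first by rewrite opprB addrCA zetaD zeta1 mul1r.
    by rewrite ler_norml; apply/andP; split; lra.
  have [y2|y2] := leP (h * k%:R - x) 2^-1.
    apply: (@le_trans _ _ (P x k)); last by lra.
    by apply: aux; apply: chord => //; rewrite ler_norml y2 ltW.
  apply: (@le_trans _ _ (P (x + 1) k)); last by lra.
  apply: aux; apply: chord; first by rewrite opprD addrA (zetaD _ (-1)) zetaN zeta1 invr1 mulr1.
  by rewrite ler_norml; apply/andP; split; lra.
rewrite !big_split /=.
have t1 : \sum_(k < 2 ^ n) P x k <= 4.
  apply: kern_telescope => // k _; case: (leqP l k) => lk.
    by left; rewrite -mulrBr mulr_ge0 ?(ltW h0) // subr_ge0 ler_nat.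
  right; have : h * k.+1%:R <= x by rewrite ler_pM2l // ler_nat.
  by rewrite -(natr1 k) mulrDr mulr1; lra.
have t2 : \sum_(k < 2 ^ n) P (x - 1) k <= 4.
  apply: kern_telescope => // k _; left.
  have k0 : 0 <= h * k%:R by rewrite mulr_ge0 // ltW.
  have x1 : x < 1 by apply: lt_le_trans xl; rewrite ltr_pM2l // ltr_nat.
  lra.
have t3 : \sum_(k < 2 ^ n) P (x + 1) k <= 4.
  apply: kern_telescope => // k kn; right.
  have k1 : h * (k.+1)%:R <= 1 by rewrite -[leRHS]hN ler_pM2l // ler_nat.
  by move: k1; rewrite -(natr1 k) mulrDr mulr1; lra.
lra.
Qed.

(** With distances between grid points, one of [r + |l - k|] and [r' + |l' - k|] is at least half of
    [r + |l - l'|]. The kernel with that denominator is at most [4 kern r l l'], and the other one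
    is kept. *)
Lemma kern_prod r r' l l' k : 0 < r' -> r' <= r ->
  kern r l k * kern r' l' k <= 4 * kern r l l' * (kern r l k + kern r' l' k).
Proof.
move=> r'0 rr; have r0 : 0 < r by exact: lt_le_trans rr.
have K1 := kern_ge0 l k r0; have K2 := kern_ge0 l' k r'0; have K3 := kern_ge0 l l' r0.
set D := cabs (grid l - grid l'); have D0 : 0 <= D by exact: cabs_ge0.
have tri : D <= cabs (grid l - grid k) + cabs (grid l' - grid k).
  by rewrite /D -(subrKA (grid k)) (cabsB (grid l')); exact: cabsD.
have aux u d : 0 < u -> u <= r -> 0 <= d -> r + D <= 2 * (u + d) ->
    u / (u + d) ^+ 2 <= 4 * kern r l l'.
  move=> u0 ur d0 hd; rewrite /kern -/D mulrA.
  apply: (@le_trans _ _ (r / (u + d) ^+ 2)).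
    by apply: ler_wpM2r => //; rewrite invr_ge0 exprn_ge0 // addr_ge0 // ltW.
  rewrite ler_pdivrMr ?exprn_gt0 ?ltr_pwDl // mulrAC ler_pdivlMr ?exprn_gt0 ?ltr_pwDl //.
  have : (r + D) ^+ 2 <= (2 * (u + d)) ^+ 2.
    by rewrite ler_pXn2r ?nnegrE ?mulr_ge0 ?addr_ge0 ?(ltW r0) ?(ltW u0).
  move=> h1; apply: (@le_trans _ _ (r * (2 * (u + d)) ^+ 2)); first by rewrite ler_pM2l.
  by rewrite le_eqVlt; apply/orP; left; apply/eqP; ring.
rewrite mulrDr.
have P1 : 0 <= 4 * kern r l l' * kern r l k by apply: mulr_ge0 K1; apply: mulr_ge0 K3.
have P2 : 0 <= 4 * kern r l l' * kern r' l' k by apply: mulr_ge0 K2; apply: mulr_ge0 K3.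
case: (leP (r + D) (2 * (r + cabs (grid l - grid k)))) => hd.
  have := aux _ _ r0 (lexx r) (cabs_ge0 _) hd; rewrite -/(kern r l k) => h1.
  have h2 := ler_wpM2r K2 h1; lra.
have := aux _ _ r'0 rr (cabs_ge0 (grid l' - grid k)); rewrite -/(kern r' l' k) => h1.
have h2 : kern r' l' k <= 4 * kern r l l' by apply: h1; lra.
have := ler_wpM2l K1 h2; rewrite [kern r l k * (4 * _)]mulrC; lra.
Qed.

(** [96 = 4 (12 + 12)], from [kern_prod] and the mass 12 of each kernel. *)
Lemma kern_comp r r' (l l' : 'I_(2 ^ n)) : h <= r' -> r' <= r ->
  \sum_(k < 2 ^ n) (h * kern r l k) * (h * kern r' l' k) <= 96 * (h * kern r l l').
Proof.
move=> hr rr; have r'0 : 0 < r' by exact: lt_le_trans hr.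
have r0 : 0 < r by exact: lt_le_trans rr.
apply: (@le_trans _ _ (\sum_(k < 2 ^ n) 4 * (h * kern r l l') * (h * kern r l k + h * kern r' l' k))).
  apply: ler_sum => k _.
  have -> : h * kern r l k * (h * kern r' l' k) = h * h * (kern r l k * kern r' l' k) by ring.
  have -> : 4 * (h * kern r l l') * (h * kern r l k + h * kern r' l' k) =
    h * h * (4 * kern r l l' * (kern r l k + kern r' l' k)) by ring.
  by apply: ler_wpM2l; [rewrite mulr_ge0 // ltW|exact: kern_prod].
rewrite -mulr_sumr big_split /=.
have := kern_sum l (le_trans hr rr); have := kern_sum l' hr => s1 s2.
have K3 : 0 <= 4 * (h * kern r l l') by rewrite mulr_ge0 // mulr_ge0 ?(ltW h0) // kern_ge0.
have -> : 96 * (h * kern r l l') = 4 * (h * kern r l l') * (12 + 12) by ring.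
by apply: ler_wpM2l => //; exact: lerD.
Qed.

(** The radius varies with the row, which linearises a maximal operator. Of two rows, the one with
    the larger radius provides the bound of [kern_comp]; this is the hypothesis of [ttstar] with
    [C = 96]. *)
Lemma kern_square (r : nat -> R) (b : nat -> R) : (forall l, h <= r l) -> (forall k, 0 <= b k) ->
  \sum_(l < 2 ^ n) (\sum_(k < 2 ^ n) h * kern (r l) l k * b k) ^+ 2 <=
  (2 * 96) ^+ 2 * \sum_(k < 2 ^ n) b k ^+ 2.
Proof.
move=> hr b0.
apply: (@ttstar R _ (fun l k : 'I_(2 ^ n) => h * kern (r l) l k) 96 _ _ _ (fun k => b k)) => //.
  by move=> l k; rewrite mulr_ge0 ?(ltW h0) // kern_ge0 // (lt_le_trans h0).
move=> l l'.
have p m k : 0 <= h * kern (r m) m k by rewrite mulr_ge0 ?(ltW h0) // kern_ge0 // (lt_le_trans h0).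
have p1 := p l l'; have p2 := p l' l.
case: (leP (r l') (r l)) => rr.
  by apply: le_trans (kern_comp l l' (hr _) rr) _; lra.
under eq_bigr do rewrite mulrC.
by apply: le_trans (kern_comp l' l (hr _) (ltW rr)) _; lra.
Qed.

End poisson_kernel.

Lemma Re_poisson {R : realType} (a z : R[i]) :
  complex.Re ((a + z) / (a - z)) = (cabs a ^+ 2 - cabs z ^+ 2) / cabs (a - z) ^+ 2.
Proof.
rewrite !cabs_sqr; case: a z => a1 a2 [z1 z2] /=.
ring.
Qed.

(** The 6 bounds [(rho^2 - |z|^2) / r], and [833 = 16 (1 + 50 + 1) + 1] compares
    [r + |grid l - grid k|] with the distance [D >= r / 16] from [z] to the pole. *)
Definition grid_const {R : realType} : R := 145 * 6 * 833 ^+ 2.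

Lemma grid_const_ge0 {R : realType} : 0 <= grid_const :> R.
Proof. exact: mulr_ge0 (mulr_ge0 (ler0n _ _) (ler0n _ _)) (exprn_ge0 _ (ler0n _ _)). Qed.

(** * Majorant by a discrete Poisson sum *)

Section grid_majorant.
Context {R : realType} {X : normedModType R[i]}.
Variables (n m : nat) (f : R[i] -> X) (b : nat -> R).
Notation h := ((2 : R) ^- n).
Hypothesis df : forall z, cabs z <= 1 -> cdiff f z.
Hypothesis b0 : forall k, 0 < b k.
Hypothesis fb : forall k x, (k < 2 ^ n)%N -> h * k%:R <= x < h * k.+1%:R ->
  rnorm (f (zeta x)) <= b k ^+ m.+1.

Let h0 : 0 < h. Proof. by rewrite invr_gt0 exprn_gt0. Qed.
Let h1 : h <= 1. Proof. by rewrite invf_le1 ?exprn_gt0 // exprn_ege1 // ler1n. Qed.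

Let rho : R := 1 + h.
Let pole k : R[i] := rho%:C * grid n k.

(* The poles lie at distance [h], the mesh of the grid, outside the circle; on an
   arc of the grid the term of that arc alone dominates [b k]: [145] is the least
   integer above [17 ^ 2 / 2], where [17 h] bounds the distance to the pole. *)
Definition poisson_sum (z : R[i]) : CC R :=
  (145 * h)%:C *: \sum_(k < 2 ^ n) (b k)%:C *: ((pole k + z) / (pole k - z) : CC R).

Let cabs_pole k : cabs (pole k) = rho.
Proof. by rewrite cabs_polar // addr_ge0 // ltW. Qed.

Let pole_dist k z : 1 - cabs z + h <= cabs (pole k - z).
Proof. by have := h0; have := cabs_sub (pole k) z; rewrite cabs_pole /rho; lra. Qed.

Let Re_sumE z : complex.Re (poisson_sum z) =
  145 * h * \sum_(k < 2 ^ n) b k * ((rho ^+ 2 - cabs z ^+ 2) / cabs (pole k - z) ^+ 2).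
Proof.
rewrite Re_scale Re_sum; congr (_ * _); apply: eq_bigr => k _.
by rewrite Re_scale Re_poisson cabs_pole.
Qed.

Let term_ge0 k z : cabs z <= 1 -> 0 < (rho ^+ 2 - cabs z ^+ 2) / cabs (pole k - z) ^+ 2.
Proof.
move=> z1; apply: divr_gt0; last by rewrite exprn_gt0 //; have := h0; have := pole_dist k z; lra.
by rewrite subr_gt0 ltr_pXn2r ?nnegrE ?cabs_ge0 //; rewrite /rho; have := h0; lra.
Qed.

Let cdiff_poisson z : cabs z <= 1 -> cdiff poisson_sum z.
Proof.
move=> z1; apply: cdiffZ; first exact: cdiff_cst.
apply: cdiff_sum => k; apply: cdiffZ; first exact: cdiff_cst.
apply: cdiffM; first by apply: cdiffD; [exact: cdiff_cst|exact: cdiff_id].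
apply: cdiffV; last by apply: cdiffD; [exact: cdiff_cst|apply: cdiffN; exact: cdiff_id].
by rewrite -cabs_gt0; have := h0; have := pole_dist k z; lra.
Qed.

(** [harmonic_majorant] carries the domination by [poisson_sum] from the circle to [z]; what remains
    is the comparison of its terms with [kern], at a depth comparable with [r]. *)
Lemma grid_majorant (r : R) (l : nat) z : h <= r -> cabs z < 1 -> 16^-1 * r <= 1 - cabs z <= r ->
  cabs (z - grid n l) <= 50 * r ->
  rnorm (f z) <= (grid_const * \sum_(k < 2 ^ n) h * kern n r l k * b k) ^+ m.+1.
Proof.
move=> hr z1 /andP[d1 d2] zl; have hp := h0; have hp1 := h1; have r0 : 0 < r by exact: lt_le_trans hr.
have P0 u : cabs u <= 1 -> 0 < complex.Re (poisson_sum u).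
  move=> u1; have p2 : (0 < 2 ^ n)%N by rewrite expn_gt0.
  rewrite Re_sumE; apply: mulr_gt0; first by rewrite mulr_gt0.
  rewrite (bigD1 (Ordinal p2)) //=; apply: ltr_pwDl; first by rewrite mulr_gt0 // term_ge0.
  by apply: sumr_ge0 => k _; rewrite mulr_ge0 ?(ltW (b0 _)) // ltW // term_ge0.
have Pc w : cabs w = 1 -> rnorm (f w) <= complex.Re (poisson_sum w) ^+ m.+1.
  move=> w1; have [x x01 ew] := polar_unit w1.
  have [k kn /andP[k1 k2]] := dyadic_index n x01.
  rewrite ew; apply: (le_trans (fb kn _)); first by rewrite k1 k2.
  apply: lerXn2r; rewrite ?nnegrE ?(ltW (b0 _)) //; first by rewrite ltW // P0 // cabs_zeta.
  rewrite Re_sumE cabs_zeta expr1n (bigD1 (Ordinal kn)) //=.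
  rewrite -[leLHS]addr0 mulrDr; apply: lerD; last first.
    rewrite mulr_ge0 ?mulr_ge0 ?(ltW h0) //; apply: sumr_ge0 => i _.
    rewrite mulr_ge0 ?(ltW (b0 _)) //; have := @term_ge0 i (zeta x).
    by rewrite cabs_zeta expr1n => /(_ (lexx _))/ltW.
  have D1 : cabs (pole k - zeta x) <= 17 * h.
    rewrite -(subrKA (grid n k)); apply: le_trans (cabsD _ _) _.
    have -> : cabs (pole k - grid n k) = h.
      rewrite /pole -{2}[grid n k]mul1r -mulrBl cabsM cabs_zeta mulr1 /rho rmorphD rmorph1 /=.
      by rewrite addrAC subrr add0r cabsR gtr0_norm.
    have := zeta_lip (h * k%:R) x; rewrite -/(grid n k).
    have : `|h * k%:R - x| <= h.
      by move: k2; rewrite -(natr1 k) mulrDr mulr1 => k2; rewrite ler_norml; apply/andP; split; lra.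
    lra.
  have D0 : 0 < cabs (pole k - zeta x).
    by have := pole_dist k (zeta x); rewrite cabs_zeta subrr add0r; apply: lt_le_trans.
  have -> : 145 * h * (b k * ((rho ^+ 2 - 1) / cabs (pole k - zeta x) ^+ 2)) =
     b k * (145 * h * (rho ^+ 2 - 1) / cabs (pole k - zeta x) ^+ 2) by ring.
  rewrite ler_pMr // ler_pdivlMr ?exprn_gt0 // mul1r.
  apply: (@le_trans _ _ ((17 * h) ^+ 2)).
    by apply: lerXn2r; rewrite ?nnegrE ?cabs_ge0 // mulr_ge0 // ltW.
  have hh : 0 <= h * h by rewrite mulr_ge0 // ltW.
  have hhh : 0 <= h * h * h by rewrite mulr_ge0 // ltW.
  rewrite /rho (_ : (17 * h) ^+ 2 = 289 * (h * h)); last by ring.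
  by rewrite (_ : 145 * h * ((1 + h) ^+ 2 - 1) = 290 * (h * h) + 145 * (h * h * h)); [lra|ring].
apply: le_trans (harmonic_majorant df cdiff_poisson P0 Pc z1) _.
have S0 : 0 <= grid_const * \sum_(k < 2 ^ n) h * kern n r l k * b k.
  apply: mulr_ge0 grid_const_ge0 _; apply: sumr_ge0 => k _.
  by apply: mulr_ge0 (ltW (b0 k)); apply: mulr_ge0 (ltW h0) _; exact: kern_ge0.
apply: lerXn2r; [by rewrite nnegrE (ltW (P0 _ (ltW z1)))|by rewrite nnegrE|].
rewrite Re_sumE !mulr_sumr; apply: ler_sum => k _.
set D := cabs (pole k - z).
have D16 : 16^-1 * r <= D by have := pole_dist k z; rewrite -/D; lra.
have Dp : 0 < D by apply: lt_le_trans D16; rewrite mulr_gt0.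
have t1 : rho ^+ 2 - cabs z ^+ 2 <= 6 * r.
  have c0 := cabs_ge0 z.
  rewrite subr_sqr; apply: (@le_trans _ _ (2 * r * 3)); last by lra.
  by apply: ler_pM; rewrite /rho; have := h0; lra.
have t2 : r + cabs (grid n l - grid n k) <= 833 * D.
  have : cabs (grid n l - grid n k) <= 50 * r + (D + h).
    rewrite -(subrKA z); apply: le_trans (cabsD _ _) _; rewrite cabsB; apply: lerD => //.
    rewrite -(subrKA (pole k)); apply: le_trans (cabsD _ _) _.
    rewrite (cabsB z) -/D; apply: lerD => //.
    rewrite /pole -{2}[grid n k]mul1r -mulrBl cabsM cabs_zeta mulr1 /rho rmorphD rmorph1 /=.
    by rewrite addrAC subrr add0r cabsR gtr0_norm.
  lra.
have t3 : (rho ^+ 2 - cabs z ^+ 2) / D ^+ 2 <= 6 * 833 ^+ 2 * kern n r l k.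
  rewrite /kern mulrA ler_pdivrMr ?exprn_gt0 // mulrAC ler_pdivlMr; last first.
    by rewrite exprn_gt0 // ltr_pwDl // cabs_ge0.
  apply: (@le_trans _ _ (6 * r * (833 * D) ^+ 2)).
    have rc : 0 <= r + cabs (grid n l - grid n k) by rewrite addr_ge0 ?cabs_ge0 // ltW.
    have t0 : 0 <= rho ^+ 2 - cabs z ^+ 2.
      by rewrite subr_ge0; apply: lerXn2r; rewrite ?nnegrE ?cabs_ge0 // /rho; lra.
    have D1633 : 0 <= 833 * D by exact: mulr_ge0 (ler0n _ _) (ltW Dp).
    exact: ler_pM t0 (exprn_ge0 2 rc) t1 (lerXn2r 2 rc D1633 t2).
  by rewrite le_eqVlt; apply/orP; left; apply/eqP; ring.
have -> : grid_const * (h * kern n r l k * b k) =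
  145 * h * (b k * (6 * 833 ^+ 2 * kern n r l k)) by rewrite /grid_const; ring.
apply: ler_wpM2l; first by rewrite mulr_ge0 // ltW.
by apply: ler_wpM2l; [exact: ltW|].
Qed.

End grid_majorant.

(** * The product estimate *)

Section whitney_measure.
Context {R : realType}.
Implicit Types (z : R[i]) (s q : R) (j k : nat).
Notation mu := (@lebesgue_measure R).
Notation mu2 := ((@lebesgue_measure R) \x (@lebesgue_measure R))%E.

Lemma copen_cabs_lt (c : R) : copen [set z : R[i] | cabs z < c].
Proof.
move=> z /= zc; exists (c - cabs z); first by rewrite subr_gt0.
by move=> w; have := cabs_sub w z; lra.
Qed.

Lemma measurable_cabs_lt (c : R) : measurable (@toC R @^-1` [set z : R[i] | cabs z < c]).
Proof. exact: measurable_toC (@copen_cabs_lt c). Qed.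

Lemma measurable_half_plane (x : R) :
  measurable (@toC R @^-1` [set z : R[i] | complex.Im (z / zeta x) < 0]).
Proof.
apply: measurable_toC => z /= z0; exists (- complex.Im (z / zeta x)); first by rewrite oppr_gt0.
move=> w hw; have := ler_Im ((w - z) / zeta x).
rewrite cabsM cabsV cabs_zeta invr1 mulr1 mulrBl ImB => h1.
by have := ler_norm (complex.Im (w / zeta x) - complex.Im (z / zeta x)); lra.
Qed.

Lemma measurable_whit j k : measurable (@toC R @^-1` whit j k).
Proof.
case: j => [|[|j]].
- have -> : @toC R @^-1` whit 0 k = @toC R @^-1` [set z : R[i] | cabs z < 1 - 8^-1].
    by apply/seteqP; split=> p /= => [[_]|h]; [lra|split; lra].
  exact: measurable_cabs_lt.
- by have -> : @toC R @^-1` whit 1 k = set0 by apply/seteqP; split=> p.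
have -> : @toC R @^-1` whit j.+2 k =
  ((@toC R @^-1` [set z : R[i] | cabs z < 1 - 2 ^- j.+4] `\`
    @toC R @^-1` [set z : R[i] | cabs z < 1 - 2 ^- j.+3]) `&`
  (@toC R @^-1` [set z : R[i] | complex.Im (z / zeta (2 ^- j.+2 * k.+1%:R)) < 0] `\`
    @toC R @^-1` [set z : R[i] | complex.Im (z / zeta (2 ^- j.+2 * k%:R)) < 0])).
  apply/seteqP; split=> p /=.
    move=> [/andP[h1 h2] [h3 h4]]; split; split=> //; [lra|apply/negP; rewrite -leNgt; lra|].
    by apply/negP; rewrite -leNgt.
  move=> [[h1 /negP h2] [h3 /negP h4]]; rewrite -!leNgt in h2 h4.
  by split; [apply/andP; split; lra|split].
apply: measurableI; apply: measurableD; do ?exact: measurable_cabs_lt; exact: measurable_half_plane.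
Qed.

Definition density (X : normedModType R[i]) s q (f : R[i] -> X) z : R :=
  ((1 - cabs z) `^ (- s) * rnorm (f z)) `^ q * (1 - cabs z)^-1.

Lemma density_ge0 (X : normedModType R[i]) s q (f : R[i] -> X) z :
  cabs z < 1 -> 0 <= density s q f z.
Proof. by move=> z1; rewrite mulr_ge0 ?powR_ge0 // invr_ge0 subr_ge0 ltW. Qed.

Lemma measurable_density (X : normedModType R[i]) s q (f : R[i] -> X) : q != 0 ->
  (forall z, cabs z < 1 -> cdiff f z) ->
  measurable_fun setT (fun p : R * R => (density s q f \_ (@disc R)) (toC p)).
Proof.
move=> q0 df.
have m1 : measurable_fun setT (fun p : R * R => ((fun z => rnorm (f z)) \_ (@disc R)) (toC p)).
  apply: measurable_cont; first exact: copen_cabs_lt.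
  by move=> z z1 e e0; exact: cabs_continuous (df z z1) e e0.
have m2 : measurable_fun setT (fun p : R * R => 1 - cabs (toC p)).
  apply: measurable_funB => //.
  have -> : (fun p : R * R => cabs (toC p)) = fun p => ((@cabs R) \_ setT) (toC p).
    by apply/funext => p; rewrite patchE mem_set.
  apply: measurable_cont; first by move=> z _; exists 1.
  move=> z _ e e0; exists e => // w hw; apply: le_lt_trans hw.
  by rewrite ler_norml cabs_sub andbT lerNl opprB cabsB cabs_sub.
have -> : (fun p : R * R => (density s q f \_ (@disc R)) (toC p)) =
  (fun p => ((1 - cabs (toC p)) `^ (- s) * ((fun z => rnorm (f z)) \_ (@disc R)) (toC p)) `^ q
            * (1 - cabs (toC p)) `^ (-1)).
  apply/funext => p; rewrite !patchE; case: ifPn => [|_].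
    by move=> /set_mem /= p1; rewrite /density powR_inv1 // subr_ge0 ltW.
  by rewrite mulr0 powR0 // mul0r.
apply: measurable_funM; last exact: measurableT_comp (measurable_powR (-1)) m2.
apply: measurableT_comp (measurable_powR q) _; apply: measurable_funM m1.
exact: measurableT_comp (measurable_powR (- s)) m2.
Qed.

Lemma area_int_disc (A : set R[i]) (u : R[i] -> R) : A `<=` @disc R ->
  area_int A u = (\int[mu2]_(p in @toC R @^-1` A) ((u \_ (@disc R)) (toC p))%:E)%E.
Proof.
move=> AD; apply: eq_integral => p /set_mem /= Ap.
by rewrite patchE mem_set //; exact: AD.
Qed.

Lemma whit_disc j k : whit j k `<=` @disc R.
Proof. by move=> z /whit_lt1. Qed.

Lemma measurable_funE_density (X : normedModType R[i]) s q (f : R[i] -> X) (A : set (R * R)) : q != 0 ->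
  (forall z, cabs z < 1 -> cdiff f z) ->
  measurable_fun A (fun p : R * R => ((density s q f \_ (@disc R)) (toC p))%:E).
Proof.
by move=> q0 df; apply: measurable_funTS; apply/measurable_EFinP; exact: measurable_density.
Qed.

Lemma patch_density_ge0 (X : normedModType R[i]) s q (f : R[i] -> X) z :
  0 <= (density s q f \_ (@disc R)) z.
Proof. by rewrite patchE; case: ifPn => // /set_mem; exact: density_ge0. Qed.

Lemma mu2_square (a b e : R) : 0 < e ->
  mu2 (`[(a - e), (a + e)]%classic `*` `[(b - e), (b + e)]%classic) = ((2 * e) ^+ 2)%:E.
Proof.
move=> e0; rewrite product_measure1E; [|exact: measurable_itv|exact: measurable_itv].
have itvE c : mu `[(c - e), (c + e)]%classic = (2 * e)%:E.
  by rewrite lebesgue_measure_itv /= lte_fin ifT; [rewrite -EFinD; congr (_%:E); ring|lra].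
by apply: etrans (congr2 mule (itvE a) (itvE b)) _; rewrite -EFinM.
Qed.

Lemma whit_le1 j k z : (j <= 1)%N -> whit j k z -> j = 0%N.
Proof. by case: j => [|[|j]]. Qed.

(** [17 = 1 + 16] in units of [2^-j]: the depth, and the Lipschitz constant of [zeta] times the
    width of the cell. *)
Lemma whit_area_int j k (u : R[i] -> R) (B : R) : (k < 2 ^ j)%N -> 0 <= B ->
  (forall z, whit j k z -> 0 <= u z <= B) ->
  (area_int (whit j k) u <= (B * (2 * (17 * 2 ^- j)) ^+ 2)%:E)%E.
Proof.
move=> kj B0 hu; pose zt : R[i] := zeta (2 ^- j * k%:R); set e := 17 * 2 ^- j.
have P0 : 0 < 2 ^- j :> R by rewrite invr_gt0 exprn_gt0.
have e0 : 0 < e by rewrite mulr_gt0.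
pose W : set (R * R) := `[(complex.Re zt - e), (complex.Re zt + e)]%classic `*`
                        `[(complex.Im zt - e), (complex.Im zt + e)]%classic.
have mW : measurable W by apply: measurableX; exact: measurable_itv.
rewrite EFinM -(mu2_square (complex.Re zt) (complex.Im zt) e0) -/W.
rewrite -(@integral_cst _ _ _ mu2 W mW).
apply: le_integral_ge0 => [p /hu/andP[]//|p _ //|p /[dup] wp /hu/andP[u0 uB] _].
split; last by rewrite lee_fin.
have cp1 := whit_lt1 wp.
have d1 : cabs (toC p - zt) <= e.
  case: (ltnP 1 j) => j1; last first.
    have j0 := whit_le1 j1 wp.
    apply: le_trans (cabsD _ _) _; rewrite cabsN /zt cabs_zeta /e j0 expr0 invr1; lra.
  have [lev [al [_ /andP[a1 a2] ez]]] := whit_polar j1 kj wp.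
  rewrite -(subrKA (zeta al)); apply: le_trans (cabsD _ _) _.
  have -> : cabs (toC p - zeta al) = 1 - cabs (toC p).
    rewrite {1}ez -{2}[zeta al]mul1r -mulrBl cabsM cabs_zeta mulr1 cabsB.
    rewrite -(rmorph1 (@real_complex R)) -rmorphB cabsR ger0_norm //.
    by rewrite subr_ge0 ltW // (whit_lt1 wp).
  have n1 : `|al - 2 ^- j * k%:R| <= 2 ^- j by rewrite ler_norml; apply/andP; split; lra.
  have := zeta_lip al (2 ^- j * k%:R); rewrite -/zt.
  by move/andP: lev => [_]; rewrite exprS invfM /e; lra.
have h1 := le_trans (ler_Re _) d1; have h2 := le_trans (ler_Im _) d1.
move: h1 h2; rewrite ReB ImB /= !ler_norml => /andP[p1 p2] /andP[p3 p4].
by split; rewrite /= in_itv /=; apply/andP; split; lra.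
Qed.

(** As in [stolz_whit], the vertex of a Stolz angle through [z] is displaced by at most one cell;
    the box therefore keeps one cell away from both ends of the arc. *)
Lemma whit_tent j0 i0 j k z : (1 < j)%N -> (j0 <= j)%N -> (k < 2 ^ j)%N ->
  (i0 * 2 ^ (j - j0) < k)%N -> (k.+1 < i0.+1 * 2 ^ (j - j0))%N ->
  whit j k z -> tent (dyadic_arc j0 i0) z.
Proof.
move=> j1 j0j kj k1 k2 wz; have [lev [al [_ /andP[a1 a2] ez]]] := whit_polar j1 kj wz.
have z1 := whit_lt1 wz; apply: tent_intro => // x hx.
have P0 : 0 < 2 ^- j :> R by rewrite invr_gt0 exprn_gt0.
have [|y [_ y2 ey]] := @near_zeta R (zeta x) al (4 * (1 - cabs z)) (cabs_zeta x).
  rewrite -(subrKA z); apply: le_trans (cabsD _ _) _; rewrite (cabsB _ z).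
  have -> : cabs (z - zeta al) = 1 - cabs z.
    rewrite {1}ez -{2}[zeta al]mul1r -mulrBl cabsM cabs_zeta mulr1 cabsB.
    rewrite -(rmorph1 (@real_complex R)) -rmorphB cabsR ger0_norm //.
    by rewrite subr_ge0 ltW.
  lra.
have yj : `|y| <= 2 ^- j by move/andP: lev => [_]; rewrite exprS invfM; lra.
rewrite ler_norml in yj; move/andP: yj => [yj1 yj2].
have scale (i : nat) : 2 ^- j0 * i%:R = 2 ^- j * (i * 2 ^ (j - j0))%:R :> R.
  have ej : (2 : R) ^+ j = 2 ^+ j0 * 2 ^+ (j - j0) by rewrite -exprD subnKC.
  have A0 : (2 : R) ^+ j0 != 0 by rewrite expf_neq0.
  have B0 : (2 : R) ^+ (j - j0) != 0 by rewrite expf_neq0.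
  rewrite natrM natrX ej; move: (2 ^+ j0) (2 ^+ (j - j0)) A0 B0 => A B A0 B0.
  by field; rewrite A0 B0.
have SE (m : nat) : 2 ^- j * m.+1%:R = 2 ^- j * m%:R + 2 ^- j :> R.
  by rewrite -(natr1 m) mulrDr mulr1.
have l1 : 2 ^- j * (i0 * 2 ^ (j - j0)).+1%:R <= 2 ^- j * k%:R :> R by rewrite ler_pM2l // ler_nat.
have l2 : 2 ^- j * k.+2%:R <= 2 ^- j * (i0.+1 * 2 ^ (j - j0))%:R :> R.
  by rewrite ler_pM2l // ler_nat.
rewrite ey; apply: dyadic_arc_intro; rewrite !scale.
by move: l1 l2; rewrite !SE => l1 l2; apply/andP; split; lra.
Qed.

End whitney_measure.

Lemma dyadic_geometric {R : realType} j0 n : (j0 <= n)%N ->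
  \sum_(j0 <= j < n) 2 ^- j <= 2 * 2 ^- j0 :> R.
Proof.
move=> jn; have e j : (2 : R) ^- j = (- (2 * 2 ^- j.+1)) - (- (2 * 2 ^- j)).
  have P : (2 : R) ^+ j != 0 by rewrite expf_neq0.
  by rewrite exprS; field.
rewrite (eq_bigr (fun j => (- (2 * 2 ^- j.+1)) - (- (2 * 2 ^- j)))); last by move=> j _; exact: e.
rewrite telescope_sumr // opprK addrC lerBlDr lerDl mulr_ge0 //.
Qed.

(** * Carleson condition for the Whitney boxes *)

Section box_masses.
Context {R : realType}.
Variables (s q kap M B : R) (h : R[i] -> CC R).
Hypothesis q1 : 1 <= q.
Hypothesis kap0 : 0 <= kap.
Hypothesis M0 : 0 <= M.
Hypothesis B1 : 1 <= B.
Hypothesis BM : 4 * (34 ^+ 2) * M <= B.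
Hypothesis dh : forall z, cabs z < 1 -> cdiff h z.
Hypothesis tents : forall j k, (k < 2 ^ j)%N ->
  (area_int (tent (dyadic_arc j k)) (tent_density s q h) <= (kap * 2 ^- j)%:E)%E.
Hypothesis bloch : forall z, cabs z < 1 -> wq s q h z <= M * kap.
Notation mu2 := ((@lebesgue_measure R) \x (@lebesgue_measure R))%E.

Let B0 : 0 <= B. Proof. exact: le_trans ler01 B1. Qed.
Let q0 : q != 0. Proof. by rewrite gt_eqF // (lt_le_trans ltr01). Qed.

Lemma tent_density_density z : tent_density s q h z = density s q h z.
Proof. by rewrite /density rnorm_cabs. Qed.

(** Generation 0 lies in the tent over the whole circle. In the others the density is at most
    [M kap 4 2^j] on a square of side [34 * 2^-j], whence the hypothesis [BM]. *)
Lemma box_mass_le j k : (k < 2 ^ j)%N ->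
  (area_int (whit j k) (tent_density s q h) <= (B * kap * 2 ^- j)%:E)%E.
Proof.
move=> kj; case: j kj => [|[|j]] kj.
- have k0 : k = 0%N by case: k kj.
  apply: (@le_trans _ _ (area_int (tent (dyadic_arc 0 0)) (tent_density s q h))).
    apply: le_integral_ge0 => [p /whit_lt1 p1|p [p1 _]|p /whit_lt1 p1 _].
    - by rewrite lee_fin tent_density_ge0.
    - by rewrite lee_fin tent_density_ge0.
    - by split=> //; exact: tent_whole.
  apply: le_trans (tents _) _ => //; rewrite lee_fin expr0 invr1 !mulr1 ler_peMl //.
- rewrite /area_int (_ : _ @^-1` _ = set0) ?integral_set0 ?lee_fin; last by apply/seteqP; split.
  by apply: mulr_ge0; [apply: mulr_ge0 B0 kap0|rewrite invr_ge0 exprn_ge0].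
have P0 : 0 < (2 : R) ^+ j.+2 by rewrite exprn_gt0.
have C0 : 0 <= M * kap * (4 * 2 ^+ j.+2) by exact: mulr_ge0 (mulr_ge0 M0 kap0) (mulr_ge0 (ler0n _ _) (ltW P0)).
apply: (le_trans (@whit_area_int R j.+2 k _ _ kj C0 _)) => [z wz|].
  have z1 := whit_lt1 wz; rewrite tent_density_ge0 //=.
  rewrite /tent_density -/(wq s q h z); have d0 : 0 < 1 - cabs z by rewrite subr_gt0.
  apply: ler_pM; rewrite ?powR_ge0 ?invr_ge0 ?(ltW d0) //; first exact: bloch.
  have p4 : 0 < 4 * 2 ^+ j.+2 :> R by apply: mulr_gt0 P0.
  move: wz => [/andP[d1 _] _]; rewrite -[leRHS]invrK lef_pV2 ?posrE ?invr_gt0 //.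
  by rewrite -(_ : 2 ^+ j.+4 = 4 * 2 ^+ j.+2 :> R); [exact: ltW|rewrite !exprS; ring].
rewrite lee_fin; apply: (@le_trans _ _ (4 * 34 ^+ 2 * M * (kap * 2 ^- j.+2))).
  by rewrite le_eqVlt; apply/orP; left; apply/eqP; field; rewrite expf_neq0.
by rewrite -[leRHS]mulrA; apply: ler_wpM2r BM; rewrite mulr_ge0 // invr_ge0 ltW.
Qed.

Definition box_mass j k : R := fine (area_int (whit j k) (tent_density s q h)).

Lemma box_mass_ge0 j k : 0 <= box_mass j k.
Proof.
by apply: fine_ge0; apply: integral_ge0 => p /whit_lt1 p1; rewrite lee_fin tent_density_ge0.
Qed.

Lemma box_massE j k : (k < 2 ^ j)%N ->
  area_int (whit j k) (tent_density s q h) = (box_mass j k)%:E.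
Proof.
move=> kj; rewrite fineK // ge0_fin_numE; first exact: le_lt_trans (box_mass_le kj) (ltry _).
by apply: integral_ge0 => p /whit_lt1 p1; rewrite lee_fin tent_density_ge0.
Qed.

Lemma box_mass_bound j k : (k < 2 ^ j)%N -> box_mass j k <= B * kap * 2 ^- j.
Proof. by move=> kj; rewrite -lee_fin -box_massE //; exact: box_mass_le. Qed.

(** Two cells from the ends of the arc, so that all three neighbours of the box lie in the tent. *)
Let inner j0 i0 j k :=
  [&& (1 < j)%N, (i0 * 2 ^ (j - j0) + 1 < k)%N & (k + 2 < i0.+1 * 2 ^ (j - j0))%N].

(** For fixed [e] the shifted boxes are pairwise disjoint and all lie in one tent. *)
Let inner_sum e j0 i0 n : (e < 3)%N -> (j0 <= n)%N -> (i0 < 2 ^ j0)%N ->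
  \sum_(j0 <= j < n) \sum_(0 <= k < 2 ^ j | inner j0 i0 j k) box_mass j (k + e - 1) <= kap * 2 ^- j0.
Proof.
move=> e3 j0n i0j.
pose S := [seq (j, k) | j <- index_iota j0 n, k <- index_iota 0 (2 ^ j)].
pose S' := [seq x <- S | inner j0 i0 x.1 x.2].
pose F (x : nat * nat) : set (R * R) := @toC R @^-1` whit x.1 (x.2 + e - 1).
have uS : uniq S' by apply: filter_uniq; apply: allpairs_uniq_dep => //; [exact: iota_uniq|move=> ? _; exact: iota_uniq|move=> [? ?] [? ?] _ _ /= [-> ->]].
have SP x : x \in S' -> [/\ (1 < x.1)%N, (j0 <= x.1)%N, (x.2 + e - 1 < 2 ^ x.1)%N,
    (i0 * 2 ^ (x.1 - j0) < x.2 + e - 1)%N & ((x.2 + e - 1).+1 < i0.+1 * 2 ^ (x.1 - j0))%N].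
  rewrite mem_filter => /andP[/and3P[h1 h2 h3] /allpairsPdep[j [k [hj hk ex]]]].
  move: h1 h2 h3; rewrite ex /= => h1 h2 h3.
  move: hj; rewrite mem_index_iota => /andP[hj _].
  have up : (i0.+1 * 2 ^ (j - j0) <= 2 ^ j)%N.
    by rewrite -{2}(subnKC hj) expnD leq_mul2r i0j orbT.
  split=> //.
  - by apply: leq_trans up; clear -h3 e3; lia.
  - by clear -h2; lia.
  - by clear -h3 e3 h2; lia.
have tF : trivIset [set` S'] F.
  move=> x y /= /SP[x1 _ x2 x3 _] /SP[y1 _ y2 y3 _] [p [px py]].
  have [e1 e2] := whit_inj x1 y1 x2 y2 px py.
  case: x y e1 e2 x3 y3 {x1 x2 y1 y2 px py} => [j k] [j' k'] /= -> e2 x3 y3; congr pair.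
  by clear -e2 x3 y3; lia.
have -> : \sum_(j0 <= j < n) \sum_(0 <= k < 2 ^ j | inner j0 i0 j k) box_mass j (k + e - 1) =
    \sum_(x <- S') box_mass x.1 (x.2 + e - 1).
  by rewrite big_filter [RHS]big_mkcond /S big_allpairs_dep; apply: eq_bigr => j _; rewrite [LHS]big_mkcond.
rewrite -lee_fin -sumEFin.
have -> : (\sum_(x <- S') (box_mass x.1 (x.2 + e - 1))%:E =
    \sum_(x <- S') \int[mu2]_(p in F x) ((density s q h \_ (@disc R)) (toC p))%:E)%E.
  rewrite big_seq [RHS]big_seq; apply: eq_bigr => x /SP[_ _ x2 _ _].
  rewrite -box_massE // area_int_disc; last exact: whit_disc.
  by apply: eq_integral => p _; rewrite !patchE tent_density_density.
have mF x : measurable (F x) by exact: measurable_whit.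
have mf : measurable_fun (\big[setU/set0]_(x <- S') F x)
   (fun p : R * R => ((density s q h \_ (@disc R)) (toC p))%:E).
  exact: measurable_funE_density.
rewrite -(ge0_integral_bigsetU mu2 mF uS tF mf); last first.
  by move=> p _; rewrite lee_fin patch_density_ge0.
apply: le_trans (tents i0j); apply: le_integral_ge0 => [p _|p [p1 _]|p].
- by rewrite lee_fin patch_density_ge0.
- by rewrite lee_fin tent_density_ge0.
rewrite -bigcup_seq => -[x /= /SP[x1 xj x2 x3 x4] px] _.
split; first exact: (whit_tent x1 xj x2 x3 x4 px).
by rewrite lee_fin patchE mem_set ?tent_density_density //; exact: whit_lt1 px.
Qed.

(** Two cells at either end of the arc fail to be [inner]; for [j <= 1] the arc has at most two
    cells in all. *)
Let outer_sum j0 i0 j : (j0 <= j)%N ->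
  \sum_(k < 2 ^ j | (k %/ 2 ^ (j - j0) == i0)%N && ~~ inner j0 i0 j k) B * kap * 2 ^- j <=
  4 * (B * kap) * 2 ^- j.
Proof.
move=> j0j; set P := [pred k : 'I_(2 ^ j) | (k %/ 2 ^ (j - j0) == i0)%N && ~~ inner j0 i0 j k].
rewrite (eq_bigl P) // sumr_const -[_ *+ _]mulr_natl.
have -> : 4 * (B * kap) * 2 ^- j = 4 * (B * kap * 2 ^- j) by ring.
have c0 : 0 <= B * kap * 2 ^- j by rewrite mulr_ge0 ?mulr_ge0 // invr_ge0 exprn_ge0.
apply: (ler_wpM2r c0); rewrite ler_nat.
pose L := (2 ^ (j - j0))%N; have L0 : (0 < L)%N by rewrite expn_gt0.
have -> : 4%N = size [:: (i0 * L)%N; (i0 * L + 1)%N; (i0.+1 * L - 2)%N; (i0.+1 * L - 1)%N] by [].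
rewrite cardE -(size_map val); apply: uniq_leq_size; first by rewrite map_inj_uniq ?enum_uniq //; exact: val_inj.
move=> x /mapP[k]; rewrite mem_enum inE => /andP[/eqP hk hI] ->.
have k1 : (i0 * L <= k)%N by rewrite -hk leq_divM.
have k2 : (k < i0.+1 * L)%N by rewrite -hk -ltn_divLR.
have kE : val k = nat_of_ord k by []; rewrite kE.
rewrite !inE; move: hI; rewrite /inner !negb_and -!leqNgt -/L; case/or3P => h1.
- have L2 : (L <= 2)%N.
    rewrite -[2%N]/(2 ^ 1)%N leq_exp2l //; by apply: leq_trans (leq_subr _ _) h1.
  move: k2; rewrite mulSn; clear -L2 k1; move: (i0 * L)%N (nat_of_ord k) k1 => a b k1 k2.
  by lia.
- clear -h1 k1; move: (i0 * L)%N (i0.+1 * L)%N (nat_of_ord k) k1 h1 => a c b k1 h1.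
  by lia.
- clear -h1 k2; move: (i0 * L)%N (i0.+1 * L)%N (nat_of_ord k) k2 h1 => a c b k2 h1.
  by lia.
Qed.

(** The tent accounts for the inner boxes, and [box_mass_bound] for the four others of each
    generation, which add up geometrically to [8 B]. The factor 8 anticipates
    [1 / (1 - |z|) <= 8 * 2^j] on boxes of generation [j]. *)
Lemma carleson_boxes n :
  carleson n (24 * (8 * B + 1) * kap) (fun j k => 8 * \sum_(e < 3) box_mass j (nb j k e)).
Proof.
move=> j0 i0 j0n.
have P0 : 0 <= kap * 2 ^- j0 by rewrite mulr_ge0 // invr_ge0 exprn_ge0.
have key (e : 'I_3) : \sum_(j0 <= j < n) \sum_(k < 2 ^ j | (k %/ 2 ^ (j - j0))%N == i0) box_mass j (nb j k e)
    <= (8 * B + 1) * (kap * 2 ^- j0).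
  case: (leqP (2 ^ j0) i0) => i0j.
    rewrite big_nat_cond big1 ?mulr_ge0 ?addr_ge0 ?mulr_ge0 // => j; rewrite andbT => /andP[hj _].
    rewrite big1 // => k /eqP hk; exfalso; move: i0j; rewrite leqNgt -hk => /negP; apply.
    by rewrite ltn_divLR ?expn_gt0 // -expnD subnKC.
  apply: (@le_trans _ _ (\sum_(j0 <= j < n) (\sum_(0 <= k < 2 ^ j | inner j0 i0 j k) box_mass j (k + e - 1)
     + 4 * (B * kap) * 2 ^- j))).
    rewrite big_nat_cond [leRHS]big_nat_cond; apply: ler_sum => j; rewrite andbT => /andP[hj _].
    rewrite (bigID (fun k : 'I_(2 ^ j) => inner j0 i0 j k)) /=; apply: lerD.
      rewrite big_mkord; apply: (@le_trans _ _ (\sum_(k < 2 ^ j | (k %/ 2 ^ (j - j0) == i0)%N && inner j0 i0 j k)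
         box_mass j (k + e - 1))).
        apply: ler_sum => k /andP[_ /and3P[j1 h1 h2]]; rewrite /nb.
        have -> : (k + 2 ^ j + e - 1 = (k + e - 1) + 2 ^ j)%N by clear -h1; lia.
        rewrite modnDr modn_small //.
        have up : (i0.+1 * 2 ^ (j - j0) <= 2 ^ j)%N.
          by rewrite -{2}(subnKC hj) expnD leq_mul2r i0j orbT.
        by apply: leq_trans up; have := ltn_ord e; clear -h2; lia.
      rewrite big_mkcond [leRHS]big_mkcond; apply: ler_sum => k _.
      by case: (inner _ _ _ _); rewrite ?andbT ?andbF //; case: ifP => // _; exact: box_mass_ge0.
    apply: le_trans (outer_sum i0 hj); apply: ler_sum => k _.
    by apply: box_mass_bound; exact: nb_lt.
  have -> : (8 * B + 1) * (kap * 2 ^- j0) = kap * 2 ^- j0 + 8 * B * (kap * 2 ^- j0) by ring.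
  rewrite big_split /= -mulr_sumr; apply: lerD; first exact: inner_sum.
  apply: le_trans (ler_wpM2l _ (dyadic_geometric j0n)) _; first by rewrite mulr_ge0 // mulr_ge0.
  by rewrite le_eqVlt; apply/orP; left; apply/eqP; ring.
apply: (@le_trans _ _ (8 * \sum_(e < 3) (8 * B + 1) * (kap * 2 ^- j0))).
  apply: (@le_trans _ _ (8 * \sum_(e < 3) \sum_(j0 <= j < n)
     \sum_(k < 2 ^ j | (k %/ 2 ^ (j - j0))%N == i0) box_mass j (nb j k e))).
    rewrite le_eqVlt; apply/orP; left; apply/eqP.
    rewrite exchange_big mulr_sumr; apply: eq_bigr => j _.
    by rewrite exchange_big mulr_sumr.
  by apply: ler_wpM2l => //; apply: ler_sum => e _; exact: key.
rewrite sumr_const card_ord -[_ *+ 3]mulr_natl.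
by rewrite le_eqVlt; apply/orP; left; apply/eqP; ring.
Qed.

End box_masses.

Section box_majorant.
Context {R : realType} {X : normedModType R[i]}.
Variables (n0 n m : nat) (g : R[i] -> X) (b : nat -> R).
Notation h := ((2 : R) ^- n).
Notation rad := (1 - (2 : R) ^- n0.+4).
Hypothesis n0n : (n0 <= n)%N.
Hypothesis dg : forall z, cabs z < 1 -> cdiff g z.
Hypothesis b0 : forall k, 0 < b k.
Hypothesis gb : forall k x, (k < 2 ^ n)%N -> h * k%:R <= x < h * k.+1%:R ->
  rnorm (g (rad%:C * zeta x)) <= b k ^+ m.+1.

Lemma nb_zeta j k e (al : R) : (e < 3)%N ->
  2 ^- j * (nb j k e)%:R <= al < 2 ^- j * (nb j k e)%:R + 2 ^- j ->
  cabs (zeta al - zeta (2 ^- j * k%:R)) <= 32 * 2 ^- j.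
Proof.
move=> e3 /andP[a1 a2]; have P0 : 0 < (2 : R) ^- j by rewrite invr_gt0 exprn_gt0.
have PX : 2 ^- j * (2 ^ j)%:R = 1 :> R by rewrite natrX mulVf // expf_neq0.
(* The number of full turns removed by the reduction modulo [2^j] in [nb]. *)
pose c := ((k + 2 ^ j + e - 1) %/ 2 ^ j)%N.
have ek : (k + 2 ^ j + e = c * 2 ^ j + nb j k e + 1)%N.
  rewrite /nb /c -divn_eq; have : (0 < 2 ^ j)%N by rewrite expn_gt0.
  by move: (2 ^ j)%N => u; lia.
have ek' : 2 ^- j * k%:R + 1 + 2 ^- j * e%:R = c%:R + 2 ^- j * (nb j k e)%:R + 2 ^- j :> R.
  have : 2 ^- j * (k + 2 ^ j + e)%:R = 2 ^- j * (c * 2 ^ j + nb j k e + 1)%:R :> R by rewrite ek.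
  by rewrite !natrD natrM !mulrDr mulr1 PX [_ * (c%:R * _)]mulrCA PX mulr1.
have -> : zeta (2 ^- j * k%:R) = zeta (2 ^- j * k%:R + 1 - c%:R) :> R[i].
  by rewrite (zetaD _ (- c%:R)) zetaD zeta1 mulr1 zetaN zeta_nat invr1 mulr1.
apply: le_trans (zeta_lip _ _) _.
have e2 : 2 ^- j * e%:R <= 2 ^- j * 2 :> R by rewrite ler_pM2l // ler_nat.
have e1 : 0 <= 2 ^- j * e%:R :> R by rewrite mulr_ge0 // ltW.
have : `|al - (2 ^- j * k%:R + 1 - c%:R)| <= 2 * 2 ^- j.
  by rewrite ler_norml; apply/andP; split; lra.
lra.
Qed.

Let rad1 : rad < 1. Proof. by rewrite ltrBlDr ltrDl invr_gt0 exprn_gt0. Qed.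

(** The box has depth at least [2^-j / 8], while [2^(- n0 - 4) <= 2^-j / 32]; so [u = z / rad] is
    still at depth at least [2^-j / 16], as [grid_majorant] requires. *)
Lemma box_majorant j k e z : (j < n0)%N -> (k < 2 ^ j)%N -> (e < 3)%N -> whit j (nb j k e) z ->
  rnorm (g z) <= (grid_const * \sum_(i < 2 ^ n) h * kern n (2 ^- j) (k * 2 ^ (n - j))%N i * b i) ^+ m.+1.
Proof.
move=> jn kj e3 wz; have z1 := whit_lt1 wz.
have jn' : (j <= n)%N by rewrite (leq_trans (ltnW jn)).
have P0 i : 0 < (2 : R) ^- i by rewrite invr_gt0 exprn_gt0.
have mono i i' : (i <= i')%N -> (2 : R) ^- i' <= 2 ^- i.
  by move=> ii; rewrite lef_pV2 ?posrE ?exprn_gt0 // ler_eXn2l // ltr1n.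
have ES i : (2 : R) ^- i.+1 = 2 ^- i / 2 by rewrite exprS invfM mulrC.
have E4 : (2 : R) ^- n0.+4 <= 2 ^- j / 32.
  by have := mono _ _ jn; rewrite !ES; lra.
have j1 : (2 : R) ^- j <= 1 by rewrite invf_le1 ?exprn_gt0 // exprn_ege1 // ler1n.
have r0 : 0 < rad by lra.
pose u := (rad^-1)%:C * z; have cu : cabs u = cabs z / rad.
  by rewrite /u cabsM cabsR ger0_norm ?invr_ge0 ?(ltW r0) // mulrC.
have gu : g z = g (rad%:C * u).
  by rewrite /u mulrA -rmorphM mulfV ?gt_eqF // rmorph1 mul1r.
have c0 := cabs_ge0 z.
have cz : cabs z <= cabs z / rad by rewrite ler_pdivlMr // ler_piMr // ltW.
have dz : (2 : R) ^- j / 8 <= 1 - cabs z.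
  case: j {kj jn jn' E4 j1} wz => [|[|j]] //=; first by rewrite expr0 invr1; lra.
  by move=> [/andP[l1 _] _]; move: l1; rewrite !ES; have := P0 j; lra.
have dz' : 1 - cabs z <= (2 : R) ^- j.
  case: j {kj jn jn' E4 j1 dz} wz => [|[|j]] //=; first by rewrite expr0 invr1; lra.
  by move=> [/andP[_ l1] _]; move: l1; rewrite (ES j.+2); have := P0 j.+2; lra.
have lz : cabs z / rad <= 1 - 16^-1 * 2 ^- j.
  rewrite ler_pdivrMr //.
  have rx : 0 <= (2 : R) ^- j * 2 ^- n0.+4 by rewrite mulr_ge0 // ltW.
  move: (2 ^- j) (2 ^- n0.+4) E4 j1 dz dz' rx => r x E4 j1 dz dz' rx.
  by rewrite mulrBr mulr1 mulrBl mul1r -mulrA; lra.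
have P := P0 j.
rewrite gu; apply: (@grid_majorant R X n m (fun w => g (rad%:C * w)) b _ b0 gb (2 ^- j) _ u).
- move=> w w1; apply: (@cdiff_comp _ _ g (fun w => rad%:C * w)).
    by apply: cdiffM; [exact: cdiff_cst|exact: cdiff_id].
  apply: dg; rewrite cabsM cabsR gtr0_norm //; apply: le_lt_trans rad1.
  by rewrite ler_piMr // ltW.
- exact: mono.
- by rewrite cu; lra.
- by rewrite cu; apply/andP; split; lra.
- have gE : grid n (k * 2 ^ (n - j))%N = zeta (2 ^- j * k%:R) :> R[i].
    rewrite /grid natrM natrX; congr zeta.
    have -> : (2 : R) ^- n = 2 ^- j / 2 ^+ (n - j).
      by rewrite -[in LHS](subnKC jn') exprD invfM.
    by field; rewrite !expf_neq0.
  rewrite gE; case: (ltnP 1 j) => j2; last first.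
    have -> : j = 0%N by case: j j2 wz {kj jn jn' E4 j1 dz dz' lz P gE} => [|[|j]].
    by rewrite expr0 invr1 mulr1; apply: le_trans (cabsD _ _) _; rewrite cabsN cabs_zeta cu; lra.
  have [lev [al [_ hal ez]]] := whit_polar j2 (nb_lt j k e) wz.
  rewrite -(subrKA (zeta al)); apply: le_trans (cabsD _ _) _.
  have -> : cabs (u - zeta al) = 1 - cabs z / rad.
    have -> : u - zeta al = ((cabs z / rad)%:C - 1) * zeta al.
      by rewrite /u {1}ez mulrBl mul1r mulrA -rmorphM [_ / rad]mulrC.
    rewrite cabsM cabs_zeta mulr1 cabsB -(rmorph1 (@real_complex R)) -rmorphB cabsR ger0_norm //.
    lra.
  by have := nb_zeta e3 hal; lra.
Qed.

End box_majorant.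

(** * The maximal estimate on the grid *)

Section grid_stage.
Context {R : realType}.
Variables (n0 n m : nat) (p q A : R) (a : nat -> nat -> R) (b : nat -> R).
Notation h := ((2 : R) ^- n).
Notation t := (p / q).
Notation al := (m.+1%:R * p / 2).
Hypothesis n0n : (n0 <= n)%N.
Hypothesis p0 : 0 < p.
Hypothesis q1 : 1 <= q.
Hypothesis pm : 2 <= m.+1%:R * p.
Hypothesis A0 : 0 <= A.
Hypothesis carl : carleson n A a.
Hypothesis a0 : forall j k, 0 <= a j k.
Hypothesis b0 : forall k, 0 < b k.

Definition grid_avg (j l : nat) : R := \sum_(i < 2 ^ n) h * kern n (2 ^- j) l i * b i.

(** The bound of [box_majorant] for [|g|^q] on the boxes next to [(j, k)], set to 0 beyond the [n0]
    generations where it holds. *)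
Definition grid_max (j k : nat) : R :=
  if (j < n0)%N then (grid_const * grid_avg j (k * 2 ^ (n - j))%N) `^ (m.+1%:R * q) else 0.

Definition stage_const : R :=
  (grid_const * 289) `^ (m.+1%:R * p) * (12 `^ (al - 1)) ^+ 2 * (2 * 96) ^+ 2.

Let h0 : 0 < h. Proof. by rewrite invr_gt0 exprn_gt0. Qed.
Let P0 i : 0 < (2 : R) ^- i. Proof. by rewrite invr_gt0 exprn_gt0. Qed.
Let q0 : 0 < q. Proof. exact: lt_le_trans ltr01 q1. Qed.

Let avg_ge0 j l : 0 <= grid_avg j l.
Proof.
apply: sumr_ge0 => i _; apply: mulr_ge0 (ltW (b0 i)).
by apply: mulr_ge0 (ltW h0) _; exact: kern_ge0.
Qed.

Lemma grid_max_ge0 j k : 0 <= grid_max j k.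
Proof. by rewrite /grid_max; case: ifP => // _; exact: powR_ge0. Qed.

(** A leaf and the left end of its ancestor are at distance at most [16 * 2^-j], and
    [289 = (1 + 16)^2] is the constant of [kern_shift]. *)
Let avg_anc j l : (j <= n)%N -> grid_avg j (anc n j l * 2 ^ (n - j))%N <= 289 * grid_avg j l.
Proof.
move=> jn; rewrite /grid_avg mulr_sumr; apply: ler_sum => i _.
have -> : 289 * (h * kern n (2 ^- j) l i * b i) = h * (289 * kern n (2 ^- j) l i) * b i by ring.
apply: ler_wpM2r; first exact: ltW.
apply: ler_wpM2l; first exact: ltW.
have -> : 289 = (1 + 16) ^+ 2 :> R by ring.
apply: kern_shift => //; apply: le_trans (zeta_lip _ _) _; apply: ler_wpM2l => //.
rewrite -mulrBr normrM (ger0_norm (ltW h0)).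
have le1 : (anc n j l * 2 ^ (n - j) <= l)%N by exact: leq_divM.
have lt1 : (l - anc n j l * 2 ^ (n - j) <= 2 ^ (n - j))%N.
  have := ltn_mod l (2 ^ (n - j)); rewrite expn_gt0 /= => lt.
  by rewrite leq_subLR [in leqRHS]addnC {1}(divn_eq l (2 ^ (n - j))) addnC leq_add2r ltnW.
rewrite ger0_norm; last by rewrite subr_ge0 ler_nat.
rewrite -natrB //; apply: (@le_trans _ _ (h * (2 ^ (n - j))%:R)); first by rewrite ler_pM2l // ler_nat.
have ej : (2 : R) ^+ n = 2 ^+ j * 2 ^+ (n - j) by rewrite -exprD subnKC.
have X0 : (2 : R) ^+ j != 0 by rewrite expf_neq0.
have Y0 : (2 : R) ^+ (n - j) != 0 by rewrite expf_neq0.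
rewrite natrX ej invfM -mulrA mulVf // mulr1 //.
Qed.

Let avg_jensen j (l : 'I_(2 ^ n)) : (j <= n)%N ->
  grid_avg j l `^ al <= 12 `^ (al - 1) * \sum_(i < 2 ^ n) h * kern n (2 ^- j) l i * b i `^ al.
Proof.
move=> jn; have al1 : 1 <= al by have := pm; lra.
have w0 (i : 'I_(2 ^ n)) : 0 <= h * kern n (2 ^- j) l i by apply: mulr_ge0 (ltW h0) _; exact: kern_ge0.
apply: le_trans (jensen_powR _ al1 w0 (fun i => ltW (b0 i))) _.
apply: ler_wpM2r; first by apply: sumr_ge0 => i _; apply: mulr_ge0 (w0 i) _; exact: powR_ge0.
apply: powR_le; [by lra|exact: sumr_ge0|apply: kern_sum].
by rewrite lef_pV2 ?posrE ?exprn_gt0 // ler_eXn2l // ltr1n.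
Qed.

(** [(m + 1) p = 2 al]: Jensen's inequality takes the power [al >= 1], and the square is left for
    [kern_square]. *)
Let max_bound j (l : 'I_(2 ^ n)) : (j <= n)%N -> grid_max j (anc n j l) `^ t <=
  (grid_const * 289) `^ (m.+1%:R * p) * (12 `^ (al - 1)) ^+ 2 *
    (\sum_(i < 2 ^ n) h * kern n (2 ^- j) l i * b i `^ al) ^+ 2.
Proof.
move=> jn; have t0 : t != 0 by rewrite gt_eqF // divr_gt0.
have gc0 := @grid_const_ge0 R.
have gc1 : 0 <= grid_const * 289 :> R by apply: mulr_ge0 gc0 (ler0n _ _).
have r0 : 0 <= m.+1%:R * p by apply: mulr_ge0 (ler0n _ _) (ltW p0).
rewrite /grid_max; case: ifP => _; last first.
  rewrite (powR0 t0); apply: mulr_ge0 (sqr_ge0 _).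
  by apply: mulr_ge0 (powR_ge0 _ _) (sqr_ge0 _).
rewrite -powRrM (_ : m.+1%:R * q * t = m.+1%:R * p); last by field; rewrite gt_eqF.
apply: (@le_trans _ _ ((grid_const * 289) `^ (m.+1%:R * p) * grid_avg j l `^ (m.+1%:R * p))).
  rewrite -(powRM _ gc1 (avg_ge0 j l)).
  apply: powR_le; [exact: r0|exact: mulr_ge0 gc0 (avg_ge0 _ _)|rewrite -mulrA].
  exact: ler_wpM2l gc0 _ _ (avg_anc l jn).
rewrite -mulrA; apply: ler_wpM2l; first exact: powR_ge0.
have -> : grid_avg j l `^ (m.+1%:R * p) = (grid_avg j l `^ al) ^+ 2.
  by rewrite -powR_mulrn ?powR_ge0 // -powRrM; congr (_ `^ _); field.
rewrite -exprMn; apply: lerXn2r; rewrite ?nnegrE ?powR_ge0 //.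
  apply: mulr_ge0 (powR_ge0 _ _) _; apply: sumr_ge0 => i _; apply: mulr_ge0 (powR_ge0 _ _).
  by apply: mulr_ge0 (ltW h0) _; exact: kern_ge0.
exact: avg_jensen.
Qed.

(** After [tree_sum], some generation [J l] attains the maximum over the branch of leaf [l]; the
    radius [2^-(J l)] depends on the leaf, which [kern_square] allows. *)
Lemma grid_stage : \sum_(l < 2 ^ n) (\sum_(j < n0) grid_max j (anc n j l) * (a j (anc n j l) * 2 ^+ j)) `^ t <=
  tree_const A t * (stage_const * \sum_(k < 2 ^ n) b k `^ (m.+1%:R * p)).
Proof.
have t0 : 0 < t by rewrite divr_gt0.
have term0 j l : 0 <= grid_max j (anc n j l) * (a j (anc n j l) * 2 ^+ j).
  by rewrite mulr_ge0 ?grid_max_ge0 // mulr_ge0 // exprn_ge0.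
apply: (@le_trans _ _ (\sum_(l < 2 ^ n) (\sum_(j < n) grid_max j (anc n j l) * (a j (anc n j l) * 2 ^+ j)) `^ t)).
  apply: ler_sum => l _; apply: powR_le; [exact: ltW|exact: sumr_ge0|].
  rewrite -!(big_mkord xpredT (fun j => grid_max j (anc n j l) * (a j (anc n j l) * 2 ^+ j))).
  by rewrite [leRHS](big_cat_nat (leq0n _) n0n) //= lerDl sumr_ge0.
apply: le_trans (tree_sum A0 t0 carl grid_max_ge0 a0) _.
have TC : 0 <= tree_const A t.
  apply: addr_ge0; last by rewrite addr_ge0.
  by apply: mulr_ge0 (ler0n _ _) _; apply: mulr_ge0 (powR_ge0 _ _); exact: mulr_ge0 (ltW t0) A0.
apply: (ler_wpM2l TC).
pose Q j l := (grid_const * 289) `^ (m.+1%:R * p) * (12 `^ (al - 1)) ^+ 2 *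
    (\sum_(i < 2 ^ n) h * kern n (2 ^- j) l i * b i `^ al) ^+ 2.
have c0 : 0 <= (grid_const * 289) `^ (m.+1%:R * p) * (12 `^ (al - 1)) ^+ 2.
  by apply: mulr_ge0 (powR_ge0 _ _) (sqr_ge0 _).
have Q0 j l : 0 <= Q j l by apply: mulr_ge0 c0 (sqr_ge0 _).
have ex (l : nat) : exists j, (j <= n)%N /\ ((l < 2 ^ n)%N ->
    (\big[Num.max/0]_(j < n) grid_max j (anc n j l)) `^ t <= Q j l).
  case: (ltnP l (2 ^ n)) => ln; last by exists 0%N.
  have [j [jn hj]] : exists j, (j <= n)%N /\ (\big[Num.max/0]_(j < n) grid_max j (anc n j l) <=
      grid_max j (anc n j l)).
    elim/big_ind: _ => [|x y [j [jn hj]] [k [kn hk]]|j _].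
    - by exists 0%N; rewrite grid_max_ge0.
    - by case: (leP x y) => xy; [exists k; split=> //|exists j; split=> //].
    - by exists j; split=> //; exact: ltnW.
  exists j; split=> // _; apply: le_trans (max_bound (Ordinal ln) jn).
  apply: powR_le; [exact: ltW|exact: bigmax_ge_id|exact: hj].
have [J hJ] := choice ex.
apply: (@le_trans _ _ (\sum_(l < 2 ^ n) Q (J l) l)).
  by apply: ler_sum => l _; have [_] := hJ l; apply.
rewrite -mulr_sumr /stage_const -[leRHS]mulrA; apply: (ler_wpM2l c0).
have hr (l : nat) : h <= 2 ^- (J l).
  by have [jn _] := hJ l; rewrite lef_pV2 ?posrE ?exprn_gt0 // ler_eXn2l // ltr1n.
apply: le_trans (kern_square hr (fun k => powR_ge0 (b k) al)) _.
rewrite le_eqVlt; apply/orP; left; apply/eqP; congr (_ * _); apply: eq_bigr => k _.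
by rewrite -powR_mulrn ?powR_ge0 // -powRrM; congr (_ `^ _); field.
Qed.

End grid_stage.

(** * Dyadic step functions on the unit interval *)

Section unit_interval.
Context {R : realType}.
Notation mu := (@lebesgue_measure R).

Lemma dyadic_small (e : R) : 0 < e -> exists N, forall n, (N <= n)%N -> 2 ^- n < e.
Proof.
move=> e0; have h0 : 0 <= e^-1 by rewrite invr_ge0 ltW.
exists (Num.Def.archi_bound e^-1) => n hn.
rewrite invf_plt ?posrE ?exprn_gt0 //.
apply: (lt_le_trans (archi_boundP h0)); apply: (@le_trans _ _ n%:R); first by rewrite ler_nat.
by rewrite -natrX ler_nat ltnW // ltn_expl.
Qed.

Lemma dyadic_unif_cont (phi : R -> R) :
  (forall x e : R, 0 < e -> exists2 d : R, 0 < d & forall y, `|y - x| < d -> `|phi y - phi x| < e) ->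
  forall e : R, 0 < e -> exists N, forall n, (N <= n)%N ->
    forall x y, 0 <= x <= 1 -> `|y - x| <= 2 ^- n -> `|phi y - phi x| <= e.
Proof.
move=> cphi e e0.
have K : near_covering `[(0 : R), 1]%classic.
  by apply/compact_near_coveringP; exact: segment_compact.
have := K nat \oo (fun n x => forall y, `|y - x| <= 2 ^- n -> `|phi y - phi x| <= e) _.
case=> [x _|N _ hN]; last first.
  by exists N => n Nn x y x01; apply: (hN n Nn x); rewrite /= in_itv.
have [d d0 hd] := cphi x (e / 2) (divr_gt0 e0 (ltr0n _ 2)).
have d2 : 0 < d / 2 by rewrite divr_gt0.
have [N hN] := dyadic_small d2.
exists ([set y | `|x - y| < d / 2], [set n | (N <= n)%N]).
  split=> /=; first by apply/nbhs_ballP; exists (d / 2).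
  by exists N.
move=> [x' n] /= [h1 h2] y hy; have n2 := hN n h2.
have a1 : `|phi x' - phi x| < e / 2.
  by apply: hd; rewrite distrC; apply: lt_le_trans h1 _; lra.
have a2 : `|phi y - phi x| < e / 2.
  apply: hd; rewrite -(subrKA x'); apply: le_lt_trans (ler_normD _ _) _.
  by rewrite (distrC x'); lra.
rewrite -(subrKA (phi x)); apply: le_trans (ler_normD _ _) _.
by rewrite (distrC (phi x)); lra.
Qed.

Definition cell n k : set R := `[(2 ^- n * k%:R), (2 ^- n * k.+1%:R)[%classic.

Lemma mu_cell n k : mu (cell n k) = (2 ^- n)%:E.
Proof.
rewrite lebesgue_measure_itv /= lte_fin ifT.
  by rewrite -EFinD -(natr1 k) mulrDr mulr1 addrAC subrr add0r.
by rewrite ltr_pM2l ?invr_gt0 ?exprn_gt0 // ltr_nat.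
Qed.

Lemma cell_sub n k : (k < 2 ^ n)%N -> cell n k `<=` `[(0 : R), 1[%classic.
Proof.
rewrite /cell => kn x /=; rewrite !in_itv /= => /andP[x1 x2]; apply/andP; split.
  by apply: le_trans x1; rewrite mulr_ge0 // invr_ge0 exprn_ge0.
apply: (lt_le_trans x2); rewrite ler_pdivrMl ?exprn_gt0 // mulr1 -natrX ler_nat //.
Qed.

Lemma cell_idx n k x : 0 <= x -> cell n k x -> idx n x = k.
Proof.
move=> x0; rewrite /cell /= in_itv /= => /andP[x1 x2].
have /andP[y1 y2] := idx_itv n x0; have P0 : 0 < (2 : R) ^- n by rewrite invr_gt0 exprn_gt0.
have := le_lt_trans x1 y2; have := le_lt_trans y1 x2.
rewrite !ltr_pM2l // !ltr_nat !ltnS => l1 l2; apply/eqP; by rewrite eqn_leq l1 l2.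
Qed.

Lemma idx_cell n x : 0 <= x -> cell n (idx n x) x.
Proof. by move=> x0; rewrite /cell /= in_itv /=; exact: idx_itv. Qed.

Lemma stepE n (v : nat -> R) x : 0 <= x < 1 ->
  v (idx n x) = \sum_(k < 2 ^ n) v k * \1_(cell n k) x.
Proof.
move=> x01; have /andP[x0 _] := x01; have il := idx_lt n x01.
rewrite (bigD1 (Ordinal il)) //= indicE mem_set ?mulr1; last exact: idx_cell.
rewrite big1 ?addr0 // => k /eqP kx; rewrite indicE memNset ?mulr0 //.
by move=> /(cell_idx x0) e; apply: kx; apply: val_inj; rewrite /= e.
Qed.

Let cell_fun n (v : nat -> R) k x := ((v k)%:E * (\1_(cell n k) x : R)%:E)%E.

Let step_eq n v x : 0 <= x < 1 -> (v (idx n x))%:E = (\sum_(k < 2 ^ n) cell_fun n v k x)%E.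
Proof. by move=> x01; rewrite stepE // -sumEFin; apply: eq_bigr => k _; rewrite EFinM. Qed.

Lemma measurable_step d (T : measurableType d) n (v : nat -> T) :
  measurable_fun (`[(0 : R), 1[%classic : set (measurableTypeR R)) (fun x => v (idx n x)).
Proof.
move=> mD Y mY.
rewrite (_ : _ `&` _ = \bigcup_(k in [set k | Y (v k)]) (`[(0 : R), 1[%classic `&` cell n k)).
  by apply: bigcup_measurable => k _; apply: measurableI => //; exact: measurable_itv.
apply/seteqP; split=> [x [/[dup] xD]|x [k /= Yk [/[dup] xD]]]; rewrite /= in_itv /= => /andP[x0 _].
  by move=> Yx; exists (idx n x) => //; split=> //; exact: idx_cell.
by move=> /(cell_idx x0) e; split=> //=; rewrite e.
Qed.

Lemma circ_int_step n (v : nat -> R) : (forall k, 0 <= v k) ->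
  circ_int (fun x => (v (idx n x))%:E) = (2 ^- n * \sum_(k < 2 ^ n) v k)%:E.
Proof.
move=> v0; pose D : set (measurableTypeR R) := `[(0 : R), 1[%classic.
have mD : measurable D by exact: measurable_itv.
have m1 k : measurable_fun D (fun x : measurableTypeR R => (\1_(cell n k) x : R)%:E).
  by apply: measurable_funTS; apply/measurable_EFinP; apply: measurable_indic; exact: measurable_itv.
transitivity (circ_int (fun x => \sum_(k < 2 ^ n) cell_fun n v k x)%E).
  by apply: eq_integral => x /set_mem /=; rewrite in_itv /= => x01; rewrite step_eq.
have mf (k : 'I_(2 ^ n)) : measurable_fun D (cell_fun n v k) by apply: measurable_funeM; exact: m1.
have f0 (k : 'I_(2 ^ n)) x : D x -> (0 <= cell_fun n v k x)%E.
  by move=> _; rewrite /cell_fun -EFinM lee_fin mulr_ge0.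
apply: etrans (ge0_integral_sum mu mD mf f0 _) _.
rewrite mulr_sumr -sumEFin; apply: eq_bigr => k _.
have i0 (x : measurableTypeR R) : D x -> (0 <= (\1_(cell n k) x : R)%:E)%E by rewrite lee_fin.
apply: etrans (ge0_integralZl_EFin mu mD i0 (m1 k) (v0 k)) _.
have mc : measurable (cell n k : set (measurableTypeR R)) by exact: measurable_itv.
apply: etrans (congr1 _ (integral_indic mu mD mc)) _.
rewrite (_ : _ `&` _ = cell n k); last by apply/setIidPl; exact: cell_sub.
by apply: etrans (congr1 _ (mu_cell n k)) _; rewrite -EFinM mulrC.
Qed.

Lemma le_circ_int (F G : R -> \bar R) : (forall x, 0 <= x < 1 -> (0 <= F x)%E) ->
  (forall x, 0 <= x < 1 -> (F x <= G x)%E) -> (circ_int F <= circ_int G)%E.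
Proof.
move=> F0 FG; apply: le_integral_ge0 => x; rewrite /= in_itv /= => x01; first exact: F0.
  exact: le_trans (F0 x x01) (FG x x01).
by move=> _; split=> //; exact: FG.
Qed.

Lemma anc_idx n j (x : R) : 0 <= x -> (j <= n)%N -> anc n j (idx n x) = idx j x.
Proof.
move=> x0 jn; rewrite /anc; have /andP[y1 y2] := idx_itv n x0.
have P0 i : 0 < (2 : R) ^+ i by rewrite exprn_gt0.
symmetry; apply: cell_idx => //; rewrite /cell /= in_itv /=.
set i := idx n x in y1 y2 *; set L := (2 ^ (n - j))%N.
have ej : (2 : R) ^+ n = 2 ^+ j * L%:R by rewrite natrX -exprD subnKC.
have L0 : 0 < L%:R :> R by rewrite ltr0n expn_gt0.
have sc (u : nat) : 2 ^- j * u%:R = 2 ^- n * (u * L)%:R :> R.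
  by rewrite ej natrM; field; rewrite !gt_eqF.
rewrite !sc; apply/andP; split.
  by apply: le_trans y1; rewrite ler_pM2l ?invr_gt0 // ler_nat leq_divM.
by apply: (lt_le_trans y2); rewrite ler_pM2l ?invr_gt0 // ler_nat -ltn_divLR // expn_gt0.
Qed.

End unit_interval.

(** * Stolz angles covered by columns of boxes *)

Section stolz_boxes.
Context {R : realType} {X : normedModType R[i]}.
Variables (s q : R) (f : R[i] -> X).
Hypothesis s0 : s < 0.
Hypothesis q1 : 1 <= q.
Hypothesis df : forall z, cabs z < 1 -> cdiff f z.
Notation mu2 := ((@lebesgue_measure R) \x (@lebesgue_measure R))%E.

Definition box_int j k : \bar R := area_int (whit j k) (density s q f).

Definition box_column j k : \bar R := (\sum_(e < 3) (2 ^+ j.+3)%:E * box_int j (nb j k e))%E.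

Lemma box_int_ge0 j k : (0 <= box_int j k)%E.
Proof. by apply: integral_ge0 => p /whit_lt1 p1; rewrite lee_fin density_ge0. Qed.

Lemma box_column_ge0 j k : (0 <= box_column j k)%E.
Proof. by apply: sume_ge0 => e _; rewrite mule_ge0 ?box_int_ge0 // lee_fin exprn_ge0. Qed.

Let q0 : q != 0. Proof. by rewrite gt_eqF // (lt_le_trans ltr01). Qed.

Let dens (p : R * R) : \bar R := ((density s q f \_ (@disc R)) (toC p))%:E.
Let term j k p : \bar R := (\sum_(e < 3) (2 ^+ j.+3)%:E * (dens \_ (@toC R @^-1` whit j (nb j k e))) p)%E.

Let dens_ge0 p : (0 <= dens p)%E.
Proof. by rewrite lee_fin patch_density_ge0. Qed.

Let piece_ge0 (A : set (R * R)) p : (0 <= (dens \_ A) p)%E.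
Proof. by rewrite patchE; case: ifP. Qed.

Let measurable_piece j k : measurable_fun setT (dens \_ (@toC R @^-1` whit j k)).
Proof.
apply/(measurable_restrict _ _ _).1 => //; first exact: measurable_whit.
exact: measurable_funE_density.
Qed.

Let integral_piece j k : (\int[mu2]_p (dens \_ (@toC R @^-1` whit j k)) p = box_int j k)%E.
Proof. by rewrite -integral_mkcond /box_int area_int_disc //; exact: whit_disc. Qed.

Let term_ge0 j k p : (0 <= term j k p)%E.
Proof. by apply: sume_ge0 => e _; rewrite mule_ge0 // lee_fin exprn_ge0. Qed.

Let measurable_term j k : measurable_fun setT (term j k).
Proof. by apply: emeasurable_sum => e; apply: measurable_funeM; exact: measurable_piece. Qed.

Let integral_term j k : (\int[mu2]_p term j k p = box_column j k)%E.
Proof.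
rewrite ge0_integral_sum //; first last.
- by move=> e p _; rewrite mule_ge0 // lee_fin exprn_ge0.
- by move=> e; apply: measurable_funeM; exact: measurable_piece.
apply: eq_bigr => e _; rewrite -integral_piece.
have c0 : 0 <= (2 : R) ^+ j.+3 by rewrite exprn_ge0.
exact: (ge0_integralZl_EFin mu2 measurableT (fun p _ => piece_ge0 _ p) (measurable_piece _ _) c0).
Qed.

(** The boxes over [x] and their neighbours cover the Stolz angle. Of the two factors
    [1 / (1 - |z|)] one stays in [density], and the other is at most [2^(j + 3)] on a box of
    generation [j]. *)
Lemma stolz_int_le x : 0 <= x < 1 ->
  (area_int (stolz (zeta x)) (fun z => (((1 - cabs z) `^ (- s) * rnorm (f z)) `^ q * (1 - cabs z) ^- 2)%R)
    <= \sum_(0 <= j <oo) box_column j (idx j x))%E.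
Proof.
move=> x01.
under eq_eseriesr do rewrite -integral_term.
rewrite -integral_nneseries //; last by move=> j; exact: measurable_term.
apply: le_integral_ge0 => [p sp|p _|p sp].
- rewrite lee_fin; have := stolz_sub (cabs_zeta x) sp; have := cabs_ge0 (toC p - zeta x) => a b.
  by rewrite mulr_ge0 ?powR_ge0 // invr_ge0 exprn_ge0 //; lra.
- by apply: nneseries_ge0 => j _ _.
move=> pos; split=> //.
have p1 : cabs (toC p) < 1.
  have := stolz_sub (cabs_zeta x) sp; have := cabs_ge0 (toC p - zeta x) => a b.
  (* Where [|z| = 1] the integrand is 0, as [- s > 0]; [pos] excludes such points. *)
  rewrite lt_neqAle; apply/andP; split; last by lra.
  apply/eqP => c1; move: pos; rewrite lte_fin c1 subrr powR0; last by rewrite gt_eqF // oppr_gt0.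
  by rewrite mul0r powR0 // mul0r ltxx.
have d0 : 0 < 1 - cabs (toC p) by rewrite subr_gt0.
have [j [e [e3 wp]]] := stolz_whit x01 sp p1.
apply: (@le_trans _ _ (term j (idx j x) p)); last first.
  apply: le_trans (nneseries_lim_ge j.+1 _) => //.
  by rewrite big_nat_recr //= leeDr // sume_ge0.
rewrite /term (bigD1 (Ordinal e3)) //= patchE mem_set //.
apply: (@le_trans _ _ ((2 ^+ j.+3)%:E * dens p)%E); last first.
  by rewrite leeDl // sume_ge0 // => i _; rewrite mule_ge0 // lee_fin exprn_ge0.
rewrite /dens patchE mem_set // -EFinM lee_fin /density mulrCA.
apply: ler_wpM2l; first exact: powR_ge0.
rewrite expr2 invfM; apply: ler_wpM2r; first by rewrite invr_ge0 ltW.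
rewrite -[leRHS]invrK lef_pV2 ?posrE ?invr_gt0 ?exprn_gt0 //.
move: wp; case: j => [|[|j]] //= [].
  by move=> _ h; rewrite (_ : 2 ^+ 3 = 8); [exact: ltW|ring].
move=> /andP[h _] _; apply: le_trans (ltW h).
by rewrite lef_pV2 ?posrE ?exprn_gt0 // ler_eXn2l // ltr1n.
Qed.

End stolz_boxes.

(** * The estimate for finitely many generations *)

Section stage_bound.
Context {R : realType} {X : normedModType R[i]}.
Variables (s p q kap M B Gp : R) (m : nat) (g : R[i] -> X) (h : R[i] -> CC R).
Hypothesis p0 : 0 < p.
Hypothesis q1 : 1 <= q.
Hypothesis pm : 2 <= m.+1%:R * p.
Hypothesis kap0 : 0 < kap.
Hypothesis M0 : 0 <= M.
Hypothesis B1 : 1 <= B.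
Hypothesis BM : 4 * (34 ^+ 2) * M <= B.
Hypothesis dg : forall z, cabs z < 1 -> cdiff g z.
Hypothesis dh : forall z, cabs z < 1 -> cdiff h z.
Hypothesis tents : forall j k, (k < 2 ^ j)%N ->
  (area_int (tent (dyadic_arc j k)) (tent_density s q h) <= (kap * 2 ^- j)%:E)%E.
Hypothesis bloch : forall z, cabs z < 1 -> wq s q h z <= M * kap.
Hypothesis hardy : forall r, 0 < r < 1 ->
  (circ_int (fun x => (rnorm (g (r%:C * zeta x)) `^ p)%:E) <= Gp%:E)%E.

Notation f := (fun z => h z *: g z).
Notation t := (p / q).
Let carl_const : R := 24 * (8 * B + 1).
Let mass j k : R := 8 * \sum_(e < 3) box_mass s q h j (nb j k e).

Let q0 : 0 < q. Proof. exact: lt_le_trans ltr01 q1. Qed.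

Let mass_ge0 j k : 0 <= mass j k.
Proof. by apply: mulr_ge0 (ler0n _ _) (sumr_ge0 _ _) => e _; exact: box_mass_ge0. Qed.

Lemma density_mul z : cabs z < 1 ->
  density s q f z = rnorm (g z) `^ q * tent_density s q h z.
Proof.
move=> z1; rewrite /density /tent_density rnormZ.
have -> : (1 - cabs z) `^ (- s) * (cabs (h z) * rnorm (g z)) =
  rnorm (g z) * ((1 - cabs z) `^ (- s) * cabs (h z)) by ring.
by rewrite powRM ?rnorm_ge0 ?mulr_ge0 ?powR_ge0 ?cabs_ge0 // mulrA.
Qed.

Lemma column_bound n0 n b j k : (n0 <= n)%N -> (forall i, 0 < b i) ->
  (forall i x, (i < 2 ^ n)%N -> 2 ^- n * i%:R <= x < 2 ^- n * i.+1%:R ->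
     rnorm (g ((1 - 2 ^- n0.+4)%:C * zeta x)) <= b i ^+ m.+1) ->
  (j < n0)%N -> (k < 2 ^ j)%N ->
  (box_column s q f j k <= (grid_max n0 n m q b j k * (mass j k * 2 ^+ j))%:E)%E.
Proof.
move=> n0n b0 gb jn kj; set c := grid_max n0 n m q b j k.
have c0 : 0 <= c by exact: grid_max_ge0.
have bound e : (e < 3)%N -> (box_int s q f j (nb j k e) <= (c * box_mass s q h j (nb j k e))%:E)%E.
  move=> e3.
  have pt z : whit j (nb j k e) z -> density s q f z <= c * tent_density s q h z.
    move=> wz; have z1 := whit_lt1 wz; rewrite density_mul //.
    apply: ler_wpM2r; first exact: tent_density_ge0.
    have := box_majorant n0n dg b0 gb jn kj e3 wz; rewrite -/(grid_avg n b j _) => hG.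
    rewrite /c /grid_max jn.
    have y0 : 0 <= grid_const * grid_avg n b j (k * 2 ^ (n - j))%N.
      apply: mulr_ge0 grid_const_ge0 _; apply: sumr_ge0 => i _; apply: mulr_ge0 (ltW (b0 i)).
      by apply: mulr_ge0; [rewrite invr_ge0 exprn_ge0|apply: kern_ge0; rewrite invr_gt0 exprn_gt0].
    rewrite powRrM powR_mulrn //; apply: powR_le => //; [exact: ltW|exact: rnorm_ge0].
  rewrite /box_int EFinM -(box_massE (ltW kap0) M0 B1 BM tents bloch (nb_lt j k e)).
  move: c0; rewrite le_eqVlt => /orP[/eqP ce|cp].
    rewrite -ce mul0e /area_int -(integral0 ((@lebesgue_measure R) \x (@lebesgue_measure R))%E setT).
    apply: le_integral_ge0 => // u /= wu; have u1 := whit_lt1 wu.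
      by rewrite lee_fin density_ge0.
    by rewrite lte_fin; have := pt _ wu; rewrite -ce mul0r => h1 h2; move: (lt_le_trans h2 h1); rewrite ltxx.
  apply: le_integral_scale => // u /= wu; have u1 := whit_lt1 wu.
  - by rewrite lee_fin density_ge0.
  - by rewrite lee_fin tent_density_ge0.
  - by split=> //; rewrite -EFinM lee_fin; exact: pt.
have -> : c * (mass j k * 2 ^+ j) = \sum_(e < 3) 2 ^+ j.+3 * (c * box_mass s q h j (nb j k e)).
  rewrite -mulr_sumr -mulr_sumr /mass !exprS; ring.
rewrite -sumEFin; apply: lee_sum => e _.
have x0 : (0 <= ((2 : R) ^+ j.+3)%:E)%E by rewrite lee_fin exprn_ge0.
by apply: le_trans (lee_wpmul2l x0 (bound e (ltn_ord e))) _; rewrite -EFinM.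
Qed.

(** Division by [kap] makes the Carleson constant independent of [h]; the power [kap^(p / q)]
    reappears outside the integral. *)
Let carl_scaled n : carleson n carl_const (fun j k => mass j k / kap).
Proof.
move=> j0 i0 jn; have := carleson_boxes q1 (ltW kap0) M0 B1 BM dh tents bloch i0 jn.
under [X in _ -> X <= _]eq_bigr do rewrite -mulr_suml.
rewrite -mulr_suml -/mass ler_pdivrMr // => h1; apply: le_trans h1 _.
by rewrite le_eqVlt; apply/orP; left; apply/eqP; rewrite /carl_const; ring.
Qed.

Lemma stage_bound n0 (ep : R) : 0 < ep ->
  (circ_int (fun x => (\sum_(j < n0) box_column s q f j (idx j x))%E `^ t)%E <=
   (kap `^ t * (tree_const carl_const t * stage_const m p) * (2 `^ p * (Gp + ep)))%:E)%E.
Proof.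
move=> ep0; have t0 : 0 < t by rewrite divr_gt0.
(* The upper and lower step functions of [phi] differ by at most [2 * dl], whose [p]-th power is
   [ep]. *)
pose dl := ep `^ p^-1 / 2; have dl0 : 0 < dl by rewrite divr_gt0 // powR_gt0.
have dlE : (2 * dl) `^ p = ep.
  by rewrite /dl mulrCA divff // mulr1 -powRrM mulVf ?gt_eqF // powRr1 // ltW.
pose rad : R := 1 - 2 ^- n0.+4.
have rad1 : rad < 1 by rewrite ltrBlDr ltrDl invr_gt0 exprn_gt0.
have rad0 : 0 < rad.
  by rewrite subr_gt0 invf_lt1 ?exprn_gt0 // exprn_egt1 // ltr1n.
have radz x : cabs (rad%:C * zeta x) < 1 by rewrite cabs_polar // ltW.
pose phi x := rnorm (g (rad%:C * zeta x)).
have phi0 x : 0 <= phi x by exact: rnorm_ge0.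
have [N hN] : exists N, forall n, (N <= n)%N -> forall x y, 0 <= x <= 1 -> `|y - x| <= 2 ^- n -> `|phi y - phi x| <= dl.
  apply: dyadic_unif_cont => // x e e0.
  have [d d0 hd] := cabs_continuous (dg (radz x)) e0.
  exists (d / 16); first by rewrite divr_gt0.
  move=> y hy; apply: hd; rewrite -mulrBr cabsM cabsR gtr0_norm //.
  apply: (@le_lt_trans _ _ (cabs (zeta y - zeta x))); first by rewrite ler_piMl ?cabs_ge0 // ltW.
  by have := zeta_lip y x; lra.
pose n := maxn N n0; have Nn : (N <= n)%N by rewrite leq_maxl.
have n0n : (n0 <= n)%N by rewrite leq_maxr.
have P0 : 0 < (2 : R) ^- n by rewrite invr_gt0 exprn_gt0.
pose fk (k : nat) := phi (2 ^- n * k%:R).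
have near k x : (k < 2 ^ n)%N -> 2 ^- n * k%:R <= x < 2 ^- n * k.+1%:R -> `|phi x - fk k| <= dl.
  move=> kn /andP[x1 x2]; apply: (hN n Nn).
    apply/andP; split; first by rewrite mulr_ge0 // ltW.
    by rewrite ler_pdivrMl ?exprn_gt0 // mulr1 -natrX ler_nat ltnW.
  by move: x2; rewrite -(natr1 k) mulrDr mulr1 => x2; rewrite ler_norml; apply/andP; split; lra.
(* Adding [dl] gives an upper bound on the whole cell and keeps [b] positive at zeros of [g]. *)
pose b k := (fk k + dl) `^ (m.+1%:R)^-1.
have fd0 k : 0 < fk k + dl by rewrite ltr_wpDl //; exact: phi0.
have b0 k : 0 < b k by rewrite powR_gt0.
have gb k x : (k < 2 ^ n)%N -> 2 ^- n * k%:R <= x < 2 ^- n * k.+1%:R -> rnorm (g (rad%:C * zeta x)) <= b k ^+ m.+1.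
  move=> kn hx; rewrite -powR_mulrn ?(ltW (b0 _)) // -powRrM mulVf // powRr1 ?(ltW (fd0 _)) //.
  by have := near k x kn hx; rewrite ler_norml -/(phi x) => /andP[_]; lra.
have A0 : 0 <= carl_const.
  by apply: mulr_ge0 (ler0n _ _) _; rewrite addr_ge0 // mulr_ge0 // (le_trans ler01 B1).
have a0 j k : 0 <= mass j k / kap by rewrite divr_ge0 // ltW.
have st := grid_stage n0n p0 q1 pm A0 (carl_scaled (n := n)) a0 b0.
pose T l := (\sum_(j < n0) grid_max n0 n m q b j (anc n j l) * (mass j (anc n j l) / kap * 2 ^+ j)).
have T0 l : 0 <= T l.
  by apply: sumr_ge0 => j _; rewrite mulr_ge0 ?grid_max_ge0 // mulr_ge0 // exprn_ge0.
apply: (@le_trans _ _ (circ_int (fun x => (kap `^ t * T (idx n x) `^ t)%:E))).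
  apply: le_circ_int => x x01; first exact: poweR_ge0.
  have /andP[x0 _] := x01.
  have S0 : (0 <= \sum_(j < n0) box_column s q f j (idx j x))%E.
    by apply: sume_ge0 => j _; exact: box_column_ge0.
  rewrite -powRM ?(ltW kap0) // -poweR_EFin.
  apply: gt0_ler_poweR; rewrite ?(ltW t0) // ?in_itv /= ?leey ?andbT //.
    by rewrite lee_fin mulr_ge0 // ltW.
  have -> : kap * T (idx n x) = \sum_(j < n0) grid_max n0 n m q b j (idx j x) * (mass j (idx j x) * 2 ^+ j).
    rewrite /T mulr_sumr; apply: eq_bigr => j _.
    rewrite (anc_idx x0) ?(leq_trans (ltnW (ltn_ord j))) //.
    by field; rewrite gt_eqF.
  rewrite -sumEFin; apply: lee_sum => j _.
  by apply: column_bound => //; exact: idx_lt.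
rewrite (@circ_int_step R n (fun l => kap `^ t * T l `^ t)); last by move=> k; rewrite mulr_ge0 ?powR_ge0.
have asso (u v w y : R) : u * (v * w) * y = u * (v * (w * y)) by ring.
rewrite lee_fin -mulr_sumr mulrCA asso; apply: ler_wpM2l; first exact: powR_ge0.
apply: (@le_trans _ _ (2 ^- n * (tree_const carl_const t * (stage_const m p * \sum_(k < 2 ^ n) b k `^ (m.+1%:R * p))))).
  by apply: ler_wpM2l; [exact: ltW|exact: st].
rewrite (mulrCA (2 ^- n)) (mulrCA (2 ^- n) (stage_const m p)).
have TC : 0 <= tree_const carl_const t.
  apply: addr_ge0; last by rewrite addr_ge0.
  by apply: mulr_ge0 (ler0n _ _) _; apply: mulr_ge0 (powR_ge0 _ _); exact: mulr_ge0 (ltW t0) A0.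
have SC : 0 <= stage_const m p.
  apply: mulr_ge0 (sqr_ge0 _); apply: mulr_ge0 (sqr_ge0 _); exact: powR_ge0.
apply: (ler_wpM2l TC); apply: (ler_wpM2l SC).
(* This step function lies below [phi], so the Hardy norm bounds its mean; the truncation keeps it
   nonnegative. *)
pose lo k := Num.max (fk k - dl) 0.
have lo0 k : 0 <= lo k by rewrite le_max lexx orbT.
have lo1 k : fk k + dl <= lo k + 2 * dl.
  by rewrite -lerBlDr le_max; apply/orP; left; lra.
have loE : 2 ^- n * \sum_(k < 2 ^ n) lo k `^ p <= Gp.
  rewrite -lee_fin -(@circ_int_step R n (fun k => lo k `^ p)); last by move=> k; exact: powR_ge0.
  apply: le_trans (hardy (r := rad) _); last by rewrite rad0.
  apply: le_circ_int => x x01; rewrite lee_fin ?powR_ge0 //.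
  have /andP[x0 _] := x01; apply: powR_le; [exact: ltW|by []|].
  have := near _ x (idx_lt n x01) (idx_itv n x0); rewrite ler_norml => /andP[h1 h2].
  by rewrite ge_max; apply/andP; split; [rewrite -/(phi x); lra|exact: phi0].
apply: (@le_trans _ _ (2 ^- n * \sum_(k < 2 ^ n) 2 `^ p * (lo k `^ p + ep))).
  apply: ler_wpM2l; first exact: ltW.
  apply: ler_sum => k _; rewrite /b -powRrM mulrA mulVf // mul1r.
  apply: (@le_trans _ _ ((lo k + 2 * dl) `^ p)); first by apply: powR_le; [exact: ltW|exact: ltW|].
  rewrite -dlE; apply: powR_sum_le => //; [by rewrite mulr_ge0 // ltW|exact: ltW].
rewrite -mulr_sumr mulrCA; apply: ler_wpM2l; first exact: powR_ge0.
rewrite big_split /= sumr_const card_ord mulrDr; apply: lerD => //.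
by rewrite -[ep *+ _]mulr_natl natrX mulrA mulVf ?mul1r // expf_neq0.
Qed.

End stage_bound.

(** * Passage to all generations *)

Section limits.
Context {R : realType}.

(** The power [1 / t] recovers the partial sums from their powers, so a bound on the latter is one
    on the series. *)
Lemma poweR_nneseries_le (u : nat -> \bar R) (t : R) : 0 < t -> (forall j, 0 <= u j)%E ->
  ((\sum_(0 <= j <oo) u j) `^ t <= limn (fun n => (\sum_(j < n) u j) `^ t))%E.
Proof.
move=> t0 u0; pose v n := (\sum_(j < n) u j)%E.
have v0 n : (0 <= v n)%E by apply: sume_ge0.
have vm : {homo v : m n / (m <= n)%N >-> (m <= n)%E}.
  move=> m n mn; rewrite /v -!(big_mkord xpredT u).
  by rewrite [leRHS](big_cat_nat (leq0n _) mn) //= leeDl // sume_ge0.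
have wm : {homo (fun n => v n `^ t)%E : m n / (m <= n)%N >-> (m <= n)%E}.
  by move=> m n mn; apply: gt0_ler_poweR; rewrite ?(ltW t0) // ?in_itv /= ?v0 ?leey //; exact: vm.
rewrite (cvg_lim _ (ereal_nondecreasing_cvgn wm)) //.
set L := ereal_sup _.
have hL n : (v n `^ t <= L)%E by apply: ereal_sup_ubound; exists n.
have L0 : (0 <= L)%E by apply: le_trans (hL 0%N); exact: poweR_ge0.
have vL n : (v n <= L `^ t^-1)%E.
  rewrite -[leLHS]poweRe1 // -(divff (lt0r_neq0 t0)) poweRrM.
  apply: gt0_ler_poweR; rewrite ?in_itv /= ?poweR_ge0 ?L0 ?leey ?invr_ge0 ?(ltW t0) //.
have -> : L = ((L `^ t^-1) `^ t)%E by rewrite -poweRrM mulVf ?gt_eqF // poweRe1.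
apply: gt0_ler_poweR; rewrite ?(ltW t0) // ?in_itv /= ?poweR_ge0 ?leey ?andbT //.
  exact: nneseries_ge0.
apply: lime_le; first by apply: is_cvg_nneseries.
by apply: nearW => n; rewrite big_mkord; exact: vL.
Qed.

Lemma circ_int_series_le (c : nat -> nat -> \bar R) (t : R) (K : \bar R) : 0 < t ->
  (forall j k, 0 <= c j k)%E ->
  (forall n, circ_int (fun x => (\sum_(j < n) c j (idx j x))%E `^ t)%E <= K)%E ->
  (circ_int (fun x => (\sum_(0 <= j <oo) c j (idx j x))%E `^ t)%E <= K)%E.
Proof.
move=> t0 c0 hK.
pose D : set (measurableTypeR R) := `[(0 : R), 1[%classic.
have mD : measurable D by exact: measurable_itv.
pose v n (x : measurableTypeR R) := ((\sum_(j < n) c j (idx j x)) `^ t)%E.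
have mv n : measurable_fun D (v n).
  apply: (measurableT_comp (measurable_poweR t)).
  by apply: emeasurable_sum => j; exact: measurable_step.
have v0 n x : D x -> (0 <= v n x)%E by move=> _; exact: poweR_ge0.
have s0 n x : (0 <= \sum_(j < n) c j (idx j x))%E by apply: sume_ge0.
have vm x : D x -> {homo v ^~ x : m n / (m <= n)%N >-> (m <= n)%E}.
  move=> _ m n mn; apply: gt0_ler_poweR; rewrite ?(ltW t0) // ?in_itv /= ?s0 ?leey //.
  rewrite -!(big_mkord xpredT (fun j => c j (idx j x))).
  by rewrite [leRHS](big_cat_nat (leq0n _) mn) //= leeDl // sume_ge0.
apply: (@le_trans _ _ (\int[@lebesgue_measure R]_(x in D) limn (v ^~ x))%E).
  apply: le_circ_int => x _; first exact: poweR_ge0.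
  exact: poweR_nneseries_le.
rewrite (monotone_convergence _ mD mv v0 vm); apply: lime_le.
  apply: ereal_nondecreasing_is_cvgn => m n mn; apply: le_integral_ge0 => x Dx; [exact: v0|exact: v0|].
  by move=> _; split=> //; exact: vm.
by apply: nearW => n; exact: hK.
Qed.

End limits.

Section factor_bound.
Context {R : realType} {X : normedModType R[i]}.
Variables (s p q : R).
Hypothesis s0 : s < 0.
Hypothesis p0 : 0 < p.
Hypothesis q1 : 1 <= q.

Let q0 : 0 < q. Proof. exact: lt_le_trans ltr01 q1. Qed.

Lemma circ_int_ge0 (F : R -> \bar R) : (forall x, 0 <= F x)%E -> (0 <= circ_int F)%E.
Proof. by move=> F0; apply: integral_ge0. Qed.

Lemma Hnorm_ge0 (g : R[i] -> X) : (0 <= Hnorm p g)%E.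
Proof.
apply: (@le_trans _ _ ((circ_int (fun x => (rnorm (g ((2^-1)%:C * zeta x)) `^ p)%:E) `^ p^-1)%E)).
  exact: poweR_ge0.
apply: ereal_sup_ubound; exists 2^-1 => //=.
by rewrite in_itv /=; apply/andP; split; lra.
Qed.

Lemma Hnorm_mean (g : R[i] -> X) r : 0 < r < 1 -> (Hnorm p g < +oo)%E ->
  (circ_int (fun x => (rnorm (g (r%:C * zeta x)) `^ p)%:E) <= (fine (Hnorm p g) `^ p)%:E)%E.
Proof.
move=> r01 hg; set I := circ_int _.
have I0 : (0 <= I)%E by apply: circ_int_ge0 => x; rewrite lee_fin powR_ge0.
have H0 := Hnorm_ge0 g.
have hI : (I `^ p^-1 <= Hnorm p g)%E by apply: ereal_sup_ubound; exists r => //=; rewrite in_itv.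
rewrite -poweR_EFin fineK ?ge0_fin_numE //.
rewrite -[leLHS]poweRe1 // -(mulVf (lt0r_neq0 p0)) poweRrM.
by apply: gt0_ler_poweR; rewrite ?(ltW p0) // ?in_itv /= ?poweR_ge0 ?H0 ?leey.
Qed.

Lemma Finfnorm_ge0 (h : CC R -> CC R) : (0 <= Finfnorm s q h)%E.
Proof. exact: poweR_ge0. Qed.

Lemma Finfnorm_tents (h : CC R -> CC R) j k : (k < 2 ^ j)%N -> (Finfnorm s q h < +oo)%E ->
  (area_int (tent (dyadic_arc j k)) (tent_density s q h) <=
    ((fine (Finfnorm s q h) `^ q) * 2 ^- j)%:E)%E.
Proof.
move=> kj; rewrite /Finfnorm /Tinfnorm; set S := ereal_sup _ => hS.
have hle : ((2 ^ j)%N%:R%:E * area_int (tent (dyadic_arc j k)) (tent_density s q h) <= S)%E.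
  apply: ereal_sup_ubound; exists j, k; split=> //; congr (_ * _)%E.
have A0 : (0 <= area_int (tent (dyadic_arc j k)) (tent_density s q h))%E.
  by apply: integral_ge0 => u [u1 _]; rewrite lee_fin tent_density_ge0.
have S0 : (0 <= S)%E by apply: le_trans hle; rewrite mule_ge0.
have SE : S = (fine (S `^ q^-1) `^ q)%:E.
  rewrite -poweR_EFin fineK; last by rewrite ge0_fin_numE ?poweR_ge0.
  by rewrite -poweRrM mulVf ?gt_eqF // poweRe1.
have P0 : 0 < (2 ^ j)%:R :> R by rewrite ltr0n expn_gt0.
rewrite SE in hle; rewrite mulrC EFinM -natrX lee_pdivlMl //.
Qed.

Lemma factor_bound : exists2 C : R, 0 <= C &
  forall (g : CC R -> X) (h : CC R -> CC R),
    analytic g -> (Hnorm p g < +oo)%E -> analytic h -> (Finfnorm s q h < +oo)%E ->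
    (Fnorm s p q (fun z => (h z : R[i]) *: g z) <= C%:E * Hnorm p g * Finfnorm s q h)%E.
Proof.
have [m pm] : exists m, 2 <= m.+1%:R * p.
  have e0 : 0 <= 2 / p by rewrite divr_ge0 // ltW.
  exists (Num.Def.archi_bound (2 / p)); rewrite -ler_pdivrMr //.
  by apply: le_trans (ltW (archi_boundP e0)) _; rewrite ler_nat.
have [M M0 hM] := bloch_bound s0 q1.
have [B [B1 BM]] : exists B : R, 1 <= B /\ 4 * (34 ^+ 2) * M <= B.
  exists (4 * (34 ^+ 2) * M + 1).
  have c0 : 0 <= 4 * (34 ^+ 2) * M.
    by apply: mulr_ge0 M0; apply: mulr_ge0 (ler0n _ _) (exprn_ge0 _ (ler0n _ _)).
  by split; [rewrite lerDr|rewrite lerDl].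
have t0 : 0 < p / q by rewrite divr_gt0.
have B0 : 0 <= B by exact: le_trans ler01 B1.
pose K := tree_const (24 * (8 * B + 1)) (p / q) * stage_const m p * 2 `^ p.
have K0 : 0 <= K.
  have A0 : 0 <= 24 * (8 * B + 1) by apply: mulr_ge0 (ler0n _ _) (addr_ge0 (mulr_ge0 (ler0n _ _) B0) ler01).
  apply: mulr_ge0 (powR_ge0 _ _); apply: mulr_ge0.
    apply: addr_ge0; last exact: addr_ge0 ler01 A0.
    by apply: mulr_ge0 (ler0n _ _) _; apply: mulr_ge0 (powR_ge0 _ _); exact: mulr_ge0 (ltW t0) A0.
  by apply: mulr_ge0 (sqr_ge0 _); apply: mulr_ge0 (sqr_ge0 _); exact: powR_ge0.
exists (K `^ p^-1); first exact: powR_ge0.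
move=> g h ag hg ah hh; set f := fun z => _.
have dg z : cabs z < 1 -> cdiff g z by move=> /ag/derivable_cdiff.
have dh z : cabs z < 1 -> cdiff h z by move=> /ah/derivable_cdiff.
have df z : cabs z < 1 -> cdiff f z by move=> z1; apply: cdiffZ; [exact: dh|exact: dg].
set Hg := fine (Hnorm p g); set Hh := fine (Finfnorm s q h).
have gE : Hnorm p g = Hg%:E by rewrite fineK // ge0_fin_numE // Hnorm_ge0.
have hE : Finfnorm s q h = Hh%:E by rewrite fineK // ge0_fin_numE // Finfnorm_ge0.
have Hg0 : 0 <= Hg by apply: fine_ge0; exact: Hnorm_ge0.
have Hh0 : 0 <= Hh by apply: fine_ge0; exact: Finfnorm_ge0.
(* The masses are divided by [kap], which has to be positive; [ep1] covers an [h] of norm 0 and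
   tends to 0 at the end. *)
have main ep1 : 0 < ep1 -> (Fnorm s p q f <= (K `^ p^-1 * Hg * (Hh + ep1))%:E)%E.
  move=> e1; have kb : 0 < Hh + ep1 by exact: ltr_wpDl.
  pose kap := (Hh + ep1) `^ q; have kap0 : 0 < kap by rewrite powR_gt0.
  have tents j k : (k < 2 ^ j)%N ->
      (area_int (tent (dyadic_arc j k)) (tent_density s q h) <= (kap * 2 ^- j)%:E)%E.
    move=> kj; apply: le_trans (Finfnorm_tents kj hh) _; rewrite lee_fin -/Hh.
    apply: ler_wpM2r; first by rewrite invr_ge0 exprn_ge0.
    by apply: powR_le; [exact: ltW|by []|rewrite lerDl ltW].
  have bl := hM kap h (ltW kap0) dh tents.
  have stage n : (circ_int (fun x => (\sum_(j < n) box_column s q f j (idx j x))%E `^ (p / q))%E <=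
      (kap `^ (p / q) * K * Hg `^ p)%:E)%E.
    apply/lee_addgt0Pr => e e0.
    have Q0 : 0 <= kap `^ (p / q) * K by apply: mulr_ge0 (powR_ge0 _ _) K0.
    pose ep := e / (kap `^ (p / q) * K + 1).
    have ep0 : 0 < ep by rewrite divr_gt0 // ltr_wpDl.
    have := stage_bound p0 q1 pm kap0 M0 B1 BM dg dh tents bl (Gp := Hg `^ p)
       (fun r r01 => Hnorm_mean r01 hg) n ep0.
    move=> h1; apply: (le_trans h1); rewrite -EFinD lee_fin.
    have asso (u v y : R) : u * v * (2 `^ p * y) = u * (v * 2 `^ p) * y by ring.
    rewrite asso -/K mulrDr lerD2l /ep mulrCA; apply: ler_piMr; first exact: ltW.
    by rewrite ler_pdivrMr ?ltr_wpDl // mul1r lerDl.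
  have series := circ_int_series_le t0 (box_column_ge0 s q f) stage.
  have I1 : (circ_int (fun x => Aq q (fun z => ((1 - cabs z) `^ (- s) * rnorm (f z))%R) (zeta x) `^ p)%E
     <= (kap `^ (p / q) * K * Hg `^ p)%:E)%E.
    apply: le_trans series; apply: le_circ_int => x x01; first exact: poweR_ge0.
    rewrite /Aq -poweRrM [q^-1 * p]mulrC.
    apply: gt0_ler_poweR; rewrite ?(ltW t0) // ?in_itv /= ?leey ?andbT.
    - apply: integral_ge0 => u su; rewrite lee_fin mulr_ge0 ?powR_ge0 // invr_ge0 exprn_ge0 //.
      by have := stolz_sub (cabs_zeta x) su; have := cabs_ge0 (toC u - zeta x); lra.
    - by apply: nneseries_ge0 => j _ _; exact: box_column_ge0.
    - exact: stolz_int_le.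
  rewrite /Fnorm /Tnorm.
  have -> : K `^ p^-1 * Hg * (Hh + ep1) = (kap `^ (p / q) * K * Hg `^ p) `^ p^-1.
    have k1 : 0 <= kap `^ (p / q) * K by apply: mulr_ge0 (powR_ge0 _ _) K0.
    rewrite (powRM _ k1 (powR_ge0 _ _)) (powRM _ (powR_ge0 _ _) K0).
    have -> : (kap `^ (p / q)) `^ p^-1 = Hh + ep1.
      rewrite /kap -!powRrM (_ : q * (p / q / p) = 1) ?powRr1 ?(ltW kb) //.
      by field; rewrite !gt_eqF.
    have -> : (Hg `^ p) `^ p^-1 = Hg by rewrite -powRrM divff ?gt_eqF // powRr1.
    by rewrite mulrC mulrA.
  rewrite -poweR_EFin; apply: gt0_ler_poweR; rewrite ?invr_ge0 ?(ltW p0) // ?in_itv /= ?leey ?andbT //.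
    by apply: circ_int_ge0 => x; exact: poweR_ge0.
  by apply: le_trans I1; apply: circ_int_ge0 => x; exact: poweR_ge0.
rewrite gE hE -!EFinM; apply/lee_addgt0Pr => e e0.
have c0 : 0 <= K `^ p^-1 * Hg by rewrite mulr_ge0 // powR_ge0.
have d0 : 0 < K `^ p^-1 * Hg + 1 by exact: ltr_wpDl.
apply: le_trans (main (e / (K `^ p^-1 * Hg + 1)) _) _; first by rewrite divr_gt0.
rewrite -EFinD lee_fin mulrDr lerD2l mulrCA; apply: ler_piMr; first exact: ltW.
by rewrite ler_pdivrMr // mul1r lerDl.
Qed.

End factor_bound.

(** * The counterexample *)

Section power_series.
Context {R : realType} {V : completeNormedModType R[i]}.
Implicit Types (v u : nat -> V) (z a : R[i]) (C r e : R).

Lemma cauchy_limit (S : nat -> V) (err : nat -> R) :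
  (forall m n, (m <= n)%N -> rnorm (S n - S m) <= err m) ->
  (forall e : R, 0 < e -> exists N, forall n, (N <= n)%N -> err n <= e) ->
  exists l, forall m, rnorm (l - S m) <= err m.
Proof.
move=> hS herr.
have cS : cvg (S @ \oo).
  apply: cauchy_cvg; apply: cauchy_exP => _ /posC[e e0 ->].
  have [N hN] := herr (e / 2) (divr_gt0 e0 (ltr0n _ 2)).
  exists (S N); exists N => // n /= Nn.
  rewrite -ball_normE /ball_ /= norm_rnorm ltcR rnormB.
  by apply: le_lt_trans (hS _ _ Nn) _; apply: le_lt_trans (hN N (leqnn N)) _; lra.
exists (lim (S @ \oo)) => m; apply/ler_addgt0Pr => e e0.
have /cvgrPdist_le /(_ e%:C) := cS; rewrite ltcR => /(_ e0)[N _ hN].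
have := hN (maxn N m) (leq_maxl _ _); rewrite norm_rnorm lecR => h1.
rewrite -(subrKA (S (maxn N m))); apply: le_trans (rnormD _ _) _; rewrite addrC.
by apply: lerD => //; apply: hS; rewrite leq_maxr.
Qed.

Lemma exprn_small r e : 0 <= r -> r < 1 -> 0 < e -> exists N, forall n, (N <= n)%N -> r ^+ n <= e.
Proof.
move=> r0 r1 e0; have d0 : 0 < e * (1 - r) by rewrite mulr_gt0 // subr_gt0.
have p0 : 0 <= (e * (1 - r))^-1 by rewrite invr_ge0 ltW.
exists (Num.Def.archi_bound (e * (1 - r))^-1) => n hn.
have h1 : (e * (1 - r))^-1 < n%:R by apply: (lt_le_trans (archi_boundP p0)); rewrite ler_nat.
have h2 := exprn_le_inv n r0 (ltW r1).
rewrite -[X in X < _]mul1r ltr_pdivrMr // in h1.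
have n0 : 0 < n%:R * (1 - r).
  apply: mulr_gt0; last by rewrite subr_gt0.
  by rewrite lt_neqAle ler0n andbT; apply/eqP => n0; move: h1; rewrite -n0 mul0r ltr10.
rewrite -(ler_pM2r n0); have := exprn_ge0 n r0.
by move: h2; rewrite mulrDr mulr1 => h2 h3; lra.
Qed.

Definition psum v n z : V := \sum_(k < n) z ^+ k *: v k.

(** The sum of the series is specified by its rate of convergence, so that identities reduce to
    [geometric_eq0]. *)
Definition is_psum v C (F : R[i] -> V) := forall z, cabs z < 1 ->
  forall n, rnorm (F z - psum v n z) <= C / (1 - cabs z) * cabs z ^+ n.

Lemma psumS v n z : psum v n.+1 z = psum v n z + z ^+ n *: v n.
Proof. by rewrite /psum big_ord_recr. Qed.

Lemma psum_shift v n z : psum v n.+1 z = v 0%N + z *: psum (fun k => v k.+1) n z.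
Proof.
rewrite /psum big_ord_recl expr0 scale1r scaler_sumr; congr (_ + _).
by apply: eq_bigr => k _; rewrite scalerA -exprS.
Qed.

Lemma psum_tail v C z m n : 0 <= C -> (forall k, rnorm (v k) <= C) -> cabs z < 1 -> (m <= n)%N ->
  rnorm (psum v n z - psum v m z) <= C / (1 - cabs z) * cabs z ^+ m.
Proof.
move=> C0 hv z1 mn; set r := cabs z in z1 *; have r0 : 0 <= r by exact: cabs_ge0.
have d0 : 0 < 1 - r by rewrite subr_gt0.
have c0 : 0 <= C / (1 - r) by rewrite divr_ge0 // ltW.
suff h : rnorm (psum v n z - psum v m z) <= C / (1 - r) * (r ^+ m - r ^+ n).
  by apply: le_trans h _; apply: ler_wpM2l => //; rewrite gerBl exprn_ge0.
elim: n mn => [|n IH].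
  by rewrite leqn0 => /eqP ->; rewrite !subrr rnorm0 mulr0.
rewrite leq_eqVlt => /orP[/eqP ->|]; first by rewrite !subrr rnorm0 mulr0.
rewrite ltnS => mn; rewrite psumS addrAC; apply: le_trans (rnormD _ _) _.
have -> : C / (1 - r) * (r ^+ m - r ^+ n.+1) = C / (1 - r) * (r ^+ m - r ^+ n) + r ^+ n * C.
  by rewrite exprS; field; rewrite gt_eqF.
apply: lerD; first exact: IH.
by rewrite rnormZ cabsX; apply: ler_wpM2l (hv n); rewrite exprn_ge0.
Qed.

Lemma psum_exists v C : 0 <= C -> (forall k, rnorm (v k) <= C) -> exists F, is_psum v C F.
Proof.
move=> C0 hv.
have ex z : exists l, cabs z < 1 -> forall n, rnorm (l - psum v n z) <= C / (1 - cabs z) * cabs z ^+ n.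
  case: (ltP (cabs z) 1) => [z1|]; last by exists 0.
  have d0 : 0 < 1 - cabs z by rewrite subr_gt0.
  have hsmall e : 0 < e -> exists N, forall n, (N <= n)%N -> C / (1 - cabs z) * cabs z ^+ n <= e.
    move=> e0; have c0 : 0 <= C / (1 - cabs z) by rewrite divr_ge0 // ltW.
    have c1 : 0 < C / (1 - cabs z) + 1 by exact: ltr_wpDl.
    have [N hN] := exprn_small (cabs_ge0 z) z1 (divr_gt0 e0 c1).
    exists N => n /hN h; apply: le_trans (ler_wpM2l c0 h) _.
    rewrite mulrCA; apply: ler_piMr; first exact: ltW.
    by rewrite ler_pdivrMr // mul1r lerDl.
  have [l hl] := cauchy_limit (fun m n mn => psum_tail C0 hv z1 mn) hsmall.
  by exists l.
by have [F hF] := choice ex; exists F => z z1 n; exact: hF.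
Qed.

Lemma geometric_eq0 (x : V) C r : 0 <= r -> r < 1 -> 0 <= C ->
  (forall n, rnorm x <= C * r ^+ n) -> x = 0.
Proof.
move=> r0 r1 C0 h; apply/eqP; rewrite -rnorm_eq0 eq_le rnorm_ge0 andbT.
apply/ler_addgt0Pr => e e0; rewrite add0r.
have c1 : 0 < C + 1 by exact: ltr_wpDl.
have [N hN] := exprn_small r0 r1 (divr_gt0 e0 c1).
apply: le_trans (h N) _; apply: le_trans (ler_wpM2l C0 (hN N (leqnn N))) _.
rewrite mulrCA; apply: ler_piMr; first exact: ltW.
by rewrite ler_pdivrMr // mul1r lerDl.
Qed.

(* The coefficients of [(F z - F a) / (z - a)] are the values at [a] of the
   shifted series. *)
Lemma psum_div v C F a : 0 <= C -> (forall k, rnorm (v k) <= C) -> is_psum v C F -> cabs a < 1 ->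
  exists u G, [/\ forall k, rnorm (u k) <= C / (1 - cabs a), is_psum u (C / (1 - cabs a)) G &
    forall z, cabs z < 1 -> F z = F a + (z - a) *: G z].
Proof.
move=> C0 hv hF a1.
have da : 0 < 1 - cabs a by rewrite subr_gt0.
have D0 : 0 <= C / (1 - cabs a) by rewrite divr_ge0 // ltW.
have D2 : 0 <= 2 * (C / (1 - cabs a)) by exact: mulr_ge0 (ler0n _ _) D0.
have ex i : exists t, forall n, rnorm (t - psum (fun k => v (i + k)%N) n a) <= C / (1 - cabs a) * cabs a ^+ n.
  have [Fi hFi] := psum_exists C0 (fun k => hv (i + k)%N).
  by exists (Fi a) => n; exact: hFi.
have [T hT] := choice ex.
have TS i : T i = v i + a *: T i.+1.
  apply/eqP; rewrite -subr_eq0; apply/eqP.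
  apply: (geometric_eq0 (cabs_ge0 a) a1 D2) => n.
  have h1 := hT i n.+1; have h2 := hT i.+1 n.
  rewrite psum_shift addn0 in h1.
  have e1 : psum (fun k => v (i + k.+1)%N) n a = psum (fun k => v (i.+1 + k)%N) n a.
    by apply: eq_bigr => k _; rewrite addnS addSn.
  rewrite e1 in h1; set P := psum _ n a in h1 h2.
  have -> : T i - (v i + a *: T i.+1) = (T i - (v i + a *: P)) - a *: (T i.+1 - P).
    by rewrite scalerBr; zmod.
  apply: le_trans (rnormD _ _) _; rewrite rnormN rnormZ.
  have c0 := cabs_ge0 a.
  have E0 : 0 <= C / (1 - cabs a) * cabs a ^+ n by rewrite mulr_ge0 // exprn_ge0.
  have h3 := ler_wpM2l c0 h2.
  move: h1; rewrite exprS mulrCA => h1.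
  have : cabs a * (C / (1 - cabs a) * cabs a ^+ n) <= C / (1 - cabs a) * cabs a ^+ n.
    by rewrite ler_piMl // ltW.
  rewrite -mulrA; lra.
have T0 : F a = T 0%N.
  apply/eqP; rewrite -subr_eq0; apply/eqP.
  apply: (geometric_eq0 (cabs_ge0 a) a1 D2) => n.
  have h1 := hF a a1 n; have h2 := hT 0%N n.
  have -> : F a - T 0%N = (F a - psum v n a) - (T 0%N - psum v n a) by zmod.
  apply: le_trans (rnormD _ _) _; rewrite rnormN -mulrA.
  by have := lerD h1 h2; rewrite /psum /=; lra.
have Tb i : rnorm (T i) <= C / (1 - cabs a).
  by have := hT i 0%N; rewrite /psum big_ord0 subr0 expr0 mulr1.
have [G hG] := psum_exists D0 (fun k => Tb k.+1).
exists (fun k => T k.+1), G; split=> // z z1.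
have SE n : psum v n z = F a + (z - a) *: psum (fun k => T k.+1) n z - z ^+ n *: T n.
  elim: n => [|n IH].
    by rewrite /psum !big_ord0 scaler0 addr0 expr0 scale1r T0 subrr.
  rewrite !psumS IH.
  have -> : v n = T n - a *: T n.+1 by rewrite TS addrK.
  have -> : (z - a) *: (psum (fun k => T k.+1) n z + z ^+ n *: T n.+1) =
     (z - a) *: psum (fun k => T k.+1) n z + (z ^+ n.+1 *: T n.+1 - z ^+ n *: (a *: T n.+1)).
    by rewrite scalerDr !scalerA -scalerBl; congr (_ + _ *: _); rewrite exprS; ring.
  by rewrite scalerBr; zmod.
apply/eqP; rewrite -subr_eq0; apply/eqP.
have dz : 0 < 1 - cabs z by rewrite subr_gt0.
have c1 : 0 <= C / (1 - cabs z) by rewrite divr_ge0 // ltW.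
have c2 : 0 <= C / (1 - cabs a) / (1 - cabs z) by rewrite divr_ge0 // ltW.
apply: (@geometric_eq0 _ (C / (1 - cabs z) + cabs (z - a) * (C / (1 - cabs a) / (1 - cabs z)) + C / (1 - cabs a)) (cabs z)) => //.
- exact: cabs_ge0.
- by rewrite !addr_ge0 // mulr_ge0 // cabs_ge0.
move=> n.
have -> : F z - (F a + (z - a) *: G z) =
   (F z - psum v n z) - (z - a) *: (G z - psum (fun k => T k.+1) n z) - z ^+ n *: T n.
  by rewrite {1}SE scalerBr; zmod.
apply: le_trans (rnormD _ _) _; rewrite mulrDl; apply: lerD; last first.
  by rewrite rnormN rnormZ cabsX mulrC; apply: ler_wpM2r (Tb n); rewrite exprn_ge0 // cabs_ge0.
apply: le_trans (rnormD _ _) _; rewrite mulrDl; apply: lerD; first exact: hF.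
by rewrite rnormN rnormZ -mulrA; apply: ler_wpM2l (cabs_ge0 _) _ _ (hG z z1 n).
Qed.

Lemma psum_bound v C F z : (forall k, rnorm (v k) <= C) -> is_psum v C F -> cabs z < 1 ->
  rnorm (F z) <= C / (1 - cabs z).
Proof. by move=> hv hF z1; have := hF z z1 0%N; rewrite /psum big_ord0 subr0 expr0 mulr1. Qed.

(** Two divisions give [F (a + x) = F a + x G a + x^2 K (a + x)] with [K] bounded near [a], that is
    a quadratic remainder. *)
Lemma psum_cdiff v C F a : 0 <= C -> (forall k, rnorm (v k) <= C) -> is_psum v C F -> cabs a < 1 ->
  cdiff F a.
Proof.
move=> C0 hv hF a1; have da : 0 < 1 - cabs a by rewrite subr_gt0.
have [u [G [hu hG FG]]] := psum_div C0 hv hF a1.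
have C1 : 0 <= C / (1 - cabs a) by rewrite divr_ge0 // ltW.
have [w [K [hw hK GK]]] := psum_div C1 hu hG a1.
set E := C / (1 - cabs a) / (1 - cabs a) in hw hK.
have E0 : 0 <= E by rewrite divr_ge0 // ltW.
exists (G a) => e e0.
pose B := 2 * E / (1 - cabs a).
have B0 : 0 <= B by exact: divr_ge0 (mulr_ge0 (ler0n _ _) E0) (ltW da).
exists (Num.min ((1 - cabs a) / 2) (e / (B + 1))).
  by rewrite lt_min !divr_gt0 // ltr_wpDl.
move=> x; rewrite lt_min => /andP[x1 x2].
have ax : cabs (a + x) <= (1 + cabs a) / 2 by apply: le_trans (cabsD _ _) _; lra.
have ax1 : cabs (a + x) < 1 by lra.
have ex : a + x - a = x by ring.
rewrite (FG _ ax1) ex (GK _ ax1) ex (addrC (F a)) addrK.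
have -> : x *: (G a + x *: K (a + x)) - x *: G a = (x * x) *: K (a + x).
  by rewrite scalerDr scalerA addrAC subrr add0r.
rewrite rnormZ cabsM.
have Kb : rnorm (K (a + x)) <= B.
  apply: le_trans (psum_bound hw hK ax1) _; rewrite /B.
  rewrite ler_pdivrMr ?subr_gt0 // mulrAC ler_pdivlMr //.
  have : 0 <= E * (2 * (1 - cabs (a + x)) - (1 - cabs a)) by rewrite mulr_ge0 //; lra.
  lra.
have c0 := cabs_ge0 x.
have xB : cabs x * rnorm (K (a + x)) <= e.
  apply: (@le_trans _ _ (cabs x * (B + 1))); first by apply: ler_wpM2l => //; lra.
  by rewrite -ler_pdivlMr ?ltr_wpDl // ltW.
by rewrite -mulrA mulrC; apply: ler_wpM2r.
Qed.

End power_series.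

(** * Orthonormal sequences *)

Section orthonormal.
Context {R : realType} {H : completeNormedModType R[i]}.
Variable ip : H -> H -> R[i].
Hypothesis ipL : forall (a : R[i]) (x y z : H), ip (a *: x + y) z = a * ip x z + ip y z.
Hypothesis ipC : forall x y, ip y x = (ip x y)^*%C.
Hypothesis ipN : forall x, `|x| ^+ 2 = ip x x.

Let ipD x y z : ip (x + y) z = ip x z + ip y z.
Proof. by have := ipL 1 x y z; rewrite scale1r mul1r. Qed.

Let ip0 z : ip 0 z = 0.
Proof. by have := ipD 0 0 z; rewrite addr0 => /eqP; rewrite -subr_eq0 opprD addrA subrr sub0r oppr_eq0 => /eqP. Qed.

Let ipZ a x z : ip (a *: x) z = a * ip x z.
Proof. by have := ipL a x 0 z; rewrite addr0 ip0 addr0. Qed.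

Let ip_sum n (c : nat -> R[i]) (x : nat -> H) z :
  ip (\sum_(k < n) c k *: x k) z = \sum_(k < n) c k * ip (x k) z.
Proof.
elim: n => [|n IH]; first by rewrite !big_ord0 ip0.
by rewrite !big_ord_recr /= ipD IH ipZ.
Qed.

Let rnorm_sqr x : rnorm x ^+ 2 = complex.Re (ip x x).
Proof. by rewrite -ipN norm_rnorm -rmorphXn. Qed.

Let Re_ipC x y : complex.Re (ip x y) = complex.Re (ip y x).
Proof. by rewrite (ipC y x); case: (ip y x). Qed.

Lemma pythagoras x y : ip x y = 0 -> rnorm (x + y) ^+ 2 = rnorm x ^+ 2 + rnorm y ^+ 2.
Proof.
move=> xy; rewrite !rnorm_sqr ipD ReD (Re_ipC x) (Re_ipC y) !ipD !ReD (Re_ipC y x) xy /=.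
by ring.
Qed.

Definition orthonormal (e : nat -> H) n :=
  forall i j, (i < n)%N -> (j < n)%N -> ip (e i) (e j) = (i == j)%:R.

Lemma orthonormal_extend n (e : nat -> H) : infinite_dimensional H -> orthonormal e n ->
  exists x, ip x x = 1 /\ forall i, (i < n)%N -> ip x (e i) = 0.
Proof.
move=> inf on; have [y0 hy0] := inf n (fun i : 'I_n => e i).
pose y := y0 - \sum_(i < n) ip y0 (e i) *: e i.
have y_ne : y != 0 by rewrite subr_eq0; apply/eqP; exact: hy0.
have yE : y = (-1) *: (\sum_(i < n) ip y0 (e i) *: e i) + y0 by rewrite scaleN1r addrC.
have yo i : (i < n)%N -> ip y (e i) = 0.
  move=> ni; rewrite yE ipL (ip_sum n (fun i => ip y0 (e i)) e).
  rewrite (bigD1 (Ordinal ni)) //= on // eqxx mulr1 big1; first by ring.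
  by move=> k ki; rewrite on // (_ : (k == i :> nat) = false) ?mulr0 //; apply/negbTE.
have r0 : rnorm y != 0 by rewrite rnorm_eq0.
exists (((rnorm y)^-1)%:C *: y); split; last by move=> i ni; rewrite ipZ yo // mulr0.
rewrite -ipN norm_rnorm rnormZ cabsR ger0_norm ?invr_ge0 ?rnorm_ge0 //.
by rewrite mulVf // rmorph1 expr1n.
Qed.

Lemma orthonormal_sequence : infinite_dimensional H -> exists e, forall n, orthonormal e n.
Proof.
move=> inf.
(* The choice is made as a function of the whole list of earlier vectors; on lists that are not
   orthonormal nothing is asked of it. *)
have ex (l : seq H) : exists x, orthonormal (nth 0 l) (size l) ->
    ip x x = 1 /\ forall i, (i < size l)%N -> ip x (nth 0 l i) = 0.
  have [on|non] := pselect (orthonormal (nth 0 l) (size l)); last by exists 0.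
  by have [x hx] := orthonormal_extend inf on; exists x.
have [nxt hn] := choice ex.
pose L n := iter n (fun l => rcons l (nxt l)) [::].
pose e n := nxt (L n).
have LE n : L n = mkseq e n by elim: n => [|n IH] //; rewrite mkseqS -IH.
exists e; elim=> [|n IH] //.
have on : orthonormal (nth 0 (L n)) (size (L n)).
  by rewrite LE size_mkseq => i j ni nj; rewrite !nth_mkseq //; exact: IH.
have [e1 e2] := hn _ on; rewrite -/(e n) in e1 e2.
have e3 i : (i < n)%N -> ip (e n) (e i) = 0.
  by move=> ni; have := e2 i; rewrite LE size_mkseq nth_mkseq //; apply.
move=> i j; rewrite !ltnS leq_eqVlt => /orP[/eqP ->|ni]; rewrite leq_eqVlt => /orP[/eqP ->|nj].
- by rewrite eqxx.
- by rewrite e3 // gtn_eqF.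
- by rewrite ipC e3 // conjc0 ltn_eqF.
- exact: IH.
Qed.

Lemma orthonormal_norm (e : nat -> H) (c : nat -> R[i]) n : (forall n, orthonormal e n) ->
  rnorm (\sum_(k < n) c k *: e k) ^+ 2 = \sum_(k < n) cabs (c k) ^+ 2.
Proof.
move=> on; elim: n => [|n IH]; first by rewrite !big_ord0 rnorm0 expr0n.
rewrite !big_ord_recr /= pythagoras; last first.
  rewrite ip_sum big1 // => k _; rewrite ipC ipZ (on n.+1) //; last exact: ltnW (ltn_ord k).
  by rewrite gtn_eqF // mulr0 conjc0 mulr0.
rewrite IH; congr (_ + _); rewrite rnormZ exprMn.
have -> : rnorm (e n) ^+ 2 = 1 by rewrite rnorm_sqr (on n.+1) // eqxx.
by rewrite mulr1.
Qed.

End orthonormal.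

(** * Logarithmic sums *)

Section harmonic.
Context {R : realType}.

(** The squared norm on [|z| = r] of the [n]-th partial sum of the counterexample. *)
Definition log_sum (r : R) n : R := \sum_(k < n) r ^+ (2 * k) / k.+1%:R.

Lemma log_sum_mono (r : R) m n : 0 <= r -> (m <= n)%N -> log_sum r m <= log_sum r n.
Proof.
move=> r0 mn; rewrite /log_sum -!(big_mkord xpredT (fun k => r ^+ (2 * k) / k.+1%:R)).
rewrite [leRHS](big_cat_nat (leq0n _) mn) //= lerDl sumr_ge0 // => k _.
by rewrite divr_ge0 // exprn_ge0.
Qed.

Lemma harmonic_dyadic i : i%:R / 2 <= \sum_(k < 2 ^ i) (k.+1%:R : R)^-1 <= 1 + i%:R.
Proof.
elim: i => [|i /andP[IH1 IH2]].
  by rewrite expn0 big_ord1 invr1 mul0r addr0 ler01 lexx.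
have P0 : 0 < (2 ^ i)%:R :> R by rewrite ltr0n expn_gt0.
rewrite expnS mul2n -addnn big_split_ord /= -(natr1 i).
have u : \sum_(k < 2 ^ i) ((2 ^ i + k).+1%:R : R)^-1 <= 1.
  apply: (@le_trans _ _ (\sum_(k < 2 ^ i) ((2 ^ i)%:R : R)^-1)).
    by apply: ler_sum => k _; rewrite lef_pV2 ?posrE // ler_nat -addnS leq_addr.
  by rewrite sumr_const card_ord -[_ *+ _]mulr_natl divff // gt_eqF.
have l : 2^-1 <= \sum_(k < 2 ^ i) ((2 ^ i + k).+1%:R : R)^-1.
  apply: (@le_trans _ _ (\sum_(k < 2 ^ i) ((2 ^ i + 2 ^ i)%:R : R)^-1)).
    rewrite sumr_const card_ord -[leRHS]mulr_natl natrD ler_pdivlMr ?addr_gt0 //; lra.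
  apply: ler_sum => k _; rewrite lef_pV2 ?posrE ?ltr0n ?addn_gt0 ?expn_gt0 // ler_nat.
  by rewrite -addnS leq_add2l.
by apply/andP; split; lra.
Qed.

(** The first [2^J] terms are at most the harmonic sum, hence [1 + J] together; the others are at
    most [2^-J r^k], with sum at most [2^-J / (1 - r) <= 1]. *)
Lemma log_sum_le (r : R) (J n : nat) : 0 <= r -> 2 ^- J <= 1 - r -> log_sum r n <= J%:R + 2.
Proof.
move=> r0 hJ; have P0 : 0 < (2 : R) ^- J by rewrite invr_gt0 exprn_gt0.
have r1 : r < 1 by lra.
apply: le_trans (log_sum_mono r0 (leq_addl (2 ^ J) n)) _.
rewrite /log_sum big_split_ord /=.
have h1 : \sum_(k < 2 ^ J) r ^+ (2 * k) / k.+1%:R <= 1 + J%:R.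
  have /andP[_ h] := harmonic_dyadic J; apply: le_trans h; apply: ler_sum => k _.
  by rewrite ler_piMl ?invr_ge0 // exprn_ile1 // ltW.
have geo : (1 - r) * \sum_(k < n) r ^+ k <= 1.
  by rewrite -[1 - r]opprB mulNr -subrX1 opprB gerBl exprn_ge0.
have h2 : \sum_(k < n) r ^+ (2 * (2 ^ J + k)) / (2 ^ J + k).+1%:R <= 2 ^- J * \sum_(k < n) r ^+ k.
  rewrite mulr_sumr; apply: ler_sum => k _; rewrite mulrC; apply: ler_pM.
  - by rewrite invr_ge0.
  - by rewrite exprn_ge0.
  - by rewrite -natrX lef_pV2 ?posrE ?ltr0n ?expn_gt0 // ler_nat -addnS leq_addr.
  - apply: ler_wiXn2l => //; first exact: ltW.
    by rewrite mulnDr -[X in (X <= _)%N]add0n leq_add // leq_pmull.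
have S0 : 0 <= \sum_(k < n) r ^+ k by apply: sumr_ge0 => k _; rewrite exprn_ge0.
have h3 := ler_wpM2r S0 hJ.
lra.
Qed.

(** With [r = 1 - 1 / (4 n)] and [k < n], [r^(2 k) >= 1 - 2 k / (4 n) >= 1/2]; so half of the
    harmonic sum up to [n = 2^i] remains, at least [i / 4]. *)
Lemma log_sum_unbounded (T : R) : exists r n, 0 < r < 1 /\ T <= log_sum r n.
Proof.
pose i := Num.Def.archi_bound (4 * `|T|).
have hi : 4 * `|T| <= i%:R by rewrite ltW // archi_boundP // mulr_ge0.
pose n := (2 ^ i)%N; have n0 : 0 < n%:R :> R by rewrite ltr0n expn_gt0.
pose r : R := 1 - (4 * n%:R)^-1.
have n1 : 1 <= n%:R :> R by rewrite ler1n expn_gt0.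
have x0 : 0 < (4 * n%:R)^-1 :> R by rewrite invr_gt0 mulr_gt0.
have x1 : (4 * n%:R)^-1 <= 4^-1 :> R by rewrite lef_pV2 ?posrE ?mulr_gt0 //; lra.
have r01 : 0 < r < 1 by rewrite /r; apply/andP; split; lra.
exists r, n; split=> //; have /andP[r0 r1] := r01.
have bern k : 1 - k%:R * (4 * n%:R)^-1 <= r ^+ k.
  elim: k => [|k IH]; first by rewrite mul0r subr0 expr0.
  rewrite exprS -(natr1 k); have k0 : 0 <= k%:R * ((4 * n%:R)^-1 * (4 * n%:R)^-1) :> R.
    by rewrite mulr_ge0 // mulr_ge0 // ltW.
  apply: le_trans (ler_wpM2l (ltW r0) IH); rewrite /r.
  rewrite [leRHS](_ : _ = 1 - (k%:R + 1) * (4 * n%:R)^-1 + k%:R * ((4 * n%:R)^-1 * (4 * n%:R)^-1)); last by ring.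
  by rewrite lerDl.
have half k : (k < n)%N -> 2^-1 <= r ^+ (2 * k).
  move=> kn; apply: le_trans (bern _).
  have : (2 * k)%:R * (4 * n%:R)^-1 <= 2^-1 :> R.
    rewrite ler_pdivrMr ?mulr_gt0 // natrM.
    have : k%:R <= n%:R :> R by rewrite ler_nat ltnW.
    lra.
  lra.
have /andP[hlow _] := harmonic_dyadic i.
apply: (@le_trans _ _ (\sum_(k < n) 2^-1 * (k.+1%:R)^-1)).
  by rewrite -mulr_sumr; have := ler_norm T; rewrite -/n in hlow; lra.
by apply: ler_sum => k _; apply: ler_wpM2r; rewrite ?invr_ge0 //; exact: half.
Qed.

End harmonic.

Section counterexample.
Context {R : realType} {H : completeNormedModType R[i]}.

(** The sums [log_sum] increase to [|F z|^2]; this limit is expressed as a least upper bound. *)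
Lemma unbounded_analytic : hilbert H -> infinite_dimensional H -> exists F : R[i] -> H,
  forall z, cabs z < 1 -> [/\ cdiff F z,
    forall n, log_sum (cabs z) n <= rnorm (F z) ^+ 2 &
    forall B, (forall n, log_sum (cabs z) n <= B) -> rnorm (F z) ^+ 2 <= B].
Proof.
move=> [ip [ipL [ipC ipN]]] inf.
have [e on] := orthonormal_sequence ipL ipC ipN inf.
pose c k : R := (Num.sqrt k.+1%:R)^-1.
have c0 k : 0 <= c k by rewrite invr_ge0 sqrtr_ge0.
pose v k : H := (c k)%:C *: e k.
have e1 k : rnorm (e k) = 1.
  have : rnorm (e k) ^+ 2 = 1.
    have := ipN (e k); rewrite norm_rnorm (on k.+1) // eqxx -rmorphXn /= => h.
    by apply: complexI; rewrite h.
  by move=> /eqP; rewrite sqrp_eq1 ?rnorm_ge0 // => /eqP.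
have v1 k : rnorm (v k) <= 1.
  rewrite rnormZ e1 mulr1 cabsR ger0_norm //.
  rewrite invf_le1 ?sqrtr_gt0 // -[leLHS]sqrtr1 ler_sqrt //.
  by rewrite ler1n.
have [F hF] := psum_exists ler01 v1.
exists F => z z1.
have SE n : rnorm (psum v n z) ^+ 2 = log_sum (cabs z) n.
  rewrite /psum (eq_bigr (fun k : 'I_n => (z ^+ k * (c k)%:C) *: e k)); last first.
    by move=> k _; rewrite scalerA.
  rewrite (orthonormal_norm ipL ipC ipN (fun k => z ^+ k * (c k)%:C)) //.
  apply: eq_bigr => k _; rewrite cabsM cabsX cabsR ger0_norm // exprMn -exprM mulnC.
  by rewrite exprVn sqr_sqrtr.
have d0 : 0 < 1 - cabs z by rewrite subr_gt0.
have D0 : 0 < 1 / (1 - cabs z) by rewrite divr_gt0.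
have err ep : 0 < ep -> exists N, forall n, (N <= n)%N -> rnorm (F z - psum v n z) <= ep.
  move=> ep0; have [N hN] := exprn_small (cabs_ge0 z) z1 (divr_gt0 ep0 D0).
  exists N => n /hN h; apply: le_trans (hF z z1 n) _.
  by rewrite mulrC -ler_pdivlMr.
split.
- exact: (psum_cdiff ler01 v1 hF z1).
- move=> n; rewrite -SE ler_pXn2r ?nnegrE ?rnorm_ge0 //.
  apply/ler_addgt0Pr => ep ep0; have [N hN] := err ep ep0.
  have := hN (maxn N n) (leq_maxl _ _); rewrite rnormB => h1.
  have h2 := rnorm_sub (psum v (maxn N n) z) (F z).
  have h3 : rnorm (psum v n z) <= rnorm (psum v (maxn N n) z).
    rewrite -(@ler_pXn2r _ 2) ?nnegrE ?rnorm_ge0 // !SE.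
    by apply: log_sum_mono; rewrite ?cabs_ge0 // leq_maxr.
  lra.
- move=> B hB; have B0 : 0 <= B by apply: le_trans (hB 0%N); rewrite /log_sum big_ord0.
  rewrite -[leRHS](sqr_sqrtr B0) ler_pXn2r ?nnegrE ?rnorm_ge0 ?sqrtr_ge0 //.
  apply/ler_addgt0Pr => ep ep0; have [N hN] := err ep ep0.
  have h1 := hN N (leqnn N); have h2 := rnorm_sub (F z) (psum v N z).
  have h3 : rnorm (psum v N z) <= Num.sqrt B.
    by rewrite -(@ler_pXn2r _ 2) ?nnegrE ?rnorm_ge0 ?sqrtr_ge0 // SE sqr_sqrtr.
  lra.
Qed.

End counterexample.

(** * Finiteness of the norm *)

Section finite_norm.
Context {R : realType} {H : completeNormedModType R[i]}.
Variables (s : R) (F : R[i] -> H).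
Hypothesis s0 : s < 0.
Hypothesis dF : forall z, cabs z < 1 -> cdiff F z.
Hypothesis F_log : forall z, cabs z < 1 -> forall B, (forall n, log_sum (cabs z) n <= B) -> rnorm (F z) ^+ 2 <= B.

Lemma whit_dist j k (z : R[i]) : whit j k z -> 2 ^- j.+3 < 1 - cabs z <= 2 ^- j.
Proof.
have P0 i : 0 < (2 : R) ^- i by rewrite invr_gt0 exprn_gt0.
have ES i : (2 : R) ^- i.+1 = 2 ^- i / 2 by rewrite exprS invfM mulrC.
case: j => [|[|j]] //=.
  by move=> [_ h]; rewrite !ES expr0 invr1; have := cabs_ge0 z; move=> c0; apply/andP; split; lra.
by move=> [/andP[h1 h2] _]; move: h1 h2; rewrite !ES; have := P0 j; move=> p h1 h2; apply/andP; split; lra.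
Qed.

(** [2^s], the ratio of the weights [(1 - |z|)^(- s)] of successive generations. *)
Let eta : R := 2^-1 `^ (- s).
Let eta0 : 0 < eta. Proof. by rewrite powR_gt0. Qed.
Let eta1 : eta < 1.
Proof.
have s1 : 0 < - s by rewrite oppr_gt0.
have e1 : 1 `^ (- s) = 1 :> R by rewrite powR1.
rewrite /eta -[ltRHS]e1; apply: gt0_ltr_powR; rewrite ?nnegrE //.
by rewrite invf_lt1 // ltr1n.
Qed.

Let etaX j : (2 ^- j) `^ (- s) = eta ^+ j.
Proof.
rewrite -powR_mulrn ?(ltW eta0) // /eta -powRrM mulrC powRrM powR_mulrn ?invr_ge0 //.
by rewrite exprVn.
Qed.

Let box_bound j k z : whit j k z ->
  0 <= density s 2 F z <= eta ^+ j * eta ^+ j * (j%:R + 5) * (8 * 2 ^+ j).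
Proof.
move=> wz; have z1 := whit_lt1 wz; have /andP[d1 d2] := whit_dist wz.
have d0 : 0 < 1 - cabs z by rewrite subr_gt0.
rewrite density_ge0 //= /density powR_mulrn ?mulr_ge0 ?powR_ge0 ?rnorm_ge0 // exprMn.
(* [j + 5 = (j + 3) + 2], from [log_sum_le] with [J = j + 3]. *)
have F2 : rnorm (F z) ^+ 2 <= j%:R + 5.
  apply: F_log => // n; have := log_sum_le n (cabs_ge0 z) (ltW d1).
  by rewrite -(natr1 j.+2) -(natr1 j.+1) -(natr1 j); lra.
have e1 : ((1 - cabs z) `^ (- s)) ^+ 2 <= eta ^+ j * eta ^+ j.
  rewrite -expr2; apply: lerXn2r; rewrite ?nnegrE ?powR_ge0 ?exprn_ge0 ?(ltW eta0) //.
  by rewrite -etaX; apply: powR_le => //; [rewrite oppr_ge0 ltW|exact: ltW].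
apply: ler_pM.
- by rewrite mulr_ge0 ?exprn_ge0 ?powR_ge0 ?rnorm_ge0.
- by rewrite invr_ge0 ltW.
- by apply: ler_pM; rewrite ?exprn_ge0 ?powR_ge0 ?rnorm_ge0.
rewrite -[leRHS]invrK lef_pV2 ?posrE ?invr_gt0 ?mulr_gt0 ?exprn_gt0 //.
apply: le_trans (ltW d1); rewrite le_eqVlt; apply/orP; left; apply/eqP.
by congr (_^-1); rewrite !exprS; ring.
Qed.

Let C : R := 24 * 8 * 34 ^+ 2 * (5 + (1 - eta)^-1).

Let C0 : 0 <= C.
Proof.
apply: mulr_ge0.
  by apply: mulr_ge0 (exprn_ge0 _ (ler0n _ _)); exact: mulr_ge0 (ler0n _ _) (ler0n _ _).
by apply: addr_ge0 (ler0n _ _) _; rewrite invr_ge0 subr_ge0 ltW.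
Qed.

(** The powers of 2 cancel. Of the two factors [eta^j] in the squared weight, one absorbs the
    logarithm [j + 5] by [exprn_le_inv], and the other is left for a geometric series. *)
Let column_le j k : (box_column s 2 F j k <= (C * eta ^+ j)%:E)%E.
Proof.
have E0 : 0 <= eta ^+ j by rewrite exprn_ge0 // ltW.
have B0 : 0 <= eta ^+ j * eta ^+ j * (j%:R + 5) * (8 * 2 ^+ j).
  apply: mulr_ge0; last by apply: mulr_ge0 (ler0n _ _) _; rewrite exprn_ge0.
  by apply: mulr_ge0 (mulr_ge0 E0 E0) _; rewrite addr_ge0.
pose b := eta ^+ j * eta ^+ j * (j%:R + 5) * (8 * 2 ^+ j) * (2 * (17 * 2 ^- j)) ^+ 2.
apply: (@le_trans _ _ (\sum_(e < 3) (2 ^+ j.+3 * b)%:E)%E).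
  apply: lee_sum => e _.
  have x0 : (0 <= ((2 : R) ^+ j.+3)%:E)%E by rewrite lee_fin exprn_ge0.
  apply: le_trans (lee_wpmul2l x0 (whit_area_int (nb_lt j k e) B0 (@box_bound j _))) _.
  by rewrite -EFinM.
rewrite sumEFin lee_fin sumr_const card_ord -[_ *+ 3]mulr_natl.
have P : (2 : R) ^+ j != 0 by rewrite expf_neq0.
have -> : 3 * (2 ^+ j.+3 * b) = 24 * 8 * 34 ^+ 2 * (eta ^+ j * (j%:R + 5)) * eta ^+ j.
  by rewrite /b !exprS; field.
apply: ler_wpM2r => //; apply: ler_wpM2l.
  by apply: mulr_ge0 (exprn_ge0 _ (ler0n _ _)); exact: mulr_ge0 (ler0n _ _) (ler0n _ _).
have E1 : eta ^+ j <= 1 by rewrite exprn_ile1 // ltW.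
have d0 : 0 < 1 - eta by rewrite subr_gt0.
have := exprn_le_inv j (ltW eta0) (ltW eta1); rewrite mulrDr mulr1 => h1.
have h2 : eta ^+ j * j%:R <= (1 - eta)^-1.
  by rewrite -[leRHS]mul1r ler_pdivlMr // -mulrA; lra.
by rewrite mulrDr; lra.
Qed.

Lemma Fnorm_log_lty : (Fnorm s 1 2 F < +oo)%E.
Proof.
have d0 : 0 < 1 - eta by rewrite subr_gt0.
pose T := C / (1 - eta); have T0 : 0 <= T by rewrite divr_ge0 // ltW.
have series (x : R) : (\sum_(0 <= j <oo) box_column s 2 F j (idx j x) <= T%:E)%E.
  apply: lime_le; first by apply: is_cvg_nneseries => j _ _; exact: box_column_ge0.
  apply: nearW => n; apply: (@le_trans _ _ (\sum_(0 <= j < n) (C * eta ^+ j)%:E)%E).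
    by apply: lee_sum => j _; exact: column_le.
  rewrite sumEFin lee_fin -mulr_sumr; apply: ler_wpM2l => //.
  rewrite -[leRHS]mul1r ler_pdivlMr // mulrC big_mkord.
  by rewrite -[1 - eta]opprB mulNr -subrX1 opprB gerBl exprn_ge0 // ltW.
have q1 : 1 <= 2 :> R by rewrite ler1n.
rewrite /Fnorm /Tnorm; apply: poweR_lty.
apply: (@le_lt_trans _ _ (circ_int (fun x => (T `^ 2^-1)%:E))); last first.
  by have := @circ_int_step R 0 (fun=> T `^ 2^-1) (fun=> powR_ge0 _ _) => ->; exact: ltry.
apply: le_circ_int => x x01; first exact: poweR_ge0.
rewrite poweRe1 ?poweR_ge0 // /Aq -poweR_EFin.
apply: gt0_ler_poweR; rewrite ?invr_ge0 // ?in_itv /= ?leey ?andbT.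
- apply: integral_ge0 => u su; rewrite lee_fin mulr_ge0 ?powR_ge0 // invr_ge0 exprn_ge0 //.
  by have := stolz_sub (cabs_zeta x) su; have := cabs_ge0 (toC u - zeta x); lra.
- by rewrite lee_fin.
- by apply: le_trans (stolz_int_le s0 q1 dF x01) (series x).
Qed.

End finite_norm.

(** * Absence of a factorisation *)

Section no_factor.
Context {R : realType} {H : completeNormedModType R[i]}.
Variables (F g : CC R -> H) (h : CC R -> CC R).
Hypothesis F_log : forall z, cabs z < 1 -> forall n, log_sum (cabs z) n <= rnorm (F z) ^+ 2.
Hypothesis ah : analytic h.
Hypothesis hardy : (Hnorm 1 g < +oo)%E.

Let midpoint_near (x a y : R) : 0 < y -> 0 <= a -> a <= x -> x < a + y -> a + y <= 1 ->
  0 <= a + y / 2 <= 1 /\ - y <= x - (a + y / 2) <= y.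
Proof. by clear; move=> *; split; apply/andP; split; lra. Qed.

Lemma no_factor : ~ (forall z : CC R, cabs z < 1 -> F z = h z *: g z).
Proof.
move=> FE.
have h_ne z : cabs z < 1 -> h z != 0.
  move=> z1; apply/eqP => h0; have := F_log z1 1; rewrite FE // h0 scale0r rnorm0 expr0n /=.
  by rewrite /log_sum big_ord1 muln0 expr0 divr1 ler10.
have dh z : cabs z < 1 -> cdiff h z by move=> /ah/derivable_cdiff.
set G := fine (Hnorm 1 g).
have c0 : cabs (0 : R[i]) < 1 by rewrite cabs0.
set k0 := cabs (h 0)^-1.
have k00 : 0 < k0 by rewrite cabs_gt0 invr_eq0 h_ne.
have main r n : 0 < r < 1 -> Num.sqrt (log_sum r n) * k0 <= G.
  move=> /[dup] r01 /andP[r0 r1]; set A := Num.sqrt _; have A0 : 0 <= A by exact: sqrtr_ge0.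
  have rz z : cabs z <= 1 -> cabs (r%:C * z) < 1.
    move=> z1; rewrite cabsM cabsR gtr0_norm //; apply: le_lt_trans r1.
    by rewrite ler_piMr // ltW.
  pose k (z : R[i]) : CC R := (h (r%:C * z))^-1.
  have dk z : cabs z <= 1 -> cdiff k z.
    move=> z1; apply: cdiffV; first by rewrite h_ne // rz.
    apply: (@cdiff_comp _ _ h (fun z => r%:C * z)); last by apply: dh; exact: rz.
    by apply: cdiffM; [exact: cdiff_cst|exact: cdiff_id].
  have k0E : cabs (k 0) = k0 by rewrite /k mulr0.
  pose phi x := cabs (k (zeta x)).
  (* The loss [2 * e] has two sources: the circle average of [k] against [k 0], and the step
     function [lo] below [phi]. *)
  have key e : 0 < e -> A * (k0 - 2 * e) <= G.
    move=> e0.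
    have cphi x ep : 0 < ep -> exists2 d : R, 0 < d & forall y, `|y - x| < d -> `|phi y - phi x| < ep.
      move=> ep0; have zx : cabs (zeta x) <= 1 by rewrite cabs_zeta.
      have [d d0 hd] := cabs_continuous (dk _ zx) ep0.
      exists (d / 16); first by rewrite divr_gt0.
      move=> y hy; have := hd (zeta y); rewrite !rnorm_cabs; apply.
      by have := zeta_lip y x; lra.
    have [N1 hN1] := dyadic_unif_cont cphi e0.
    have [N2 hN2] := mean_value dk e0.
    pose N := maxn N1 N2.
    have P0 : 0 < (2 : R) ^- N by rewrite invr_gt0 exprn_gt0.
    pose si (i : nat) : R := (i%:R + 2^-1) / 2 ^+ N.
    pose lo i := Num.max (phi (si i) - e) 0.
    have lo0 i : 0 <= lo i by rewrite le_max lexx orbT.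
    have step : 2 ^- N * \sum_(i < 2 ^ N) A * lo i <= G.
      rewrite -lee_fin -(@circ_int_step R N (fun i => A * lo i)); last by move=> i; rewrite mulr_ge0.
      have := Hnorm_mean ltr01 r01 hardy; rewrite -/G powRr1; last by apply: fine_ge0; exact: Hnorm_ge0.
      apply: le_trans; apply: le_circ_int => x x01; first by rewrite lee_fin mulr_ge0.
      have /andP[x0 _] := x01; have z1 : cabs (r%:C * zeta x) < 1 by apply: rz; rewrite cabs_zeta.
      rewrite lee_fin powRr1 ?rnorm_ge0 //.
      have hx : phi x = (cabs (h (r%:C * zeta x)))^-1 by rewrite /phi /k cabsV.
      have hp : 0 < cabs (h (r%:C * zeta x)) by rewrite cabs_gt0 h_ne.
      have gE : rnorm (g (r%:C * zeta x)) = rnorm (F (r%:C * zeta x)) * phi x.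
        by rewrite FE // rnormZ hx mulrAC divff ?mul1r // gt_eqF.
      rewrite gE; apply: ler_pM => //.
        rewrite -(@ler_pXn2r _ 2) ?nnegrE ?rnorm_ge0 // sqr_sqrtr; last first.
          by rewrite sumr_ge0 // => i _; rewrite divr_ge0 // exprn_ge0 // ltW.
        by have := F_log z1 n; rewrite cabs_polar // ltW.
      rewrite ge_max cabs_ge0 andbT.
      have /andP[i1 i2] := idx_itv N x0; have il := idx_lt N x01; set i := idx N x in i1 i2 il *.
      have siE : si i = 2 ^- N * i%:R + 2 ^- N / 2 by rewrite /si; ring.
      rewrite -(natr1 i) mulrDr mulr1 in i2.
      have iN := @dyadic_mul R _ _ il.
      have i0 : 0 <= 2 ^- N * i%:R :> R by rewrite mulr_ge0 // ltW.
      have b12 : 0 <= si i <= 1 /\ `|x - si i| <= 2 ^- N.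
        by rewrite siE ler_norml; exact: midpoint_near P0 i0 i1 i2 iN.
      have [b1 b2] := b12.
      by have := hN1 N (leq_maxl _ _) (si i) x b1 b2; rewrite ler_norml => /andP[l1 l2]; lra.
    apply: le_trans step; rewrite -mulr_sumr mulrCA; apply: ler_wpM2l => //.
    have avg : k0 - e <= 2 ^- N * \sum_(i < 2 ^ N) phi (si i).
      have := hN2 N (leq_maxr _ _); rewrite rnormB => h1.
      have h2 := rnorm_sub (k 0) (circ_avg k N); rewrite rnorm_cabs k0E in h2.
      have h3 : rnorm (circ_avg k N) <= 2 ^- N * \sum_(i < 2 ^ N) phi (si i).
        rewrite /circ_avg rnormZ cabsR gtr0_norm //; apply: ler_wpM2l; first exact: ltW.
        exact: rnorm_sum.
      lra.
    have avg2 : 2 ^- N * \sum_(i < 2 ^ N) phi (si i) <= 2 ^- N * \sum_(i < 2 ^ N) lo i + e.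
      have eE : 2 ^- N * \sum_(i < 2 ^ N) e = e.
        by rewrite sumr_const card_ord -[e *+ _]mulr_natl natrX mulrA mulVf ?mul1r // expf_neq0.
      rewrite -[X in _ + X]eE -mulrDr -big_split /=; apply: ler_wpM2l; first exact: ltW.
      by apply: ler_sum => i _; rewrite -lerBlDr le_max lexx.
    lra.
  apply/ler_addgt0Pr => e e0; have A1 : 0 < 2 * A + 1 by rewrite ltr_wpDl // mulr_ge0.
  have := key (e / (2 * A + 1)) (divr_gt0 e0 A1); rewrite mulrBr.
  have : A * (2 * (e / (2 * A + 1))) <= e.
    rewrite (_ : A * (2 * (e / (2 * A + 1))) = e * (2 * A / (2 * A + 1))); last by ring.
    by apply: ler_piMr; [exact: ltW|rewrite ler_pdivrMr // mul1r lerDl].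
  lra.
have [r [n [r01 hT]]] := @log_sum_unbounded R ((G / k0 + 1) ^+ 2).
have := main r n r01; rewrite -ler_pdivlMr // => h1.
have G0 : 0 <= G / k0 + 1.
  by rewrite addr_ge0 // divr_ge0 ?(ltW k00) // fine_ge0 // Hnorm_ge0.
have : G / k0 + 1 <= Num.sqrt (log_sum r n).
  rewrite -(ger0_norm G0) -sqrtr_sqr; apply: ler_wsqrtr; exact: hT.
lra.
Qed.

End no_factor.

Local Close Scope complex_scope.
Local Close Scope classical_set_scope.

Theorem theorem6 (R : realType) :
  (forall (X : completeNormedModType R[i]) (s p q : R),
     s < 0 -> 0 < p -> 1 <= q ->
     exists C : R,
       forall (g : CC R -> X) (h : CC R -> CC R),
         analytic g -> (Hnorm p g < +oo)%E ->
         analytic h -> (Finfnorm s q h < +oo)%E ->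
         analytic (fun z => h z *: g z) /\
         (Fnorm s p q (fun z => h z *: g z)
            <= C%:E * Hnorm p g * Finfnorm s q h)%E)
  /\
  (forall (H : completeNormedModType R[i]) (s : R),
     hilbert H -> infinite_dimensional H -> separable_space H -> s < 0 ->
     exists f : CC R -> H,
       analytic f /\ (Fnorm s 1 2 f < +oo)%E /\
       forall (g : CC R -> H) (h : CC R -> CC R),
         analytic g -> (Hnorm 1 g < +oo)%E ->
         analytic h -> (Finfnorm s 2 h < +oo)%E ->
         ~ (forall z : CC R, cabs z < 1 -> f z = h z *: g z)).
Proof.
split=> [X s p q s0 p0 q1|H s hH inf _ s0].
  have [C _ hC] := @factor_bound R X s p q s0 p0 q1.
  exists C => g h ag hg ah hh; split; last exact: hC.
  move=> z z1; apply/derivable_cdiff; apply: cdiffZ; apply/derivable_cdiff; [exact: ah|exact: ag].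
have [F hF] := unbounded_analytic hH inf.
exists F; split; first by move=> z z1; apply/derivable_cdiff; have [] := hF z z1.
split; first by apply: Fnorm_log_lty => // z z1; have [] := hF z z1.
move=> g h ag hg ah hh; apply: no_factor => //.
by move=> z z1; have [] := hF z z1.
Qed.
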